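(* Let $1\le p\le\infty$, $p^{-1}+q^{-1}=1$, and let $(x,t)$ be an arbitrary point of $\mathbb{R}^n_+\times(0,+\infty)$. For $f\in L^p(\mathbb{R}^{n-1}\times(0,+\infty))$ let $u$ be the solution of the Dirichlet problem for the heat equation in $\mathbb{R}^n_+\times(0,+\infty)$ with zero initial data and boundary data $f$, represented by the heat double layer potential $$u(x,t)=\frac{x_n}{(4a^2\pi)^{n/2}}\int_0^t\int_{\mathbb{R}^{n-1}}\frac{e^{-\frac{|x-y|^2}{4a^2(t-\tau)}}}{(t-\tau)^{(n+2)/2}}\,f(y',\tau)\,dy'\,d\tau,\qquad y=(y',0),\ y'\in\mathbb{R}^{n-1}.$$ Then the sharp coefficient $\mathcal{W}_p(x,t)$ in the inequality $$\left|\nabla_x\left\{\frac{u(x,t)}{x_n}\right\}\right|\le \mathcal{W}_p(x,t)\,\|f\|_{p,t}$$ is given by $$\mathcal{W}_p(x,t)=\frac{c_{n,p}}{x_n^{2+\frac{n+1}{p}}}\max_{|\boldsymbol z|=1}\left\{\int_{\mathbb{S}^{n-1}}\omega_{\kappa,\lambda}\big((\boldsymbol e_\sigma,\boldsymbol e_n)\big)\,|(\boldsymbol e_\sigma,\boldsymbol e_n)|^{\frac{n+p+2}{p-1}}\,|(\boldsymbol e_\sigma,\boldsymbol z)|^{\frac{p}{p-1}}\,d\sigma\right\}^{\frac{p-1}{p}},$$ where $$c_{n,p}=\frac{2^{\frac1p}(4a^2)^{1+\frac1p}}{\pi^{\frac n2-1}\,q^{\frac n2+1+\frac1p}},\qquad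 \kappa=\frac{q x_n^2}{4a^2t}=\frac{p x_n^2}{4a^2(p-1)t},\qquad \lambda=\frac{(n+4)q}{2}-2=\frac{np+4}{2(p-1)}.$$ In particular, for $2\le p\le\infty$, $$\mathcal{W}_p(x,t)=\frac{c_{n,p}}{x_n^{2+\frac{n+1}{p}}}\left\{2\omega_{n-1}\int_0^{\pi/2}\left\{\int_{\frac{q x_n^2}{4a^2t\cos^2\vartheta}}^\infty \xi^{\frac{np+4}{2(p-1)}}e^{-\xi}\,d\xi\right\}\cos^{\frac{n+2(p+1)}{p-1}}\vartheta\,\sin^{n-2}\vartheta\,d\vartheta\right\}^{\frac{p-1}{p}}.$$ As a special case of the last formula, $$\mathcal{W}_\infty(x,t)=\frac{16a^2\sqrt{\pi}}{\Gamma\left(\frac{n-1}{2}\right)x_n^2}\int_0^{\pi/2}\left\{\int_{\frac{x_n^2}{4a^2t\cos^2\vartheta}}^\infty \xi^{n/2}e^{-\xi}\,d\xi\right\}\cos^2\vartheta\,\sin^{n-2}\vartheta\,d\vartheta.$$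
   Context: Notation: $\mathbb{R}^n_+=\{x=(x',x_n): x'\in\mathbb{R}^{n-1},\ x_n>0\}$. The Dirichlet problem is $\partial u/\partial t=a^2\Delta u$ in $\mathbb{R}^n_+\times(0,+\infty)$, $u|_{t=0}=0$, $u|_{x_n=0}=f(x',t)$; throughout, $u$ is the function given by the double layer potential formula in the claim. $\nabla_x$ is the gradient in the variables $x_1,\dots,x_n$. The norm is $\|f\|_{p,t}=\left\{\int_0^t\int_{\mathbb{R}^{n-1}}|f(x',\tau)|^p\,dx'\,d\tau\right\}^{1/p}$ for $1\le p<\infty$, and $\|f\|_{\infty,t}=\operatorname{ess\,sup}\{|f(x',\tau)|: x'\in\mathbb{R}^{n-1},\ \tau\in(0,t)\}$. ''Sharp coefficient'' means the best (smallest) coefficient for which the inequality holds at the point $(x,t)$ for all such $f$. $\mathbb{S}^{n-1}$ is the unit sphere in $\mathbb{R}^n$ with surface measure $d\sigma$; $\omega_n$ (one subscript) is the area of $\mathbb{S}^{n-1}$, so $\omega_{n-1}$ is the area of the unit sphere in $\mathbb{R}^{n-1}$. $\boldsymbol e_\sigma$ is the unit vector joining the origin to $\sigma\in\mathbb{S}^{n-1}$, $\boldsymbol e_n$ is the unit vector of the $x_n$-axis, $(\cdot,\cdot)$ is the Euclidean inner product, and the maximum is over unit vectors $\boldsymbol z\in\mathbb{R}^n$. The function $\omega_{\kappa,\lambda}$ (two subscripts) is $$\omega_{\kappa,\lambda}(u)=\int_{\kappa/u^2}^\infty \xi^\lambda e^{-\xi}\,d\xi .$$ For $p=\infty$ one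 has $q=1$, $1/p=0$, and expressions depending on $p$ are understood as their limits as $p\to\infty$.
   Formalization: The printed c_{n,p} and the coefficient of W_∞ are too large by the factor 4πa²; what is proved has c_{n,p}=2^{1/p}(4a²)^{1/p}/(π^{n/2}q^{n/2+1+1/p}) and 4/(√π Γ((n-1)/2)x_n²). For p=1, where the exponents are infinite, the formula is read as its limit as p→1+. *)

(* Defs.v *)
From HB Require Import structures.
From mathcomp Require Import all_boot all_order all_algebra.
From mathcomp Require Import all_classical all_reals all_analysis.
From mathcomp Require Import measurable_realfun.

Set Implicit Arguments.
Unset Strict Implicit.
Unset Printing Implicit Defensive.
Import Order.TTheory GRing.Theory Num.Theory.
Import numFieldNormedType.Exports.
Local Open Scope classical_set_scope.
Local Open Scope ring_scope.

(* Points that are differentiated are row vectors 'rV[R]_n, points that are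
   integrated are tuples n.-tuple R (which carry the product sigma-algebra);
   [rvec] is the identification.  The norm of 'rV[R]_n in the library is the
   sup norm, hence the separate Euclidean norm [enorm]. *)
Section euclidean.
Context {R : realType}.

Definition rvec n (y : n.-tuple R) : 'rV[R]_n := \row_i tnth y i.

Definition dotp n (u v : 'rV[R]_n) : R := \sum_i u 0 i * v 0 i.

Definition enorm n (u : 'rV[R]_n) : R := Num.sqrt (dotp u u).

Definition gradient n (g : 'rV[R]_n -> R) (x : 'rV[R]_n) : 'rV[R]_n :=
  \row_i 'D_(delta_mx 0 i) g x.

(* The last coordinate axis plays the role of the x_n-axis. *)
Definition en m : 'rV[R]_m.+1 := delta_mx 0 ord_max.
Definition xlast m (x : 'rV[R]_m.+1) : R := x 0 ord_max.

(* (y', 0) *)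
Definition bdry m (y : m.-tuple R) : 'rV[R]_m.+1 :=
  \row_i oapp (tnth y) 0 (unlift ord_max i).

End euclidean.
Arguments en {R} m.

Section lebesgue_tuple.
Context {R : realType}.
Local Notation RT := (measurableTypeR R).

Definition tcons n (p : RT * n.-tuple RT) : n.+1.-tuple RT :=
  [tuple of p.1 :: p.2].

Definition tuncons n (y : n.+1.-tuple RT) : RT * n.-tuple RT :=
  (thead y, [tuple of behead y]).

Lemma measurable_tcons n : measurable_fun setT (@tcons n).
Proof. exact: measurable_cons. Qed.

Lemma measurable_tuncons n : measurable_fun setT (@tuncons n).
Proof.
apply: measurable_fun_pair; last exact: measurable_behead.
exact: measurable_tnth.
Qed.

HB.instance Definition _ n :=
  isMeasurableFun.Build _ _ _ _ (@tcons n) (@measurable_tcons n).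

Lemma tconsK n : cancel (@tcons n) (@tuncons n).
Proof. by move=> [x y]; congr (_, _); apply/val_inj. Qed.

Lemma tunconsK n : cancel (@tuncons n) (@tcons n).
Proof. by move=> y; rewrite [RHS]tuple_eta; apply/val_inj. Qed.

Section step.
Variables (n : nat) (mu : {sigma_finite_measure set (n.-tuple RT) -> \bar R}).

Definition lebesgue_step : set (n.+1.-tuple RT) -> \bar R :=
  pushforward (lebesgue_measure \x mu)%E (@tcons n).

Let step0 : lebesgue_step set0 = 0%E.
Proof. exact: measure0. Qed.

Let step_ge0 A : (0 <= lebesgue_step A)%E.
Proof. exact: measure_ge0. Qed.

Let step_sigma_additive : semi_sigma_additive lebesgue_step.
Proof. exact: measure_semi_sigma_additive. Qed.

HB.instance Definition _ := isMeasure.Build _ _ _ lebesgue_step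
  step0 step_ge0 step_sigma_additive.

Let step_sigma_finite : sigma_finite setT lebesgue_step.
Proof.
have /sigma_finiteP[F [TF ndF Foo]] :=
  sigma_finiteT (@lebesgue_measure R : {sigma_finite_measure set RT -> \bar R}).
have /sigma_finiteP[G [TG ndG Goo]] := sigma_finiteT mu.
exists (fun k => @tuncons n @^-1` (F k `*` G k)).
  apply/seteqP; split=> // y _.
  have [i _ Fi] : (\bigcup_i F i) (tuncons y).1 by rewrite -TF.
  have [j _ Gj] : (\bigcup_j G j) (tuncons y).2 by rewrite -TG.
  exists (maxn i j) => //; split.
    by move: Fi; exact/subsetPset/ndF/leq_maxl.
  by move: Gj; exact/subsetPset/ndG/leq_maxr.
move=> k; have [mF Fk] := Foo k; have [mG Gk] := Goo k; split.
  rewrite -[X in measurable X]setTI; apply: measurable_tuncons => //.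
  exact: measurableX.
rewrite /lebesgue_step /pushforward -comp_preimage.
rewrite (_ : _ \o _ = id); last by apply/funext => y /=; rewrite tconsK.
by rewrite preimage_id product_measure1E// lte_mul_pinfty// ge0_fin_numE.
Qed.

HB.instance Definition _ := Measure_isSigmaFinite.Build _ _ _ lebesgue_step
  step_sigma_finite.

End step.

(* n-dimensional Lebesgue measure. *)
Fixpoint lebesgue_tuple n : {sigma_finite_measure set (n.-tuple RT) -> \bar R} :=
  match n with
  | 0 => [the {sigma_finite_measure set (0.-tuple RT) -> \bar R} of
           dirac [tuple]]
  | k.+1 => [the {sigma_finite_measure set (k.+1.-tuple RT) -> \bar R} of
           lebesgue_step (lebesgue_tuple k)]
  end.

End lebesgue_tuple.

Section sphere.
Context {R : realType}.
Local Notation RT := (measurableTypeR R).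

Definition usphere n : set (n.-tuple RT) := [set s | enorm (rvec s) = 1].

Definition pball n : set (n.-tuple RT) := [set y | 0 < enorm (rvec y) <= 1].

Arguments usphere : clear implicits.
Arguments pball : clear implicits.

(* y / |y|; the value at y = 0 is irrelevant. *)
Definition radial n (y : n.-tuple RT) : n.-tuple RT :=
  [tuple tnth y i / enorm (rvec y) | i < n].

Lemma measurable_enorm n :
  measurable_fun setT (fun y : n.-tuple RT => enorm (rvec y)).
Proof.
apply: (measurableT_comp (continuous_measurable_fun (@sqrt_continuous R))).
rewrite /dotp; apply: measurable_sum => i.
by apply: measurable_funM;
  under eq_fun do rewrite mxE; exact: measurable_tnth.
Qed.

Lemma measurable_pball n : measurable (pball n).
Proof.
rewrite (_ : pball n = [set y | enorm (rvec y) \in `]0, 1]])//.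
rewrite -[X in measurable X]setTI.
exact: (@measurable_enorm n measurableT `]0, 1]%classic (measurable_itv _)).
Qed.

Lemma measurable_radial n : measurable_fun setT (@radial n).
Proof.
apply/measurable_fun_tnthP => i.
rewrite (_ : _ \o _ = fun y : n.-tuple RT => tnth y i * enorm (rvec y) `^ (-1)).
  apply: measurable_funM; first exact: measurable_tnth.
  exact: (measurableT_comp (measurable_powR _) (@measurable_enorm n)).
by apply/funext => y /=; rewrite tnth_mktuple powR_inv1// sqrtr_ge0.
Qed.

HB.instance Definition _ n :=
  isMeasurableFun.Build _ _ _ _ (@radial n) (@measurable_radial n).

Definition cone_volume n : set (n.-tuple RT) -> \bar R :=
  pushforward (mrestr (lebesgue_tuple n) (@measurable_pball n)) (@radial n).

Let cone_volume0 n : cone_volume (n := n) set0 = 0%E.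
Proof. exact: measure0. Qed.

Let cone_volume_ge0 n (A : set (n.-tuple RT)) : (0 <= cone_volume A)%E.
Proof. exact: measure_ge0. Qed.

Let cone_volume_sigma_additive n : semi_sigma_additive (@cone_volume n).
Proof. exact: measure_semi_sigma_additive. Qed.

HB.instance Definition _ n := isMeasure.Build _ _ _ (@cone_volume n)
  (@cone_volume0 n) (@cone_volume_ge0 n) (@cone_volume_sigma_additive n).

(* Surface measure d(sigma) of the unit sphere, concentrated on [usphere n]:
   the area of A is n times the volume of the cone {r s | 0 < r <= 1, s in A}
   (i.e., the measure for which dy = r^(n-1) dr d(sigma)). *)
Definition surface n : {measure set (n.-tuple RT) -> \bar R} :=
  [the {measure set (n.-tuple RT) -> \bar R} of
    mscale (n%:R)%:nng (@cone_volume n)].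

Definition sphere_area n : R := fine (surface n (usphere n)).

End sphere.
Arguments usphere {R} n.
Arguments pball {R} n.
Arguments surface {R} n.
Arguments sphere_area {R} n.

Section heat.
Context {R : realType}.
Local Notation RT := (measurableTypeR R).

Definition slab m (i : interval R) : set (m.-tuple RT * RT) :=
  setT `*` [set` i].

Arguments slab : clear implicits.

Lemma measurable_slab m i : measurable (slab m i).
Proof. exact: measurableX. Qed.

(* Lebesgue measure of R^m x i, for a time interval i. *)
Definition slab_measure m (i : interval R) :
    {measure set (m.-tuple RT * RT) -> \bar R} :=
  [the {measure set (m.-tuple RT * RT)%type -> \bar R} of
    mrestr (lebesgue_tuple m \x lebesgue_measure)%E (@measurable_slab m i)].

(* f belongs to L^p(R^m x (0, +oo)); f is extended arbitrarily to t <= 0 *)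
Definition in_Lp m (p : \bar R) (f : m.-tuple RT * RT -> R) : Prop :=
  f \in Lfun (slab_measure m `]0, +oo[) p.

Definition norm_pt m (p : \bar R) (t : R) (f : m.-tuple RT * RT -> R) : \bar R :=
  Lnorm (slab_measure m `]0, t[) p (EFin \o f).

(* The double layer potential in R^n_+, n = m + 1. *)
Definition double_layer m (a : R) (f : m.-tuple RT * RT -> R)
    (x : 'rV[R]_m.+1) (t : R) : R :=
  let n : R := m.+1%:R in
  xlast x / (4 * a ^+ 2 * pi) `^ (n / 2) *
  \int[lebesgue_measure]_(tau in `]0, t[)
   \int[lebesgue_tuple m]_y
     (expR (- (enorm (x - bdry y) ^+ 2 / (4 * a ^+ 2 * (t - tau)))) /
        (t - tau) `^ ((n + 2) / 2) * f (y, tau)).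

Definition weighted_gradient m (a : R) (f : m.-tuple RT * RT -> R)
    (x : 'rV[R]_m.+1) (t : R) : 'rV[R]_m.+1 :=
  gradient (fun x => double_layer a f x t / xlast x) x.

Definition gradient_bound m (a : R) (p : \bar R) (x : 'rV[R]_m.+1) (t : R)
    (C : R) : Prop :=
  forall f : m.-tuple RT * RT -> R, in_Lp p f ->
    ((enorm (weighted_gradient a f x t))%:E <= C%:E * norm_pt p t f)%E.

Definition sharp_coefficient m (a : R) (p : \bar R) (x : 'rV[R]_m.+1) (t : R)
    (C : R) : Prop :=
  gradient_bound a p x t C /\
  forall C', gradient_bound a p x t C' -> C <= C'.

End heat.
Arguments slab {R} m i.

Section coefficient.
Context {R : realType}.

(* The value at p of an expression depending on p, which for p = +oo is
   understood as the limit as p -> +oo. *)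
Definition at_exponent (g : R -> R) (p : \bar R) : R :=
  match p with
  | r%:E%E => g r
  | _ => lim (g r @[r --> +oo])
  end.

Definition conj_exponent (p : \bar R) : R := fine (hoelder_conjugate p).

(* For u = 0 the lower limit kappa / u ^+ 2 is 0 instead of +oo; this does not
   matter below, where the factor multiplying omega vanishes for u = 0. *)
Definition omega (kappa lambda u : R) : R :=
  \int[lebesgue_measure]_(xi in `[kappa / u ^+ 2, +oo[)
    (xi `^ lambda * expR (- xi)).

Definition Gamma (s : R) : R :=
  \int[lebesgue_measure]_(xi in `]0, +oo[) (xi `^ (s - 1) * expR (- xi)).

Definition kappa (a : R) (p : \bar R) (xn t : R) : R :=
  conj_exponent p * xn ^+ 2 / (4 * a ^+ 2 * t).

Definition lambda (n : nat) (p : \bar R) : R :=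
  (n%:R + 4) * conj_exponent p / 2 - 2.

(* With q the conjugate exponent, s = t - tau and |z| = 1, the functional
   f |-> (grad (u / x_n), z) has a kernel of absolute value
     2 / (4 a^2 (4 a^2 pi)^(n/2)) |(x - y, z)| e^(-|x - y|^2 / (4 a^2 s))
       / s^((n+4)/2).
   The substitution xi = q |x - y|^2 / (4 a^2 s) in its L^q norm produces
   (4 a^2 / q)^((n+4)/2 - 1/q), and passing from the half-sphere to the whole
   sphere produces 2^(-1/q).  So the power of 4 a^2 is 1/p, that of pi is -n/2;
   a constant with (4 a^2)^(1 + 1/p) / pi^(n/2 - 1) instead, as found in print,
   is too large by the factor 4 pi a^2 (compare the stationary case f = f(x'),
   t = +oo, in which u does not depend on a). *)
Definition cnp (a : R) (n : nat) (p : \bar R) : R :=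
  let ip := fine p^-1%E in
  2 `^ ip * (4 * a ^+ 2) `^ ip /
  (pi `^ (n%:R / 2) * conj_exponent p `^ (n%:R / 2 + 1 + ip)).

Definition prefactor (a : R) (n : nat) (p : \bar R) (xn : R) : R :=
  cnp a n p / xn `^ (2 + (n%:R + 1) * fine p^-1%E).

Definition sphere_integral m (a : R) (p : \bar R) (xn t : R)
    (z : 'rV[R]_m.+1) : R :=
  let n : R := m.+1%:R in
  \int[surface m.+1]_(s in usphere m.+1)
    (omega (kappa a p xn t) (lambda m.+1 p) (dotp (rvec s) (en m)) *
     `|dotp (rvec s) (en m)| `^ at_exponent (fun r => (n + r + 2) / (r - 1)) p *
     `|dotp (rvec s) z| `^ at_exponent (fun r => r / (r - 1)) p).

Definition sphere_integrals m (a : R) (p : \bar R) (xn t : R) : set R :=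
  [set sphere_integral a p xn t z | z in [set z : 'rV[R]_m.+1 | enorm z = 1]].

(* The formula for the coefficient in dimension n = m + 1, for 1 < p. *)
Definition W_formula m (a : R) (p : \bar R) (xn t : R) : R :=
  prefactor a m.+1 p xn *
  sup (sphere_integrals m a p xn t) `^ at_exponent (fun r => (r - 1) / r) p.

(* For p = 1 the exponents are infinite, and the formula is understood as its
   limit as p -> 1. *)
Definition sharp_W m (a : R) (p : \bar R) (xn t : R) : R :=
  if p == 1%E then lim (W_formula m a r%:E xn t @[r --> 1^'+])
  else W_formula m a p xn t.

End coefficient.

(* Main.v *)
(* For a unit vector z, the functional f |-> (grad (u / x_n), z) is integration
   of f over R^(n-1) x (0, t) against a kernel K_z, so that by duality the sharp
   coefficient is the maximum over z of the L^q norm of K_z; it is a lower bound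
   for admissible coefficients because K_z has constant sign for z = e_n, where
   f = |K_z|^(q-1) is extremal in Hoelder's inequality.

   The substitution xi = q |x - y|^2 / (4 a^2 (t - tau)) and the central
   projection of the boundary hyperplane from x onto a half-sphere turn the
   L^q norm of K_z into the integral over the sphere.  The latter is maximal for
   z = e_n, for every p: as omega(u) |u|^e is nondecreasing in |u|, this is a
   rearrangement inequality for the reflection exchanging z and e_n.  Hence the
   formula with the angle theta.

   Differentiability follows from the second-order Taylor expansion of the
   Gaussian: as x_n > 0, powers of t - tau in the denominators are absorbed by
   the exponential, and all the kernels are dominated by a fixed Gaussian in y.

   For p = 1 the coefficient is the supremum of K_z for z = e_n (tested on
   indicator functions), which is the limit of the L^q norms as q -> +oo. *)
Require Import Defs.
From HB Require Import structures.
From mathcomp Require Import all_boot all_order all_algebra.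
From mathcomp Require Import all_classical all_reals all_analysis.
From mathcomp Require Import measurable_realfun ess_sup_inf.
From mathcomp Require Import ring lra.
Import Order.TTheory GRing.Theory Num.Theory.
Import numFieldNormedType.Exports.
Local Open Scope classical_set_scope.
Local Open Scope ring_scope.

Set Implicit Arguments.
Unset Strict Implicit.
Unset Printing Implicit Defensive.

(** * Integration on tuples *)

(** Integrals are first evaluated as extended real integrals of nonnegative functions, where
    Tonelli's theorem asks for no integrability; finiteness is settled once the value is known.

    Only one-dimensional derivatives occur. Affine substitutions are made one coordinate at a time,
    invariance under reflections is inherited from the Gaussian, and a nonlinear substitution [T] is
    justified by computing the measure of the preimage of every half-open interval, which determines
    the image measure.

    The Taylor remainder of the Gaussian is paid for with half of its exponent. The other half still
    absorbs every negative power of [t - tau], because the distance to the boundary is at least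
    [x_n]; hence the factors [2^-1] in the dominating kernels.

    For [p] near 1 the L^q norm is squeezed between two bounds of the form [C v^(1 - 1/r)], one from
    Chebyshev's inequality and one from interpolation between L^1 and L^oo; the powers of [v] tend
    to 1. *)

Section general.
Context d (T : measurableType d) (R : realType).
Local Open Scope ereal_scope.

Lemma ge0_integral_mrestr (mu : {measure set T -> \bar R}) (D : set T)
    (mD : measurable D) (f : T -> \bar R) :
  measurable_fun setT f -> (forall x, 0 <= f x) ->
  \int[mrestr mu mD]_x f x = \int[mu]_(x in D) f x.
Proof.
move=> mf f0; rewrite -(setUv D) ge0_integral_setU//=; first last.
- by rewrite disj_set2E setICr.
- by rewrite setUv.
- exact: measurableC.
rewrite [X in _ + X](_ : _ = 0) ?adde0.
  apply: eq_measure_integral => A mA AD; congr (mu _); exact/setIidl.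
rewrite -[RHS](integral_measure_zero (~` D) f).
apply: eq_measure_integral => A mA AD /=; rewrite /mrestr.
rewrite (_ : A `&` D = set0) ?measure0//; apply/disjoints_subset.
by move=> x /AD.
Qed.

(** The image measure is given only by its values on measurable sets, so that [nu] may be Lebesgue
    measure itself or any measure that agrees with a pushforward without being one by
    construction. *)
Lemma ge0_integral_image d' (T' : measurableType d')
    (mu : {measure set T -> \bar R}) (nu : {measure set T' -> \bar R})
    (phi : T -> T') (f : T' -> \bar R) :
  measurable_fun setT phi ->
  (forall A, measurable A -> nu A = mu (phi @^-1` A)) ->
  measurable_fun setT f -> (forall x, 0 <= f x) ->
  \int[nu]_x f x = \int[mu]_x f (phi x).
Proof.
move=> mphi numu mf f0.
transitivity (\int[mu]_(x in phi @^-1` setT) (f \o phi) x); last first.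
  by rewrite preimage_setT.
rewrite -(ge0_integral_pushforward mphi)//.
by apply: eq_measure_integral => A mA _; rewrite numu.
Qed.

End general.

Definition image_measure d d' (T : measurableType d) (T' : measurableType d')
    (R : realType) (mu : {measure set T -> \bar R}) (phi : T -> T')
    (mphi : measurable_fun setT phi) : {measure set T' -> \bar R}.
Proof. by refine (pushforward mu phi : {measure set T' -> \bar R}). Defined.

Section lebesgue_tuple.
Context {R : realType}.
Local Notation RT := (measurableTypeR R).
Local Notation mu := (@lebesgue_measure R).
Local Notation lambda n := (@lebesgue_tuple R n).
Local Open Scope ereal_scope.

Lemma measurable_affine (c b : R) :
  measurable_fun setT (fun r : RT => (c * r + b)%R : RT).
Proof. by apply: measurable_funD => //; exact: measurable_funM. Qed.

(** By uniqueness of Lebesgue measure: the right-hand side is a measure in [A] with the correct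
    value on half-open intervals. *)
Lemma lebesgue_measure_affine (c b : R) (A : set RT) : (0 < c)%R ->
  measurable A -> mu A = c%:E * mu ((fun r => c * r + b)%R @^-1` A).
Proof.
move=> c0 mA.
pose phi := fun r : RT => (c * r + b)%R : RT.
pose m : {measure set RT -> \bar R} :=
  mscale (NngNum (ltW c0)) (pushforward mu phi).
rewrite (@lebesgue_measure_unique _ (m (measurable_affine c b)))// => _ [[u v] _ <-].
rewrite /m /= /mscale/= /pushforward/=.
rewrite (_ : _ @^-1` _ = `]((u - b) / c)%R, ((v - b) / c)%R]%classic); last first.
  by apply/seteqP; split => r /=; rewrite !in_itv/= ltr_pdivrMr// ler_pdivlMr//
    ltrBlDr lerBrDr (mulrC r).
rewrite [LHS]lebesgue_measure_itv [X in _ * X]lebesgue_measure_itv/= !lte_fin ltr_pM2r ?invr_gt0// ltrD2r.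
case: ifPn => uv; last by rewrite mule0.
by rewrite -!EFinB -EFinM; congr EFin; field; exact: lt0r_neq0.
Qed.

Lemma ge0_integral_affine (c b : R) (f : RT -> \bar R) : c != 0%R ->
  measurable_fun setT f -> (forall x, 0 <= f x) ->
  \int[mu]_r f r = `|c|%:E * \int[mu]_r f (c * r + b)%R.
Proof.
have pos e (h : RT -> \bar R) : (0 < e)%R -> measurable_fun setT h ->
    (forall x, 0 <= h x) -> \int[mu]_r h r = e%:E * \int[mu]_r h (e * r + b)%R.
  move=> e0 mh h0.
  rewrite -(@ge0_integral_mscale _ _ _ mu _ measurableT (NngNum (ltW e0)))//.
    apply: (@ge0_integral_image _ _ _ _ _ (mscale (NngNum (ltW e0)) mu) mu
      (fun r : RT => (e * r + b)%R : RT)) => //.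
      exact: measurable_affine.
    by move=> A; exact: lebesgue_measure_affine.
  exact: (measurableT_comp mh (measurable_affine e b)).
move=> + mf f0; rewrite neq_lt => /orP[c0|c0]; last by rewrite gtr0_norm// -pos.
(* For [c < 0], scale by [- c > 0] and use that [r |-> - r] preserves Lebesgue measure. *)
rewrite ltr0_norm// (pos (- c)%R)// ?oppr_gt0//; congr (_ * _).
rewrite (@ge0_integral_image _ _ _ _ _ mu mu (-%R : RT -> RT))//=.
- by apply: eq_integral => r _; rewrite mulrNN.
- by move=> A mA; rewrite -lebesgue_measureN.
- exact: (measurableT_comp mf (measurable_affine _ b)).
Qed.

Lemma integral_lebesgue_tuple0 (f : 0.-tuple RT -> \bar R) :
  measurable_fun setT f -> \int[lambda 0]_y f y = f [tuple].
Proof. by move=> mf; rewrite integral_dirac// diracT mul1e. Qed.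

Lemma integral_lebesgue_tupleS n (f : n.+1.-tuple RT -> \bar R) :
  measurable_fun setT f -> (forall x, 0 <= f x) ->
  \int[lambda n.+1]_y f y = \int[mu]_r \int[lambda n]_y f (tcons (r, y)).
Proof.
move=> mf f0; rewrite (@ge0_integral_image _ _ _ _ _
  (mu \x lambda n) (lambda n.+1) (@tcons R n))//.
by rewrite fubini_tonelli1//; exact: (measurableT_comp mf (@measurable_tcons R n)).
Qed.

Lemma measurable_tcons2 n (r : RT) : measurable_fun setT (fun y => @tcons R n (r, y)).
Proof.
apply: (measurableT_comp (@measurable_tcons R n)).
exact: measurable_fun_pair.
Qed.

Definition taffine n (c : R) (b y : n.-tuple RT) : n.-tuple RT :=
  [tuple (c * tnth y i + tnth b i)%R | i < n].

Lemma measurable_taffine n c (b : n.-tuple RT) : measurable_fun setT (taffine c b).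
Proof.
apply/measurable_fun_tnthP => i.
rewrite (_ : _ \o _ = fun y => (c * tnth y i + tnth b i)%R).
  exact: (measurableT_comp (measurable_affine c (tnth b i)) (measurable_tnth i)).
by apply/funext => y /=; rewrite tnth_mktuple.
Qed.

Lemma taffine_tcons n c (b : n.+1.-tuple RT) r y :
  taffine c b (tcons (r, y)) =
  tcons ((c * r + thead b)%R : RT, taffine c [tuple of behead b] y).
Proof.
apply: eq_from_tnth => i; rewrite tnth_mktuple.
case: (unliftP ord0 i) => [j|] ->; rewrite ?tnth0 //.
by rewrite !tnthS/= tnth_mktuple (tuple_eta b) tnthS; congr (_ + tnth _ _)%R; apply/val_inj.
Qed.

(** Induction on the dimension, one coordinate at a time. Negative [c] are included because the
    projection from [x] substitutes [x' - x_n y] for [y]. *)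
Lemma ge0_integral_taffine n (c : R) (b : n.-tuple RT) (f : n.-tuple RT -> \bar R) :
  c != 0%R -> measurable_fun setT f -> (forall x, 0 <= f x) ->
  \int[lambda n]_y f y = (`|c| ^+ n)%:E * \int[lambda n]_y f (taffine c b y).
Proof.
move=> c0; elim: n b f => [|n IH] b f mf f0.
  rewrite expr0 mul1e !integral_lebesgue_tuple0//.
    by congr f; apply: eq_from_tnth => -[].
  exact: (measurableT_comp mf (measurable_taffine c b)).
rewrite !integral_lebesgue_tupleS//; last first.
  exact: (measurableT_comp mf (measurable_taffine c b)).
have mF : measurable_fun setT (fun r : RT => \int[lambda n]_y f (tcons (r, y))).
  apply: (measurable_fun_fubini_tonelli_F (f \o @tcons R n)) => //.
    exact: (measurableT_comp mf (@measurable_tcons R n)).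
  by move=> z; exact: f0.
rewrite (ge0_integral_affine (thead b) c0)//; last first.
  by move=> r; exact: integral_ge0.
under eq_integral => r _.
  rewrite (IH [tuple of behead b]) //; last first.
    exact: (measurableT_comp mf (measurable_tcons2 _)).
  over.
rewrite ge0_integralZl//=; first last.
- by move=> r _; apply: integral_ge0.
- apply: (measurable_fun_fubini_tonelli_F (fun z => f (tcons ((c * z.1 + thead b)%R : RT, taffine c [tuple of behead b] z.2)))) => //.
  apply: (measurableT_comp mf); apply: (measurableT_comp (@measurable_tcons R n)).
  apply: measurable_fun_pair.
    exact: (measurableT_comp (measurable_affine c (thead b)) measurable_fst).
  exact: (measurableT_comp (measurable_taffine c _) measurable_snd).
rewrite muleA -EFinM -exprS; congr (_ * _).
by apply: eq_integral => r _; apply: eq_integral => y _; rewrite taffine_tcons.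
Qed.

End lebesgue_tuple.

(** * Euclidean inner product and norm *)

Section euclidean.
Context {R : realType}.
Implicit Types n : nat.

Lemma dotp_ge0 n (u : 'rV[R]_n) : 0 <= dotp u u.
Proof. by apply: sumr_ge0 => i _; rewrite -expr2 sqr_ge0. Qed.

Lemma enorm_ge0 n (u : 'rV[R]_n) : 0 <= enorm u.
Proof. exact: sqrtr_ge0. Qed.

Lemma sqr_enorm n (u : 'rV[R]_n) : enorm u ^+ 2 = dotp u u.
Proof. exact/sqr_sqrtr/dotp_ge0. Qed.

Lemma dotpC n (u v : 'rV[R]_n) : dotp u v = dotp v u.
Proof. by apply: eq_bigr => i _; rewrite mulrC. Qed.

Lemma dotpDl n (u v w : 'rV[R]_n) : dotp (u + v) w = dotp u w + dotp v w.
Proof. by rewrite -big_split; apply: eq_bigr => i _; rewrite mxE mulrDl. Qed.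

Lemma dotpZl n a (u v : 'rV[R]_n) : dotp (a *: u) v = a * dotp u v.
Proof. by rewrite mulr_sumr; apply: eq_bigr => i _; rewrite mxE mulrA. Qed.

Lemma dotpDr n (u v w : 'rV[R]_n) : dotp w (u + v) = dotp w u + dotp w v.
Proof. by rewrite !(dotpC w) dotpDl. Qed.

Lemma dotpZr n a (u v : 'rV[R]_n) : dotp u (a *: v) = a * dotp u v.
Proof. by rewrite !(dotpC u) dotpZl. Qed.

Lemma dotpNl n (u v : 'rV[R]_n) : dotp (- u) v = - dotp u v.
Proof. by rewrite -scaleN1r dotpZl mulN1r. Qed.

Lemma dotpNr n (u v : 'rV[R]_n) : dotp u (- v) = - dotp u v.
Proof. by rewrite !(dotpC u) dotpNl. Qed.

Lemma dotp_eq0 n (u : 'rV[R]_n) : dotp u u = 0 -> u = 0.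
Proof.
move/eqP; rewrite psumr_eq0; last by move=> i _; rewrite -expr2 sqr_ge0.
move=> /allP u0; apply/rowP => i; rewrite mxE.
by have /eqP := u0 i (mem_index_enum _); move/eqP; rewrite mulf_eq0 orbb => /eqP.
Qed.

Lemma enorm_eq0 n (u : 'rV[R]_n) : enorm u = 0 -> u = 0.
Proof. by move=> u0; apply: dotp_eq0; rewrite -sqr_enorm u0 expr0n. Qed.

Lemma enormZ n a (u : 'rV[R]_n) : enorm (a *: u) = `|a| * enorm u.
Proof. by rewrite /enorm dotpZl dotpZr mulrA -expr2 sqrtrM ?sqr_ge0// sqrtr_sqr. Qed.

Lemma dotp_en m (u : 'rV[R]_m.+1) : dotp u (en m) = u 0 ord_max.
Proof.
rewrite /dotp (bigD1 ord_max)//= big1 ?addr0; last first.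
  by move=> i im; rewrite mxE eqxx (negbTE im) mulr0.
by rewrite mxE !eqxx mulr1.
Qed.

Lemma enorm_en m : enorm (en m : 'rV[R]_m.+1) = 1.
Proof. by rewrite /enorm dotp_en mxE !eqxx sqrtr1. Qed.

(* Cauchy-Schwarz through the discriminant: |v|^2 u - (u, v) v has a
   nonnegative square. *)
Lemma dotp_le n (u v : 'rV[R]_n) : `|dotp u v| <= enorm u * enorm v.
Proof.
have [v0|v0] := eqVneq (dotp v v) 0.
  have -> : v = 0 by exact: dotp_eq0.
  by rewrite -(scale0r 0) dotpZr mul0r normr0 mulr_ge0// enorm_ge0.
rewrite -(@ler_pXn2r _ 2%N)// ?nnegrE ?mulr_ge0 ?enorm_ge0//.
rewrite exprMn !sqr_enorm real_normK ?num_real//.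
have vp : 0 < dotp v v by rewrite lt0r v0 dotp_ge0.
have := dotp_ge0 (dotp v v *: u - dotp u v *: v).
rewrite !(dotpDl, dotpDr, dotpNl, dotpNr, dotpZl, dotpZr) (dotpC v u).
set a := dotp v v in vp *; set b := dotp u v; set c := dotp u u.
have -> : a * (a * c - b * b) + (a * - (b * b) - b * - (b * a))
  = a * (c * a - b ^+ 2) by ring.
by rewrite pmulr_rge0// subr_ge0.
Qed.

End euclidean.

Section lebesgue_tuple.
Context {R : realType}.
Local Notation RT := (measurableTypeR R).
Local Notation mu := (@lebesgue_measure R).
Local Notation lambda n := (@lebesgue_tuple R n).

Definition tsnoc n (y : n.-tuple RT) (r : RT) : n.+1.-tuple RT :=
  [tuple of rcons y r].

Definition tuple_of_rV n (u : 'rV[R]_n) : n.-tuple RT := [tuple u 0 i | i < n].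

Lemma tuple_of_rVK n : cancel (@tuple_of_rV n) (@rvec R n).
Proof. by move=> u; apply/rowP => i; rewrite mxE tnth_mktuple. Qed.

Lemma rvecK n : cancel (@rvec R n) (@tuple_of_rV n).
Proof. by move=> u; apply: eq_from_tnth => i; rewrite tnth_mktuple mxE. Qed.

Lemma rvec_taffine n c (b y : n.-tuple RT) :
  rvec (taffine c b y) = c *: rvec y + rvec b.
Proof. by apply/rowP => i; rewrite !mxE tnth_mktuple. Qed.

Lemma dotp_tcons n (r s : RT) (y z : n.-tuple RT) :
  dotp (rvec (tcons (r, y))) (rvec (tcons (s, z))) = r * s + dotp (rvec y) (rvec z).
Proof.
rewrite /dotp big_ord_recl !mxE !tnth0; congr (_ + _).
by apply: eq_bigr => i _; rewrite !mxE !tnthS.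
Qed.

Lemma tnth_tsnoc_max n (y : n.-tuple RT) r : tnth (tsnoc y r) ord_max = r.
Proof. by rewrite (tnth_nth 0) nth_rcons size_tuple ltnn eqxx. Qed.

Lemma tnth_tsnoc_lift n (y : n.-tuple RT) r (i : 'I_n) :
  tnth (tsnoc y r) (lift ord_max i) = tnth y i.
Proof.
by rewrite !(tnth_nth 0) lift_max nth_rcons size_tuple ltn_ord.
Qed.

Lemma rvec_tsnoc n (y : n.-tuple RT) r :
  rvec (tsnoc y r) = bdry y + r *: en n.
Proof.
apply/rowP => i; rewrite !mxE eqxx /=.
case: (unliftP ord_max i) => [j|] ->.
  by rewrite tnth_tsnoc_lift eq_sym (negbTE (neq_lift _ _)) mulr0 addr0.
by rewrite tnth_tsnoc_max eqxx mulr1 add0r.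
Qed.

Lemma dotp_bdry n (y z : n.-tuple RT) :
  dotp (bdry y) (bdry z) = dotp (rvec y) (rvec z).
Proof.
rewrite /dotp big_ord_recr/= !mxE unlift_none/= mulr0 addr0.
apply: eq_bigr => i _; rewrite !mxE.
have -> : widen_ord (leqnSn n) i = lift ord_max i.
  by apply: val_inj; rewrite /= /bump leqNgt ltn_ord.
by rewrite liftK.
Qed.

Lemma measurable_tsnoc n :
  measurable_fun setT (fun p : n.-tuple RT * RT => tsnoc p.1 p.2).
Proof.
apply/measurable_fun_tnthP => i; case: (unliftP ord_max i) => [j|] ->.
- rewrite (_ : _ \o _ = fun p => tnth p.1 j).
    exact: (measurableT_comp (measurable_tnth j) measurable_fst).
  by apply/funext => p /=; rewrite tnth_tsnoc_lift.
- rewrite (_ : _ \o _ = snd); first exact: measurable_snd.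
  by apply/funext => p /=; rewrite tnth_tsnoc_max.
Qed.

(** [lebesgue_tuple] is built by adding first coordinates, whereas [x_n] is the last one; the
    induction carries the last coordinate past all the others. *)
Lemma ge0_integral_tsnoc n (f : n.+1.-tuple RT -> \bar R) :
  measurable_fun setT f -> (forall x, 0 <= f x)%E ->
  (\int[lambda n.+1]_y f y = \int[lambda n]_y \int[mu]_r f (tsnoc y r))%E.
Proof.
elim: n f => [|n IH] f mf f0.
  rewrite integral_lebesgue_tupleS// integral_lebesgue_tuple0; last first.
    apply: (measurable_fun_fubini_tonelli_F (fun z => f (tsnoc z.1 z.2))) => //.
    exact: (measurableT_comp mf (@measurable_tsnoc 0)).
  apply: eq_integral => r _; rewrite integral_lebesgue_tuple0; last first.
    exact: (measurableT_comp mf (measurable_tcons2 _)).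
  by congr f; apply/val_inj.
rewrite integral_lebesgue_tupleS// [RHS]integral_lebesgue_tupleS//=; first last.
- by move=> y; exact: integral_ge0.
- apply: (measurable_fun_fubini_tonelli_F (fun z => f (tsnoc z.1 z.2))) => //.
  exact: (measurableT_comp mf (@measurable_tsnoc n.+1)).
apply: eq_integral => r _; rewrite IH//; last first.
  exact: (measurableT_comp mf (measurable_tcons2 _)).
by apply: eq_integral => y _; apply: eq_integral => s _; congr f; apply/val_inj.
Qed.

(** Besides its use for isometries, this value yields the finiteness and the positivity of the
    volume of the unit ball, and the relation between the area of the sphere and [Gamma]. *)
Lemma integral_gauss_tuple n :
  (\int[lambda n]_y (expR (- enorm (rvec y) ^+ 2))%:E = (Num.sqrt pi ^+ n)%:E)%E.
Proof.
have mg k : measurable_fun setT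
    (fun y : k.-tuple RT => (expR (- enorm (rvec y) ^+ 2))%:E).
  apply/measurable_EFinP; apply: measurableT_comp => //.
  apply: measurableT_comp => //; apply: measurable_funX.
  exact: measurable_enorm.
elim: n => [|n IH].
  rewrite integral_lebesgue_tuple0// expr0.
  by rewrite sqr_enorm /dotp big_ord0 oppr0 expR0.
rewrite integral_lebesgue_tupleS//.
under eq_integral => r _.
  under eq_integral => y _.
    rewrite sqr_enorm dotp_tcons opprD expRD EFinM -sqr_enorm.
    over.
  rewrite ge0_integralZl ?IH//=; last exact: mg.
  over.
rewrite ge0_integralZr//=; last first.
  apply/measurable_EFinP; apply: measurableT_comp => //.
  by apply: measurableT_comp => //; exact: measurable_funM.
rewrite exprS EFinM; congr (_ * _)%E.
by rewrite -integralT_gauss; apply: eq_integral => r _; rewrite /gauss_fun expr2.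
Qed.

(* Convoluting with the Gaussian, which T preserves, compares the integrals of
   f o T and of f, as in the proof of the uniqueness of the Haar measure. *)
Lemma ge0_integral_isometry n (T : n.-tuple RT -> n.-tuple RT)
    (f : n.-tuple RT -> \bar R) :
  measurable_fun setT T -> involutive T ->
  (forall x y, T (taffine (-1) x y) = taffine (-1) (T x) (T y)) ->
  (forall x, enorm (rvec (T x)) = enorm (rvec x)) ->
  measurable_fun setT f -> (forall x, 0 <= f x)%E ->
  (\int[lambda n]_x f (T x) = \int[lambda n]_x f x)%E.
Proof.
move=> mT TK Tsub Tnorm mf f0.
pose g (y : n.-tuple RT) : \bar R := (expR (- enorm (rvec y) ^+ 2))%:E.
have mg : measurable_fun setT g.
  apply/measurable_EFinP; apply: measurableT_comp => //.
  apply: measurableT_comp => //; apply: measurable_funX.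
  exact: measurable_enorm.
have g0 y : (0 <= g y)%E by rewrite lee_fin expR_ge0.
have gT y : g (T y) = g y by rewrite /g Tnorm.
have msub : measurable_fun setT
    (fun p : n.-tuple RT * n.-tuple RT => taffine (-1) p.2 (T p.1)).
  apply/measurable_fun_tnthP => i.
  rewrite (_ : _ \o _ = fun p => -1 * tnth (T p.1) i + tnth p.2 i); last first.
    by apply/funext => p /=; rewrite tnth_mktuple.
  apply: measurable_funD.
    apply: measurable_funM => //.
    apply: (measurableT_comp (measurable_tnth i)).
    exact: (measurableT_comp mT measurable_fst).
  exact: (measurableT_comp (measurable_tnth i) measurable_snd).
have msub2 x : measurable_fun setT (fun y => taffine (-1) y (T x)).
  exact: (measurableT_comp msub (pair1_measurable x)).
have msub1 y : measurable_fun setT (fun x => taffine (-1) y (T x)).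
  exact: (measurableT_comp msub (pair2_measurable y)).
have subK (x y : n.-tuple RT) : taffine (-1) y (taffine (-1) y x) = x.
  by apply: eq_from_tnth => i; rewrite !tnth_mktuple; ring.
(* Translation invariance: [taffine (-1) y x] is [y - x]. *)
have shift (h : n.-tuple RT -> \bar R) : measurable_fun setT h ->
    (forall y, 0 <= h y)%E -> forall x : n.-tuple RT,
    (\int[lambda n]_y h y = \int[lambda n]_y h (taffine (-1) y x))%E.
  move=> mh h0 x.
  rewrite (ge0_integral_taffine (taffine (-1) [tuple 0 | i < n] x) (oner_neq0 _))//.
  rewrite normr1 expr1n mul1e; apply: eq_integral => y _; congr h.
  by apply: eq_from_tnth => i; rewrite !tnth_mktuple; ring.
have intg : (\int[lambda n]_y g y = (Num.sqrt pi ^+ n)%:E)%E.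
  exact: integral_gauss_tuple.
have c0 : 0 < Num.sqrt pi ^+ n :> R by rewrite exprn_gt0// sqrtr_gt0 pi_gt0.
suff : ((Num.sqrt pi ^+ n)%:E * \int[lambda n]_x f (T x) =
        (Num.sqrt pi ^+ n)%:E * \int[lambda n]_x f x)%E.
  move/(congr1 (fun e => ((Num.sqrt pi ^+ n)^-1)%:E * e)%E).
  by rewrite !muleA -!EFinM mulVf ?gt_eqF// !mul1e.
have mfT : measurable_fun setT (f \o T) by exact: measurableT_comp.
rewrite -intg -ge0_integralZl//=; last exact: integral_ge0.
transitivity (\int[lambda n]_x \int[lambda n]_y
    (f (T x) * g (taffine (-1) y (T x))))%E.
  apply: eq_integral => x _; rewrite ge0_integralZl//=; last first.
    exact: (measurableT_comp mg (msub2 x)).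
  by rewrite -(shift g mg g0 (T x)); exact: muleC.
transitivity (\int[lambda n]_y \int[lambda n]_x
    (f (T x) * g (taffine (-1) y (T x))))%E.
  apply: (fubini_tonelli (fun p => f (T p.1) * g (taffine (-1) p.2 (T p.1)))%E).
    apply: emeasurable_funM; first exact: (measurableT_comp mfT measurable_fst).
    exact: (measurableT_comp mg msub).
  by move=> p; rewrite mule_ge0.
(* Substitute [T y - x] for [x]. Since [T] respects differences and [T (T y) = y], the argument of
   [f] becomes [y - T x] and that of [g] becomes [T x], where [g] takes the value [g x]. *)
transitivity (\int[lambda n]_y \int[lambda n]_x
    (f (taffine (-1) y (T x)) * g x))%E.
  apply: eq_integral => y _.
  rewrite (ge0_integral_taffine (T y) (_ : -1 != 0)); first last.
  - by move=> x; rewrite mule_ge0.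
  - apply: emeasurable_funM => //; exact: (measurableT_comp mg (msub1 y)).
  - by rewrite oppr_eq0 oner_eq0.
  rewrite normrN1 expr1n mul1e; apply: eq_integral => x _.
  by rewrite Tsub TK subK gT.
transitivity (\int[lambda n]_x \int[lambda n]_y
    (f (taffine (-1) y (T x)) * g x))%E.
  apply/esym.
  apply: (fubini_tonelli (fun p => f (taffine (-1) p.2 (T p.1)) * g p.1)%E).
    apply: emeasurable_funM; first exact: (measurableT_comp mf msub).
    exact: (measurableT_comp mg measurable_fst).
  by move=> p; rewrite mule_ge0.
rewrite -ge0_integralZr//=; last exact: integral_ge0.
apply: eq_integral => x _; rewrite ge0_integralZr//=; last first.
  exact: (measurableT_comp mf (msub2 x)).
by rewrite -(shift f mf f0 (T x)); exact: muleC.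
Qed.

End lebesgue_tuple.

(** * Change of variables through distribution functions *)

Section density.
Context d (X : measurableType d) (R : realType).
Local Notation RT := (measurableTypeR R).
Local Notation leb := (@lebesgue_measure R).
Local Open Scope ereal_scope.

Lemma eq_measure_ocitv (m1 m2 : {measure set RT -> \bar R}) :
  (forall c e : R, m1 `]c, e]%classic = m2 `]c, e]%classic) ->
  (forall c e : R, m1 `]c, e]%classic < +oo) ->
  forall A, measurable A -> m1 A = m2 A.
Proof.
move=> m12 m1oo A mA.
apply: (@measure_unique _ R RT (@ocitv R)
  (fun n => `](- n%:R)%R, n%:R]%classic)) => //.
- exact: ocitvI.
- by move=> n; exact: is_ocitv.
- apply/seteqP; split => // r _; exists (Num.truncn `|r|).+1 => //=.
  have := truncnS_gt `|r|%R; rewrite ltr_norml in_itv/= => /andP[].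
  by move=> -> /ltW ->.
- by move=> _ [[c e] _ <-]; exact: m12.
Qed.

(** The density [D] on [S] is encoded by planar Lebesgue measure on the region under its graph;
    [density_measure], the image under the first projection, is then a measure without further
    proof. *)
Definition undergraph (S : set RT) (D : RT -> R) : set (RT * RT) :=
  [set p | S p.1 /\ (0 < p.2 < D p.1)%R].

Lemma measurable_bool_set d' (T : measurableType d') (f : T -> bool) :
  measurable_fun setT f -> measurable [set x | f x].
Proof.
move=> mf; have := mf measurableT [set true] I.
by rewrite setTI; congr (measurable _).
Qed.

Lemma measurable_undergraph S D : measurable S -> measurable_fun setT D ->
  measurable (undergraph S D).
Proof.
move=> mS mD.
rewrite (_ : undergraph S D = (S `*` setT) `&`
    [set p | (0 < p.2)%R && (p.2 < D p.1)%R]); last first.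
  by apply/seteqP; split => [p [Sp Dp]|p [[Sp _] Dp]].
apply: measurableI; first exact: measurableX.
apply: measurable_bool_set; apply: measurable_and.
- by apply: measurable_fun_ltr => //; exact: measurable_snd.
- apply: measurable_fun_ltr; first exact: measurable_snd.
  exact: (measurableT_comp mD measurable_fst).
Qed.

Definition density_measure (S : set RT) (D : RT -> R) (mS : measurable S)
    (mD : measurable_fun setT D) : {measure set RT -> \bar R}.
Proof.
refine (pushforward (mrestr (leb \x leb) (measurable_undergraph mS mD)) fst
  : {measure set RT -> \bar R}).
exact: measurable_fst.
Defined.

Lemma integral_density_measure (S : set RT) (D : RT -> R) (mS : measurable S)
    (mD : measurable_fun setT D) (g : RT -> \bar R) :
  (forall r, S r -> (0 <= D r)%R) -> measurable_fun setT g -> (forall r, 0 <= g r) ->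
  \int[density_measure mS mD]_r g r = \int[leb]_(r in S) (g r * (D r)%:E).
Proof.
move=> D0 mg g0.
have mg1 : measurable_fun setT (g \o fst : RT * RT -> _).
  exact: (measurableT_comp mg measurable_fst).
rewrite (@ge0_integral_image _ _ _ _ _
  (mrestr (leb \x leb) (measurable_undergraph mS mD)) _ fst)//.
rewrite (@ge0_integral_mrestr _ _ _ _ _ _ (g \o fst : RT * RT -> _))//; last first.
  by move=> p; exact: g0.
rewrite integral_mkcond fubini_tonelli1/=; first last.
- by move=> p; apply: erestrict_ge0 => q _; exact: g0.
- apply/(measurable_restrictT _ (measurable_undergraph mS mD)).
  exact: measurable_funS mg1.
rewrite [RHS]integral_mkcond; apply: eq_integral => r _.
rewrite /fubini_F patchE; case: ifPn => Sr; last first.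
  rewrite integral0_eq// => u _; rewrite patchE ifF//; apply/negP.
  by rewrite inE => -[/= /mem_set]; rewrite (negbTE Sr).
transitivity (\int[leb]_(u in `]0%R, D r[) g r).
  rewrite [RHS]integral_mkcond; apply: eq_integral => u _; rewrite !patchE.
  have -> // : ((r, u) \in undergraph S D) = (u \in `]0%R, D r[%classic).
  apply/idP/idP; rewrite !inE /undergraph /= in_itv/=; first by case.
  by split => //; exact/set_mem.
rewrite integral_cst//= lebesgue_measure_itv/= lte_fin -EFinB subr0.
case: ifPn => // D0r; congr (_ * _); congr EFin; apply/eqP.
by rewrite eq_le D0 ?andbT; [rewrite leNgt|exact/set_mem].
Qed.

(** The image of [mu] under [T] and the measure with density [D] agree on the half-open subintervals
    of each []a k, b k]], hence on its Borel sets, hence in the integrals over it; monotone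
    convergence passes to the union [S]. *)
Lemma ge0_integral_density (mu : {measure set X -> \bar R}) (T : X -> RT)
    (D : RT -> R) (a b : nat -> R) (g : RT -> \bar R) :
  let S := \bigcup_k `]a k, b k]%classic in
  measurable_fun setT T -> measurable_fun setT D ->
  (forall r, S r -> (0 <= D r)%R) ->
  (forall k, a k.+1 <= a k)%R -> (forall k, b k <= b k.+1)%R ->
  (forall k c e, (a k <= c)%R -> (c <= e)%R -> (e <= b k)%R ->
    mu (T @^-1` `]c, e]) = \int[leb]_(r in `]c, e]) (D r)%:E) ->
  (forall k, mu (T @^-1` `]a k, b k]) < +oo) ->
  measurable_fun setT g -> (forall r, 0 <= g r) ->
  \int[mu]_(x in T @^-1` S) g (T x) = \int[leb]_(r in S) (g r * (D r)%:E).
Proof.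
move=> S mT mD D0 nia ndb muT muTfin mg g0.
have nda : {homo a : n m / (n <= m)%N >-> (m <= n)%R}.
  by apply: homo_leq => // x y z xy yz; exact: le_trans yz xy.
have ndb' : {homo b : n m / (n <= m)%N >-> (n <= m)%R}.
  by apply: homo_leq => // x y z; exact: le_trans.
have ndI : {homo (fun k => `]a k, b k]%classic) : n m / (n <= m)%N >-> (n <= m)%O}.
  move=> n m nm; apply/subsetPset => x /=; rewrite !in_itv/= => /andP[ax xb].
  by rewrite (le_lt_trans (nda _ _ nm) ax) (le_trans xb (ndb' _ _ nm)).
have mTI (A : set RT) : measurable A -> measurable (T @^-1` A).
  by move=> mA; rewrite -[X in measurable X]setTI; exact: mT.
have part k : \int[mu]_(x in T @^-1` `]a k, b k]) g (T x) =
    \int[leb]_(r in `]a k, b k]) (g r * (D r)%:E).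
  have mI : measurable `]a k, b k]%classic by exact: measurable_itv.
  have Dk r : `]a k, b k]%classic r -> (0 <= D r)%R by move=> kr; apply: D0; exists k.
  rewrite -(integral_density_measure mI mD)//.
  rewrite -(ge0_integral_mrestr _ (mTI _ mI) (measurableT_comp mg mT))//; last first.
    by move=> x; exact: g0.
  have nuE A : measurable A ->
      density_measure mI mD A = \int[leb]_(r in A `&` `]a k, b k]) (D r)%:E.
    move=> mA; rewrite -[LHS]mul1e -integral_cst// integral_mkcond.
    rewrite integral_density_measure//; last 2 first.
    - apply/(measurable_restrictT _ mA); exact: measurable_cst.
    - by move=> r; exact: erestrict_ge0.
    rewrite [RHS]integral_mkcondl; apply: eq_integral => r _.
    by rewrite !patchE; case: ifP; rewrite ?mul1e ?mul0e.
  apply/esym/ge0_integral_image => // A mA.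
  have itvI c e : `]c, e] `&` `]a k, b k] =
      `]Num.max c (a k), Num.min e (b k)]%classic :> set R.
    apply/seteqP; split => r /=; rewrite !in_itv/= gt_max le_min.
      by move=> [/andP[-> ->] /andP[-> ->]].
    by move=> /andP[/andP[-> ->] /andP[-> ->]].
  suff <- : image_measure (mrestr mu (mTI _ mI)) mT A = density_measure mI mD A.
    by [].
  have imE B : image_measure (mrestr mu (mTI _ mI)) mT B =
      mu (T @^-1` (B `&` `]a k, b k])) by [].
  apply: eq_measure_ocitv => //.
  - move=> c e; rewrite nuE// imE itvI.
    (* Both measures live on []a k, b k]], so an arbitrary interval is cut down to a subinterval of
       it or to the empty set. *)
    have [le|lt] := leP (Num.max c (a k)) (Num.min e (b k)).
      by apply: (muT k) => //; rewrite ?le_max ?ge_min lexx orbT.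
    by rewrite set_itv_ge ?bnd_simp -?leNgt ?(ltW lt)// integral_set0 preimage_set0 measure0.
  - move=> c e; rewrite imE.
    apply: le_lt_trans (muTfin k); apply: le_measure.
    - by rewrite inE; apply: (mTI); exact: measurableI.
    - by rewrite inE; apply: (mTI).
    - by move=> x /= [].
have mS k : measurable_fun (`]a k, b k]%classic : set R) (fun r => g r * (D r)%:E).
  apply: emeasurable_funM; first exact: measurable_funTS.
  by apply/measurable_EFinP; exact: measurable_funTS.
have gD0 k r : `]a k, b k]%classic r -> 0 <= g r * (D r)%:E.
  by move=> kr; rewrite mule_ge0// lee_fin D0//; exists k.
have := @ge0_nondecreasing_set_cvg_integral _ RT R (fun k => `]a k, b k]%classic)
  (fun r => g r * (D r)%:E) leb ndI (fun=> measurable_itv _) mS gD0.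
move=> /cvg_lim <-//.
have ndT : {homo (fun k => T @^-1` `]a k, b k]) : n m / (n <= m)%N >-> (n <= m)%O}.
  by move=> n m /ndI /subsetPset nm; apply/subsetPset; exact: preimage_subset.
have mTk k : measurable (T @^-1` `]a k, b k]) by apply: (mTI).
have mgT k : measurable_fun (T @^-1` `]a k, b k]) (g \o T).
  by apply: measurable_funTS; exact: measurableT_comp.
have := @ge0_nondecreasing_set_cvg_integral _ _ _ (fun k => T @^-1` `]a k, b k])
  (g \o T) mu ndT mTk mgT (fun k x _ => g0 (T x)).
rewrite /S preimage_bigcup => /cvg_lim <-//.
by apply: congr_lim; apply/funext => k /=; rewrite -part.
Qed.

End density.

Section ftc.
Context {R : realType}.
Local Notation mu := (@lebesgue_measure R).

(** Half-open intervals are what the comparison of measures supplies; there [c = e] has to be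
    allowed. *)
Lemma integral_ocitv_derive (F f : R -> R) (c e : R) : c <= e ->
  (forall x, c <= x <= e -> is_derive x (1 : R) F (f x)) ->
  (forall x, c <= x <= e -> {for x, continuous f}) ->
  (\int[mu]_(x in `]c, e]) (f x)%:E = (F e - F c)%:E)%E.
Proof.
rewrite le_eqVlt => /predU1P[<- _ _|ce Ff cf].
  by rewrite set_itvoc0 integral_set0 subrr.
have cF x : c <= x <= e -> {for x, continuous F}.
  move=> xce; apply/differentiable_continuous/derivable1_diffP.
  by have [] := Ff _ xce.
have mf : measurable_fun `[c, e] f.
  apply: subspace_continuous_measurable_fun => //.
  by apply: continuous_in_subspaceT => x; rewrite inE/= in_itv/=; exact: cf.
rewrite integral_itv_obnd_cbnd; last first.
  by apply/measurable_EFinP; apply: measurable_funS mf => //; exact: subset_itv_oc_cc.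
rewrite (continuous_FTC2 (F := F) ce) ?EFinB//.
- by apply: continuous_in_subspaceT => x; rewrite inE/= in_itv/=; exact: cf.
- split.
  + move=> x; rewrite in_itv/= => /andP[cx xe].
    by have [] := Ff x; rewrite ?(ltW cx) ?(ltW xe).
  + by apply: cvg_at_right_filter; apply: cF; rewrite lexx ltW.
  + by apply: cvg_at_left_filter; apply: cF; rewrite lexx ltW.
- move=> x; rewrite in_itv/= => /andP[cx xe]; rewrite derive1E.
  by apply: derive_val; apply: Ff; rewrite !ltW.
Qed.

End ftc.

(** * Volumes of balls and spherical shells *)

Section ball.
Context {R : realType}.
Local Notation RT := (measurableTypeR R).
Local Notation lambda n := (@lebesgue_tuple R n).

Definition tscale n (c : R) (y : n.-tuple RT) : n.-tuple RT :=
  taffine c (tuple_of_rV 0) y.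

Lemma rvec_tscale n c (y : n.-tuple RT) : rvec (tscale c y) = c *: rvec y.
Proof. by rewrite rvec_taffine tuple_of_rVK addr0. Qed.

Lemma lebesgue_tuple_affine n (c : R) (b : n.-tuple RT) A : c != 0 ->
  measurable A ->
  (lambda n A = (`|c| ^+ n)%:E * lambda n (taffine c b @^-1` A))%E.
Proof.
move=> c0 mA.
have mT : measurable (taffine c b @^-1` A).
  by rewrite -[X in measurable X]setTI; exact: measurable_taffine.
rewrite -[A in LHS]setIT -integral_indic//.
rewrite (ge0_integral_taffine b c0)//; last first.
  by apply/measurable_EFinP; exact: measurable_indic.
by rewrite -[X in lambda n X]setIT -integral_indic.
Qed.

Definition eball n (r : R) : set (n.-tuple RT) := [set y | enorm (rvec y) <= r].

Arguments eball : clear implicits.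

Lemma measurable_eball n r : measurable (eball n r).
Proof.
apply: measurable_bool_set; apply: measurable_fun_ler => //.
exact: measurable_enorm.
Qed.

Definition ball_volume n : R := fine (lambda n (eball n 1)).

Lemma lebesgue_eball_scale n r : 0 < r ->
  (lambda n (eball n r) = (r ^+ n)%:E * lambda n (eball n 1))%E.
Proof.
move=> r0; rewrite (@lebesgue_tuple_affine n r (tuple_of_rV 0))//; last 2 first.
- by rewrite gt_eqF.
- exact: measurable_eball.
rewrite gtr0_norm//; congr (_ * lambda n _)%E; apply/seteqP.
by split => y; rewrite /eball /= rvec_tscale enormZ gtr0_norm// ger_pMr.
Qed.

(** The point is finiteness: the indicator of the unit ball is at most [e * exp (- |y|^2)], whose
    integral is known. *)
Lemma lebesgue_eball1 n : lambda n (eball n 1) = (ball_volume n)%:E.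
Proof.
rewrite fineK// ge0_fin_numE//.
have : (lambda n (eball n 1) <=
    (expR 1)%:E * \int[lambda n]_y (expR (- enorm (rvec y) ^+ 2))%:E)%E.
  rewrite -[X in lambda n X]setIT -integral_indic//; last exact: measurable_eball.
  have mg : measurable_fun setT
      (fun y : n.-tuple RT => (expR (- enorm (rvec y) ^+ 2))%:E).
    apply/measurable_EFinP; apply: measurableT_comp => //.
    apply: measurableT_comp => //; apply: measurable_funX.
    exact: measurable_enorm.
  rewrite -ge0_integralZl//.
  apply: ge0_le_integral => //.
  - by apply/measurable_EFinP; apply: measurable_indic; exact: measurable_eball.
  - exact: measurable_funeM.
  - move=> y _; rewrite -EFinM lee_fin -expRD indicE.
    case: (boolP (y \in _)) => [|_]; last exact: expR_ge0.
    rewrite inE /eball/= => y1; rewrite -[X in X <= _]expR0 ler_expR subr_ge0.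
    by rewrite exprn_ile1// enorm_ge0.
by move=> /le_lt_trans; apply; rewrite integral_gauss_tuple -EFinM ltry.
Qed.

Lemma lebesgue_eball n r : 0 < r ->
  lambda n (eball n r) = (r ^+ n * ball_volume n)%:E.
Proof. by move=> r0; rewrite lebesgue_eball_scale// lebesgue_eball1 EFinM. Qed.

(** If the unit ball were null, so would be all balls by scaling, and then the whole space, against
    the positive Gaussian integral. *)
Lemma ball_volume_gt0 n : 0 < ball_volume n.
Proof.
rewrite lt0r fine_ge0// andbT; apply/negP => /eqP V0.
have : (\int[lambda n]_y (expR (- enorm (rvec y) ^+ 2))%:E = 0)%E.
  rewrite (_ : [set: n.-tuple RT] = \bigcup_k eball n k.+1%:R); last first.
    apply/seteqP; split => // y _; exists (Num.truncn (enorm (rvec y))) => //.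
    by rewrite /eball/= ltW// truncnS_gt.
  apply: null_set_integral.
  - by apply: bigcup_measurable => k _; exact: measurable_eball.
  - apply/measurable_EFinP; apply: measurable_funTS; apply: measurableT_comp => //.
    apply: measurableT_comp => //; apply: measurable_funX.
    exact: measurable_enorm.
  - apply/eqP; rewrite eq_le measure_ge0 andbT.
    have : (lambda n (\bigcup_k eball n k.+1%:R) <=
        \sum_(k <oo) lambda n (eball n k.+1%:R))%E.
      apply: measure_sigma_subadditive => //.
      - by move=> k; exact: measurable_eball.
      - by apply: bigcup_measurable => k _; exact: measurable_eball.
    by rewrite eseries0// => k _ _; rewrite lebesgue_eball// V0 mulr0.
rewrite integral_gauss_tuple => /eqP; rewrite eqe expf_eq0.
by rewrite sqrtr_eq0 leNgt pi_gt0 andbF.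
Qed.

(** The degenerate ball is invariant under the dilation by 2, which multiplies volumes by
    [2 ^+ n.+1]; a finite volume with this property is 0. In dimension 0 the single point has mass
    1. *)
Lemma lebesgue_eball0 n : lambda n.+1 (eball n.+1 0) = 0%E.
Proof.
have c0 : 2 != 0 :> R by rewrite pnatr_eq0.
have := lebesgue_tuple_affine (tuple_of_rV 0) c0 (@measurable_eball n.+1 0).
have -> : taffine 2 (tuple_of_rV 0) @^-1` eball n.+1 0 = eball n.+1 0.
  apply/seteqP; split => y; rewrite /eball/= rvec_tscale enormZ normr_nat.
    by rewrite pmulr_rle0.
  by rewrite pmulr_rle0.
have : (lambda n.+1 (eball n.+1 0) < +oo)%E.
  apply: (@le_lt_trans _ _ (lambda n.+1 (eball n.+1 1))).
    apply: le_measure; rewrite ?inE//; do ?exact: measurable_eball.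
    by move=> y; rewrite /eball/= => /le_trans; apply.
  by rewrite lebesgue_eball1 ltry.
rewrite -ge0_fin_numE//; case: (lambda n.+1 _) => //= v _ [/eqP].
rewrite -subr_eq0 -[X in X - _]mul1r -mulrBl mulf_eq0 subr_eq0 eq_sym.
by rewrite ger0_norm// gt_eqF ?exprn_egt1 ?ltr1n//= => /eqP ->.
Qed.

Lemma lebesgue_shell n c e : 0 < c -> c <= e ->
  lambda n [set y | c < enorm (rvec y) <= e] =
  ((e ^+ n - c ^+ n) * ball_volume n)%:E.
Proof.
move=> c0 ce; have e0 := lt_le_trans c0 ce.
rewrite (_ : [set _ | _] = eball n e `\` eball n c); last first.
  apply/seteqP; split => y; rewrite /eball/=.
    by move=> /andP[cy ->]; split => //; apply/negP; rewrite -ltNge.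
  by move=> [-> /negP]; rewrite -ltNge => ->.
rewrite measureD//=; last 3 first.
- exact: measurable_eball.
- exact: measurable_eball.
- by rewrite lebesgue_eball// ltry.
rewrite setIidr; last by move=> y; rewrite /eball/= => /le_trans; apply.
by rewrite !lebesgue_eball// -EFinB mulrBl.
Qed.

(** The cone over the whole sphere is the unit ball without its centre, a null set. *)
Lemma sphere_areaE n : sphere_area n.+1 = n.+1%:R * ball_volume n.+1 :> R.
Proof.
rewrite /sphere_area /surface/= /mscale/= /cone_volume /pushforward/= /mrestr/=.
have -> : @radial R n.+1 @^-1` usphere n.+1 `&` pball n.+1 =
    eball n.+1 1 `\` eball n.+1 0.
  apply/seteqP; split => y; rewrite /usphere /pball /eball /=.
    by move=> [_ /andP[y0 ->]]; split => //; apply/negP; rewrite -ltNge.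
  move=> [y1 /negP]; rewrite -ltNge => y0; split; last by rewrite y0.
  rewrite (_ : rvec _ = (enorm (rvec y))^-1 *: rvec y); last first.
    by apply/rowP => i; rewrite !mxE tnth_mktuple mulrC.
  by rewrite enormZ gtr0_norm ?invr_gt0// mulVf// gt_eqF.
rewrite measureD//=; last 3 first.
- exact: measurable_eball.
- exact: measurable_eball.
- by rewrite lebesgue_eball1 ltry.
rewrite setIidr; last by move=> y; rewrite /eball/= => /le_trans; apply.
by rewrite lebesgue_eball0 sube0 lebesgue_eball1.
Qed.

End ball.
Arguments eball {R} n r.

(** * The surface measure of the sphere *)

Section surface.
Context {R : realType}.
Local Notation RT := (measurableTypeR R).
Local Notation mu := (@lebesgue_measure R).
Local Notation lambda n := (@lebesgue_tuple R n).

Lemma rvec_inj n : injective (@rvec R n).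
Proof. exact: can_inj (@rvecK R n). Qed.

Lemma rvec_radial n (y : n.-tuple RT) :
  rvec (radial y) = (enorm (rvec y))^-1 *: rvec y.
Proof. by apply/rowP => i; rewrite !mxE tnth_mktuple mulrC. Qed.

Lemma radial_tscale n (c : R) (y : n.-tuple RT) : c != 0 ->
  radial (tscale c y) = tscale (Num.sg c) (radial y).
Proof.
move=> c0; apply: rvec_inj; rewrite !(rvec_radial, rvec_tscale) enormZ !scalerA.
congr (_ *: _); rewrite invfM mulrAC; congr (_ * _).
by rewrite {2}(numEsg c) mulrCA mulVf ?mulr1// normr_eq0.
Qed.

Lemma measurable_usphere n : measurable (@usphere R n).
Proof.
rewrite -[X in measurable X]setTI.
exact: (@measurable_enorm R n measurableT [set 1%R]).
Qed.

Lemma usphere_radial n (y : n.-tuple RT) : 0 < enorm (rvec y) -> usphere n (radial y).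
Proof.
move=> y0; rewrite /usphere/= rvec_radial enormZ gtr0_norm ?invr_gt0//.
by rewrite mulVf// gt_eqF.
Qed.

Lemma integral_surface n (F : n.-tuple RT -> \bar R) :
  measurable_fun setT F -> (forall s, 0 <= F s)%E ->
  (\int[surface n]_(s in usphere n) F s =
   n%:R%:E * \int[lambda n]_(y in pball n) F (radial y))%E.
Proof.
move=> mF F0; rewrite integral_mkcond.
have mFS : measurable_fun setT (F \_ (usphere n)).
  by apply/(measurable_restrictT _ (@measurable_usphere n)); exact: measurable_funTS.
have FS0 s : (0 <= (F \_ (usphere n)) s)%E by exact: erestrict_ge0.
rewrite ge0_integral_mscale//=; congr (_ * _)%E.
rewrite (@ge0_integral_image _ _ _ _ _
  (mrestr (lambda n) (@measurable_pball R n)) (@cone_volume R n) (@radial R n))//.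
rewrite (@ge0_integral_mrestr _ _ _ _ _ _ ((F \_ (usphere n)) \o @radial R n)).
- apply: eq_integral => y /set_mem; rewrite /pball/= => /andP[y0 _].
  by rewrite patchE mem_set//; exact: usphere_radial.
- apply: measurableT_comp => //; exact: measurable_radial.
- by move=> y; exact: FS0.
Qed.

Lemma integral_exp_norm m (b : R) : 0 < b ->
  (\int[mu]_(r in `[(- b)%R, b]) (`|r| ^+ m)%:E =
   (2 * b ^+ m.+1 / m.+1%:R)%:E)%E.
Proof.
move=> b0.
have mX : measurable_fun setT (fun r : R => (`|r| ^+ m)%:E).
  by apply/measurable_EFinP; exact: measurable_funX.
rewrite -integral_itv_obnd_cbnd; last exact: measurable_funTS.
rewrite (itv_bndbnd_setU (x := BRight 0)) ?bnd_simp ?oppr_le0 ?ltW//.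
have m1 : m.+1%:R != 0 :> R by rewrite pnatr_eq0.
rewrite ge0_integral_setU//=; first last.
- rewrite disj_set2E; apply/eqP/seteqP; split => // r [/=].
  rewrite !in_itv/= => /andP[_ r0] /andP[r1 _].
  by move: (lt_le_trans r1 r0); rewrite ltxx.
- exact: measurable_funTS.
have -> : (\int[mu]_(r in `](- b)%R, 0%R]) (`|r| ^+ m)%:E =
    \int[mu]_(r in `](- b)%R, 0%R]) ((- r) ^+ m)%:E)%E.
  apply: eq_integral => r /set_mem/=; rewrite in_itv/= => /andP[_ r0].
  by rewrite ler0_norm.
have -> : (\int[mu]_(r in `]0%R, b]) (`|r| ^+ m)%:E =
    \int[mu]_(r in `]0%R, b]) (r ^+ m)%:E)%E.
  apply: eq_integral => r /set_mem/=; rewrite in_itv/= => /andP[r0 _].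
  by rewrite gtr0_norm.
have cX : continuous (fun r : R => r ^+ m) by exact: exprn_continuous.
have dX x : is_derive x (1 : R) (fun r => r ^+ m.+1 / m.+1%:R) (x ^+ m).
  rewrite (_ : (fun r => _) = m.+1%:R^-1 *: (id ^+ m.+1)); last first.
    by apply/funext => r; rewrite /GRing.scale/= /GRing.scale/= exprfctE mulrC.
  by apply: is_derive_eq; rewrite /GRing.scale/= mulr1 mulrA mulVf// mul1r.
have dN x : - b <= x <= 0 ->
    is_derive x (1 : R) (fun r => - ((- r) ^+ m.+1 / m.+1%:R)) ((- x) ^+ m).
  move=> _; apply: is_derive_eq.
    apply: is_deriveN; apply: (@is_derive1_comp _ (fun r => r ^+ m.+1 / m.+1%:R) -%R).
  by rewrite mulrN1 opprK.
have dP x : 0 <= x <= b ->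
    is_derive x (1 : R) (fun r => r ^+ m.+1 / m.+1%:R) (x ^+ m).
  by move=> _; exact: dX.
rewrite (integral_ocitv_derive _ dN) ?oppr_le0 ?(ltW b0)//; last first.
  move=> x _; apply: (@continuous_comp _ _ _ -%R (fun r : R => r ^+ m)).
    exact: opp_continuous.
  exact: cX.
rewrite (integral_ocitv_derive (ltW b0) dP); last by move=> x _; exact: cX.
rewrite -EFinD; congr EFin; rewrite !(oppr0, opprK, expr0n)/= mul0r.
by rewrite !oppr0 add0r addr0 -mulrDl -mulr2n mulr_natl.
Qed.

(** The hyperplane at height 1; [radial (homog y)] is the central projection of [(y, 1)] to the
    upper half-sphere. *)
Definition homog m (y : m.-tuple RT) : m.+1.-tuple RT := tsnoc y 1.

Lemma measurable_homog m : measurable_fun setT (@homog m).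
Proof. exact: (measurableT_comp (@measurable_tsnoc R m) (pair2_measurable _)). Qed.

Lemma tsnoc_tscale m (r : R) (y : m.-tuple RT) :
  tsnoc (tscale r y) r = tscale r (homog y).
Proof.
apply: eq_from_tnth => i; rewrite [RHS]tnth_mktuple tnth_mktuple mxE addr0.
case: (unliftP ord_max i) => [j|] ->.
  by rewrite !tnth_tsnoc_lift tnth_mktuple tnth_mktuple mxE addr0.
by rewrite !tnth_tsnoc_max mulr1.
Qed.

Lemma enorm_homog_gt0 m (y : m.-tuple RT) : 0 < enorm (rvec (homog y)).
Proof.
rewrite lt0r enorm_ge0 andbT; apply/eqP => /enorm_eq0 /rowP /(_ ord_max).
by rewrite !mxE tnth_tsnoc_max => /eqP; rewrite oner_eq0.
Qed.

(* Both sides are volumes of cones, (m+1) times the integral over r of the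
   sections at height r, which are the dilations by r of the section at height 1. *)
Lemma integral_surface_projection m (F : m.+1.-tuple RT -> \bar R) :
  measurable_fun setT F -> (forall s, 0 <= F s)%E ->
  (forall s, F (tscale (-1) s) = F s) ->
  (\int[surface m.+1]_(s in usphere m.+1) F s =
   2%:E * \int[lambda m]_y
     (F (radial (homog y)) * (enorm (rvec (homog y)) ^- m.+1)%:E))%E.
Proof.
move=> mF F0 Feven; rewrite integral_surface// integral_mkcond.
set G := (_ \_ _).
have mG : measurable_fun setT G.
  apply/(measurable_restrictT _ (@measurable_pball R m.+1)); apply: measurable_funTS.
  apply: measurableT_comp => //; exact: measurable_radial.
have G0 y : (0 <= G y)%E by apply: erestrict_ge0 => *; exact: F0.
pose P (y : m.-tuple RT) := enorm (rvec (homog y)).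
have P0 y : 0 < P y by exact: enorm_homog_gt0.
(* The multiple [r (y, 1)] lies in the ball iff [|r| <= 1 / P y], and its direction is that of
   [(y, 1)] up to a sign, to which [F] is insensitive. *)
have Gr (r : R) y : r != 0 -> G (tsnoc (tscale r y) r) =
    if `|r| <= (P y)^-1 then F (radial (homog y)) else 0%E.
  move=> r0; rewrite tsnoc_tscale /G patchE.
  have -> : (tscale r (homog y) \in pball m.+1) = (`|r| <= (P y)^-1).
    apply/idP/idP; rewrite !inE /pball/= rvec_tscale enormZ -/(P y).
      by move=> /andP[_]; rewrite -ler_pdivlMr// div1r.
    by move=> h; rewrite mulr_gt0 ?normr_gt0//= -ler_pdivlMr// div1r.
  case: ifP => // _; rewrite radial_tscale//.
  by case: sgrP r0 => // _ _; rewrite ?Feven//; congr F; apply: rvec_inj;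
    rewrite rvec_tscale scale1r.
have mT : measurable_fun setT (fun p : m.-tuple RT * RT => tsnoc p.1 p.2).
  exact: measurable_tsnoc.
have mP : measurable_fun setT P.
  exact: (measurableT_comp (@measurable_enorm R m.+1) (@measurable_homog m)).
have mFP : measurable_fun setT (fun y => F (radial (homog y))).
  apply: (measurableT_comp mF); apply: (measurableT_comp (@measurable_radial R m.+1)).
  exact: measurable_homog.
pose H (p : m.-tuple RT * RT) : \bar R :=
  if `|p.2| <= (P p.1)^-1 then (F (radial (homog p.1)) * (`|p.2| ^+ m)%:E)%E else 0%E.
have H0 p : (0 <= H p)%E.
  by rewrite /H; case: ifP => // _; rewrite mule_ge0// lee_fin exprn_ge0.
have mH : measurable_fun setT H.
  apply: measurable_fun_ifT => //.
    apply: measurable_fun_ler; first exact: (measurableT_comp _ measurable_snd).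
    rewrite (_ : (fun _ => _) = (fun p : m.-tuple RT * RT => P p.1 `^ (-1))).
      apply: (measurableT_comp (measurable_powR _)).
      exact: (measurableT_comp mP measurable_fst).
    by apply/funext => p; rewrite powR_inv1// ltW.
  apply: emeasurable_funM; first exact: (measurableT_comp mFP measurable_fst).
  apply/measurable_EFinP; apply: measurable_funX.
  exact: (measurableT_comp _ measurable_snd).
have key : (\int[lambda m.+1]_y G y =
    \int[mu]_r \int[lambda m]_y H (y, r))%E.
  rewrite ge0_integral_tsnoc//.
  have mGT := measurableT_comp mG mT.
  have GT0 p : (0 <= (G \o (fun p : m.-tuple RT * RT => tsnoc p.1 p.2)) p)%E.
    exact: G0.
  rewrite (fubini_tonelli _ mGT GT0).
  have m1 := measurable_fun_fubini_tonelli_G (m1 := lambda m) _ mGT GT0.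
  have m2 := measurable_fun_fubini_tonelli_G (m1 := lambda m) H mH H0.
  (* The section at height 0 is dropped as a null set, because the dilation by [r] has to be
     invertible. *)
  have mD0 : measurable ([set: R] `\ (0 : R)) by exact: measurableD.
  rewrite -(@integral_setD1 _ _ 0 setT mD0 (measurable_funTS m1)).
  rewrite -[RHS](@integral_setD1 _ _ 0 setT mD0 (measurable_funTS m2)).
  apply: eq_integral => r /set_mem[_ /= /eqP r0].
  rewrite /fubini_G/=.
  rewrite (ge0_integral_taffine (tuple_of_rV 0) r0)//; last first.
    exact: (measurableT_comp mG (measurableT_comp mT (pair2_measurable _))).
  rewrite -ge0_integralZl//; last first.
    apply: (measurableT_comp mG (measurableT_comp mT
      (measurableT_comp (pair2_measurable r) _))).
    exact: measurable_taffine.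
  apply: eq_integral => y _; rewrite -/(tscale r y) Gr// /H/=.
  by case: ifP; rewrite ?mule0// muleC.
rewrite key -(fubini_tonelli H)//.
(* For fixed [y], integrating [|r|^m] over [|r| <= 1 / P y] gives [2 / (m + 1)] times the Jacobian
   of the projection; the factor [m + 1] in the surface measure then cancels. *)
have -> : (\int[lambda m]_y \int[mu]_r H (y, r) =
    \int[lambda m]_y ((2 / m.+1%:R)%:E * (F (radial (homog y)) * (P y ^- m.+1)%:E)))%E.
  apply: eq_integral => y _.
  transitivity (\int[mu]_(r in `[(- (P y)^-1)%R, (P y)^-1%R])
      (F (radial (homog y)) * (`|r| ^+ m)%:E))%E.
    rewrite [RHS]integral_mkcond; apply: eq_integral => r _.
    by rewrite /H/= patchE mem_setE in_itv/= -ler_norml.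
  rewrite ge0_integralZl//; last first.
    by apply/measurable_EFinP; apply: measurable_funTS; exact: measurable_funX.
  rewrite integral_exp_norm ?invr_gt0// muleCA -EFinM; congr (_ * _%:E)%E.
  by rewrite exprVn mulrAC.
rewrite ge0_integralZl//; last 2 first.
- apply: emeasurable_funM => //; apply/measurable_EFinP.
  rewrite (_ : (fun _ => _) = (fun y => (P y ^+ m.+1) `^ (-1))).
    apply: (measurableT_comp (measurable_powR _)); exact: measurable_funX.
  by apply/funext => p; rewrite powR_inv1// exprn_ge0// ltW.
- by move=> y _; rewrite mule_ge0// lee_fin invr_ge0 exprn_ge0// ltW.
by rewrite muleA -EFinM mulrCA divff ?mulr1// pnatr_eq0.
Qed.

End surface.

(** * Reflections of the sphere and rearrangement *)

Section reflection.
Context {R : realType}.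
Local Notation RT := (measurableTypeR R).
Local Notation lambda n := (@lebesgue_tuple R n).

Lemma radialE n (y : n.-tuple RT) : radial y = tscale (enorm (rvec y))^-1 y.
Proof. by apply: rvec_inj; rewrite rvec_radial rvec_tscale. Qed.

(** The reflection in the hyperplane orthogonal to [v]. For [v = 0] it is the identity, division by
    0 giving 0; this covers [z = e] when the reflection for [z - e] exchanges [z] and [e]. *)
Definition reflection n (v : 'rV[R]_n) (y : n.-tuple RT) : n.-tuple RT :=
  tuple_of_rV (rvec y - (2 * dotp (rvec y) v / dotp v v) *: v).

Lemma rvec_reflection n (v : 'rV[R]_n) y :
  rvec (reflection v y) = rvec y - (2 * dotp (rvec y) v / dotp v v) *: v.
Proof. exact: tuple_of_rVK. Qed.

Lemma measurable_dotp n (v : 'rV[R]_n) :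
  measurable_fun setT (fun y : n.-tuple RT => dotp (rvec y) v).
Proof.
apply: measurable_sum => i; apply: measurable_funM => //.
by under eq_fun do rewrite mxE; exact: measurable_tnth.
Qed.

Lemma measurable_reflection n (v : 'rV[R]_n) : measurable_fun setT (reflection v).
Proof.
apply/measurable_fun_tnthP => i.
rewrite (_ : _ \o _ = fun y : n.-tuple RT =>
    tnth y i - (2 * dotp (rvec y) v / dotp v v) * v 0 i); last first.
  by apply/funext => y /=; rewrite tnth_mktuple !mxE.
apply: measurable_funB; first exact: measurable_tnth.
do 2 apply: measurable_funM => //.
by apply: measurable_funM => //; exact: measurable_dotp.
Qed.

Lemma reflection_tscale n (v : 'rV[R]_n) c y :
  reflection v (tscale c y) = tscale c (reflection v y).
Proof.
apply: rvec_inj; rewrite !(rvec_reflection, rvec_tscale) dotpZl scalerBr scalerA.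
by congr (_ - _ *: _); rewrite !mulrA (mulrC 2).
Qed.

Lemma reflectionK n (v : 'rV[R]_n) : involutive (reflection v).
Proof.
move=> y; apply: rvec_inj; rewrite !rvec_reflection dotpDl dotpNl dotpZl.
have [v0|v0] := eqVneq (dotp v v) 0; first by rewrite v0 invr0 !mulr0 !scale0r !subr0.
rewrite -addrA -opprD -scalerDl [X in X *: _](_ : _ = 0) ?scale0r ?subr0//.
by field.
Qed.

Lemma enorm_reflection n (v : 'rV[R]_n) y :
  enorm (rvec (reflection v y)) = enorm (rvec y).
Proof.
rewrite /enorm rvec_reflection; congr Num.sqrt.
rewrite !(dotpDl, dotpDr, dotpNl, dotpNr, dotpZl, dotpZr) (dotpC v (rvec y)).
have [v0|v0] := eqVneq (dotp v v) 0; last by field.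
by rewrite v0 invr0 !(mulr0, mul0r) !(oppr0, subr0, addr0).
Qed.

Lemma reflection_taffine n (v : 'rV[R]_n) x y :
  reflection v (taffine (-1) x y) =
  taffine (-1) (reflection v x) (reflection v y).
Proof.
apply: rvec_inj; rewrite !(rvec_reflection, rvec_taffine) dotpDl dotpZl.
rewrite scalerBr scalerA addrACA -opprD -scalerDl; congr (_ - _ *: _).
by ring.
Qed.

(** For unit vectors [(z - e, e) = - |z - e|^2 / 2], so the reflection adds exactly [(y, z - e)] to
    [(y, e)]. *)
Lemma dotp_reflection_swap n (e z : 'rV[R]_n) y : enorm e = 1 -> enorm z = 1 ->
  dotp (rvec (reflection (z - e) y)) e = dotp (rvec y) z.
Proof.
move=> e1 z1; have ee : dotp e e = 1 by rewrite -sqr_enorm e1 expr1n.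
have zz : dotp z z = 1 by rewrite -sqr_enorm z1 expr1n.
rewrite rvec_reflection dotpDl dotpNl dotpZl.
have [v0|v0] := eqVneq (dotp (z - e) (z - e)) 0.
  have /eqP := dotp_eq0 v0; rewrite subr_eq0 => /eqP ->.
  by rewrite subrr [dotp 0 e](_ : _ = 0) ?mulr0 ?subr0// -(scale0r e) dotpZl mul0r.
have ve : dotp (z - e) e = - (dotp (z - e) (z - e) / 2).
  rewrite !(dotpDl, dotpDr, dotpNl, dotpNr) ee zz (dotpC e z); by field.
rewrite ve; set w := dotp _ (z - e) in v0 *.
rewrite [X in _ - X](_ : _ = - dotp (rvec y) (z - e)); last by field.
by rewrite opprK -dotpDr addrC subrK.
Qed.

(** A reflection is a linear isometry, so it commutes with [radial] and preserves both the punctured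
    ball and its Lebesgue measure. *)
Lemma integral_surface_reflection n (v : 'rV[R]_n) (F : n.-tuple RT -> \bar R) :
  measurable_fun setT F -> (forall s, 0 <= F s)%E ->
  (\int[surface n]_(s in usphere n) F (reflection v s) =
   \int[surface n]_(s in usphere n) F s)%E.
Proof.
move=> mF F0; rewrite !integral_surface//; last first.
  exact: (measurableT_comp mF (measurable_reflection v)).
congr (_ * _)%E; rewrite integral_mkcond [RHS]integral_mkcond.
set G := (X in _ = integral _ _ X).
have mG : measurable_fun setT G.
  apply/(measurable_restrictT _ (@measurable_pball R n)); apply: measurable_funTS.
  apply: (measurableT_comp mF); exact: measurable_radial.
have G0 y : (0 <= G y)%E by apply: erestrict_ge0 => *; exact: F0.
rewrite -(ge0_integral_isometry (measurable_reflection v) (reflectionK v)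
  (reflection_taffine v) (enorm_reflection v) mG G0).
apply: eq_integral => y _; rewrite /G !patchE.
have -> : (reflection v y \in pball n) = (y \in pball n).
  by apply/idP/idP; rewrite !inE /pball/= enorm_reflection.
by case: ifP => // _; congr F; rewrite !radialE reflection_tscale enorm_reflection.
Qed.

(* The reflection exchanging e and z reduces this to the pointwise inequality
   Phi(g) Psi(h) + Phi(h) Psi(g) <= Phi(g) Psi(g) + Phi(h) Psi(h). *)
Lemma integral_surface_rearrangement n (e z : 'rV[R]_n) (Phi Psi : R -> R) :
  enorm e = 1 -> enorm z = 1 ->
  measurable_fun setT Phi -> measurable_fun setT Psi ->
  {in Num.nneg &, {homo Phi : u v / u <= v}} ->
  {in Num.nneg &, {homo Psi : u v / u <= v}} ->
  (forall u, 0 <= Phi u) -> (forall u, 0 <= Psi u) ->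
  (\int[surface n]_(s in usphere n)
     (Phi `|dotp (rvec s) e| * Psi `|dotp (rvec s) z|)%:E <=
   \int[surface n]_(s in usphere n)
     (Phi `|dotp (rvec s) e| * Psi `|dotp (rvec s) e|)%:E)%E.
Proof.
move=> e1 z1 mPhi mPsi hPhi hPsi Phi0 Psi0.
have mF u v : measurable_fun setT (fun s : n.-tuple RT =>
    (Phi `|dotp (rvec s) u| * Psi `|dotp (rvec s) v|)%:E).
  apply/measurable_EFinP; apply: measurable_funM.
    apply: (measurableT_comp mPhi); apply: measurableT_comp => //.
    exact: measurable_dotp.
  apply: (measurableT_comp mPsi); apply: measurableT_comp => //.
  exact: measurable_dotp.
have F0 (u v : 'rV[R]_n) (s : n.-tuple RT) : (0 <= (Phi `|dotp (rvec s) u| * Psi `|dotp (rvec s) v|)%:E)%E.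
  by rewrite lee_fin mulr_ge0.
have swap u v : enorm u = 1 -> enorm v = 1 ->
    (\int[surface n]_(s in usphere n)
      (Phi `|dotp (rvec s) u| * Psi `|dotp (rvec s) v|)%:E =
    \int[surface n]_(s in usphere n)
      (Phi `|dotp (rvec s) v| * Psi `|dotp (rvec s) u|)%:E)%E.
  move=> u1 v1; rewrite -(integral_surface_reflection (v - u) (mF u v) (F0 u v)).
  apply: eq_integral => s _; rewrite dotp_reflection_swap//.
  have -> : reflection (v - u) s = reflection (u - v) s; last first.
    by rewrite dotp_reflection_swap.
  apply: rvec_inj; rewrite !rvec_reflection -(opprB u v) !dotpNr dotpNl opprK.
  by rewrite mulrN mulNr scalerN scaleNr opprK.
have diag : (\int[surface n]_(s in usphere n)
      (Phi `|dotp (rvec s) z| * Psi `|dotp (rvec s) z|)%:E =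
    \int[surface n]_(s in usphere n)
      (Phi `|dotp (rvec s) e| * Psi `|dotp (rvec s) e|)%:E)%E.
  rewrite -[RHS](integral_surface_reflection (z - e) (mF e e) (F0 e e)).
  by apply: eq_integral => s _; rewrite dotp_reflection_swap.
have mS := @measurable_usphere R n.
(* Twice the left side is written with [e] and [z] in both orders, twice the right side with the
   diagonal terms of [e] and of [z]; the sums can be compared pointwise. *)
rewrite -(@lee_pmul2l _ 2%:E)// !mule_natl !mule2n.
rewrite [X in (_ + X <= _)%E]swap// -[X in (_ <= _ + X)%E]diag.
rewrite -!ge0_integralD//; do ?exact: measurable_funTS.
apply: ge0_le_integral => //.
- by move=> s _; rewrite adde_ge0.
- by apply: emeasurable_funD; exact: measurable_funTS.
- by apply: emeasurable_funD; exact: measurable_funTS.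
move=> s _; rewrite -!EFinD lee_fin -subr_ge0.
set g := `|dotp _ e|; set h := `|dotp _ z|.
have -> : Phi g * Psi g + Phi h * Psi h - (Phi g * Psi h + Phi h * Psi g) =
  (Phi g - Phi h) * (Psi g - Psi h) by ring.
have [gh|hg] := leP g h.
  by rewrite mulr_le0// subr_le0 ?hPhi ?hPsi// nnegrE normr_ge0.
by rewrite mulr_ge0// subr_ge0 ?hPhi ?hPsi ?ltW// nnegrE normr_ge0.
Qed.

End reflection.

(** * Polar coordinates *)

Section polar.
Context {R : realType}.
Local Notation RT := (measurableTypeR R).
Local Notation mu := (@lebesgue_measure R).
Local Notation lambda n := (@lebesgue_tuple R n).

(** The real power with exponent -1 is the inverse on nonnegative numbers, 0 included; negative
    numbers are reduced to these by a change of sign. *)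
Lemma measurable_invr : measurable_fun setT (fun x : R => x^-1).
Proof.
rewrite (_ : (fun _ => _) =
    (fun x : R => if x < 0 then - ((- x) `^ (-1)) else x `^ (-1))); last first.
  apply/funext => x; case: ltP => x0; last by rewrite powR_inv1.
  by rewrite powR_inv1 ?invrN ?opprK// oppr_ge0 ltW.
apply: measurable_fun_ifT.
- exact: measurable_fun_ltr.
- apply: measurableT_comp => //.
  exact: (measurableT_comp (measurable_powR (-1)) (@oppr_measurable R setT)).
- exact: measurable_powR.
Qed.

Lemma measurable_funV d (T : measurableType d) (f : T -> R) :
  measurable_fun setT f -> measurable_fun setT (fun x => (f x)^-1).
Proof. exact: measurableT_comp measurable_invr. Qed.

(** [N] is the radius as a function of the new variable and [T] plays the role of its inverse. The
    points with [T |y|] in []c, e]] form the shell [N c < |y| <= N e], whose volume is a difference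
    of values of [ball_volume k.+1 * N ^+ k.+1]; the density is the derivative of this function. *)
Lemma integral_radial_density k (N N' D : R -> R) (a b : nat -> R) (T : R -> R)
    (g : RT -> \bar R) :
  let S := \bigcup_k `]a k, b k]%classic in
  (forall k, a k.+1 <= a k) -> (forall k, b k <= b k.+1) ->
  (forall j, 0 < N (a j)) ->
  (forall r j c e, a j <= c -> c <= e -> e <= b j -> 0 <= r ->
    (T r \in `]c, e]) = (N c < r <= N e)) ->
  (forall j c, a j <= c <= b j -> is_derive c (1 : R) N (N' c)) ->
  (forall j c, a j <= c <= b j -> {for c, continuous N'}) ->
  (forall j c, a j <= c <= b j -> 0 <= N' c) ->
  (forall r, S r -> D r = sphere_area k.+1 * N r ^+ k * N' r) ->
  measurable_fun setT T -> measurable_fun setT D ->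
  measurable_fun setT g -> (forall r, 0 <= g r)%E ->
  (\int[lambda k.+1]_(y in [set y | S (T (enorm (rvec y)))]) g (T (enorm (rvec y))) =
   \int[mu]_(r in S) (g r * (D r)%:E))%E.
Proof.
move=> S nia ndb N0 TN dN cN N'0 DE mT mD mg g0.
have mTn : measurable_fun setT (fun y : k.+1.-tuple RT => T (enorm (rvec y))).
  exact: (measurableT_comp mT (@measurable_enorm R k.+1)).
have nda : {homo a : n m / (n <= m)%N >-> (m <= n)%R}.
  by apply: homo_leq => // x y z xy yz; exact: le_trans yz xy.
have sab j c : a j < c <= b j -> S c by move=> jc; exists j => //=; rewrite in_itv.
have Nle j c e : a j <= c -> c <= e -> e <= b j -> N c <= N e.
  move=> ac ce eb; rewrite -subr_ge0.
  have dNx x : c <= x <= e -> is_derive x (1 : R) N (N' x).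
    by move=> /andP[cx xe]; apply: (dN j); rewrite (le_trans ac cx) (le_trans xe eb).
  have cNx x : c <= x <= e -> {for x, continuous N'}.
    by move=> /andP[cx xe]; apply: (cN j); rewrite (le_trans ac cx) (le_trans xe eb).
  rewrite -lee_fin -(integral_ocitv_derive ce dNx cNx).
  apply: integral_ge0 => x /=; rewrite in_itv/= => /andP[cx xe].
  rewrite lee_fin; apply: (N'0 j).
  by rewrite (le_trans ac (ltW cx)) (le_trans xe eb).
have Npos j c : a j <= c <= b j -> 0 < N c.
  by move=> /andP[ac cb]; apply: lt_le_trans (N0 j) _; exact: (Nle j).
have preim j c e : a j <= c -> c <= e -> e <= b j ->
    lambda k.+1 ((fun y : k.+1.-tuple RT => T (enorm (rvec y))) @^-1` `]c, e]%classic) =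
    ((N e ^+ k.+1 - N c ^+ k.+1) * ball_volume k.+1)%:E.
  move=> ac ce eb; rewrite -lebesgue_shell; last 2 first.
  - by apply: (Npos j); rewrite ac (le_trans ce eb).
  - exact: (Nle j).
  congr (lambda k.+1 _); apply/seteqP; split => y /=.
    by rewrite (TN _ j)// enorm_ge0.
  by rewrite (TN _ j)// enorm_ge0.
apply: (ge0_integral_density mTn mD _ nia ndb _ _ mg g0).
- move=> r Sr; rewrite DE//; case: Sr => j _ /=; rewrite in_itv/= => /andP[ar rb].
  have arb : a j <= r <= b j by rewrite (ltW ar).
  rewrite mulr_ge0 ?(N'0 j)// mulr_ge0 ?exprn_ge0 ?(ltW (Npos j _ _))//.
  by rewrite sphere_areaE mulr_ge0// ltW// ball_volume_gt0.
- move=> j c e ac ce eb; apply: etrans (preim j c e ac ce eb) _.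
  have dF x : c <= x <= e ->
      is_derive x (1 : R) (fun r => ball_volume k.+1 * N r ^+ k.+1)
        (sphere_area k.+1 * N x ^+ k * N' x).
    move=> /andP[cx xe].
    have dNx : is_derive x (1 : R) N (N' x).
      by apply: (dN j); rewrite (le_trans ac cx) (le_trans xe eb).
    rewrite (_ : (fun r => _) = ball_volume k.+1 \*: (N ^+ k.+1)); last first.
      by apply/funext => r; rewrite /= exprfctE.
    apply: is_derive_eq; rewrite /GRing.scale/= sphere_areaE.
    by rewrite !mulrA (mulrC _ k.+1%:R).
  have cF x : c <= x <= e ->
      {for x, continuous (fun r => sphere_area k.+1 * N r ^+ k * N' r)}.
    move=> /andP[cx xe].
    have axb : a j <= x <= b j by rewrite (le_trans ac cx) (le_trans xe eb).
    have cNx : {for x, continuous N}.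
      apply/differentiable_continuous/derivable1_diffP.
      by have [] := dN _ _ axb.
    apply: continuousM; last exact: cN axb.
    apply: continuousM; first exact: cst_continuous.
    apply: (@continuous_comp _ _ _ N (fun r : R => r ^+ k)) => //.
    exact: exprn_continuous.
  transitivity (\int[mu]_(r in `]c, e])
      (sphere_area k.+1 * N r ^+ k * N' r)%:E)%E.
    rewrite (integral_ocitv_derive ce dF cF); congr EFin; ring.
  apply: eq_integral => r /set_mem/=; rewrite in_itv/= => /andP[cr re].
  rewrite DE//; apply: (sab j).
  by rewrite (le_lt_trans ac cr) (le_trans re eb).
- move=> j; have [ab|ba] := leP (a j) (b j).
    by apply: (@eq_ind_r _ _ (fun v => v < +oo)%E _ _
      (preim j _ _ (lexx _) ab (lexx _))); rewrite ltry.
  by rewrite set_itv_ge ?bnd_simp -?leNgt ?(ltW ba)// preimage_set0 measure0 ltry.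
Qed.

End polar.

Section polar.
Context {R : realType}.
Local Notation RT := (measurableTypeR R).
Local Notation mu := (@lebesgue_measure R).
Local Notation lambda n := (@lebesgue_tuple R n).

(** The new radial variables range over positive radii only. *)
Lemma integral_punctured k (f : k.+1.-tuple RT -> \bar R) :
  measurable_fun setT f -> (forall y, 0 <= f y)%E ->
  (\int[lambda k.+1]_(y in [set y | (0 < enorm (rvec y))%R]) f y =
   \int[lambda k.+1]_y f y)%E.
Proof.
move=> mf f0; rewrite [RHS](ge0_negligible_integral (N := eball k.+1 0))//; last 2 first.
- exact: measurable_eball.
- exact: lebesgue_eball0.
congr (integral _ _ _); apply/seteqP; split => y; rewrite /eball/= leNgt.
  by move=> ->; split => //; apply/negP.
by move=> [_ /negP]; rewrite negbK.
Qed.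

Lemma bigcup_itvS_oo :
  \bigcup_k `]k.+1%:R^-1, k.+1%:R]%classic = `]0, +oo[%classic :> set R.
Proof.
apply/seteqP; split => r.
  by move=> [k _ /=]; rewrite !in_itv/= andbT => /andP[+ _]; exact: lt_trans.
rewrite /= in_itv/= andbT => r0.
exists (maxn (Num.truncn r) (Num.truncn r^-1)) => //=; rewrite in_itv/=.
set k := maxn _ _; apply/andP; split.
  rewrite -[X in _ < X]invrK ltf_pV2 ?posrE ?invr_gt0//.
  apply: lt_le_trans (truncnS_gt _) _.
  by rewrite ler_nat ltnS leq_maxr.
apply: ltW; apply: lt_le_trans (truncnS_gt _) _.
by rewrite ler_nat ltnS leq_maxl.
Qed.

Lemma measurable_sin : measurable_fun setT (@sin R).
Proof. by apply: continuous_measurable_fun; exact: continuous_sin. Qed.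

Lemma measurable_cos : measurable_fun setT (@cos R).
Proof. by apply: continuous_measurable_fun; exact: continuous_cos. Qed.

Lemma lt_atanE (x y : R) : (atan x < atan y) = (x < y).
Proof. exact/leW_mono/le_mono/lt_atan. Qed.

Lemma le_atanE (x y : R) : (atan x <= atan y) = (x <= y).
Proof. exact/le_mono/lt_atan. Qed.

(** With [|y| = tan theta], the new variable is the angle between [(y, 1)] and the last axis;
    [cos r ^- 2] is the derivative of [tan]. *)
Lemma integral_radial_atan k (g : RT -> \bar R) :
  measurable_fun setT g -> (forall r, 0 <= g r)%E ->
  (\int[lambda k.+1]_y g (atan (enorm (rvec y))) =
   \int[mu]_(r in `]0%R, (pi / 2)%R[)
     (g r * (sphere_area k.+1 * tan r ^+ k * cos r ^- 2)%:E))%E.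
Proof.
move=> mg g0.
have matan : measurable_fun setT (@atan R).
  by apply: continuous_measurable_fun => x; exact: continuous_atan.
pose a j : R := atan j.+1%:R^-1; pose b j : R := atan j.+1%:R.
have SE : \bigcup_k `]a k, b k]%classic = `]0, pi / 2[%classic.
  apply/seteqP; split => r.
    move=> [j _]; rewrite /= !in_itv/= /a /b => /andP[ar rb].
    by rewrite (le_lt_trans rb (atan_ltpi2 _)) (lt_trans _ ar)// -atan0 lt_atanE.
  rewrite /= in_itv/= => /andP[r0 rp].
  have rK : atan (tan r) = r.
    by apply: tanK; rewrite in_itv/= rp andbT (lt_trans _ r0)// oppr_lt0 divr_gt0// pi_gt0.
  have : `]0, +oo[%classic (tan r).
    by rewrite /= in_itv/= andbT -lt_atanE atan0 rK.
  rewrite -bigcup_itvS_oo => -[j _ /=]; rewrite in_itv/= => /andP[jr rj].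
  by exists j => //=; rewrite in_itv/= /a /b -rK lt_atanE le_atanE jr.
have inS j c : a j <= c <= b j -> 0 < c < pi / 2.
  move=> /andP[ac cb]; rewrite (le_lt_trans cb (atan_ltpi2 _)).
  by rewrite (lt_le_trans _ ac)// -atan0 lt_atanE.
have cos0 c : 0 < c < pi / 2 -> 0 < cos c.
  move=> /andP[c0 cp]; apply: cos_gt0_pihalf; rewrite cp andbT.
  by apply: lt_trans c0; rewrite oppr_lt0 divr_gt0// pi_gt0.
have tanK' c : 0 < c < pi / 2 -> atan (tan c) = c.
  move=> /andP[c0 cp]; apply: tanK; rewrite in_itv/= cp andbT.
  by apply: lt_trans c0; rewrite oppr_lt0 divr_gt0// pi_gt0.
have mD : measurable_fun setT
    (fun r : R => sphere_area k.+1 * tan r ^+ k * cos r ^- 2).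
  apply: measurable_funM.
    apply: measurable_funM => //; apply: measurable_funX.
    apply: measurable_funM; first exact: measurable_sin.
    exact: measurable_funV measurable_cos.
  by apply: measurable_funV; apply: measurable_funX; exact: measurable_cos.
rewrite -SE; apply: etrans (@integral_radial_density R k tan (fun x => cos x ^- 2)
  (fun r => sphere_area k.+1 * tan r ^+ k * cos r ^- 2) a b atan g
  _ _ _ _ _ _ _ _ _ _ _ _) => //; rewrite ?SE.
- rewrite -integral_punctured//; last first.
    apply: (measurableT_comp mg); apply: (measurableT_comp matan).
    exact: measurable_enorm.
  congr (integral _ _ _); apply/seteqP; split => y; rewrite /= in_itv/=.
    by rewrite atan_ltpi2 andbT -[X in X < atan _]atan0 lt_atanE.
  by rewrite atan_ltpi2 andbT -[X in X < atan _]atan0 lt_atanE.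
- by move=> j; rewrite le_atanE lef_pV2 ?posrE// ler_nat.
- by move=> j; rewrite le_atanE ler_nat.
- by move=> j; rewrite atanK.
- move=> r j c e ac ce eb r0.
  have /tanK' cK : 0 < c < pi / 2 by apply: (inS j); rewrite ac (le_trans ce eb).
  have /tanK' eK : 0 < e < pi / 2 by apply: (inS j); rewrite (le_trans ac ce).
  by rewrite in_itv/= -{1}cK -{1}eK lt_atanE le_atanE.
- by move=> j c /inS /cos0 c0; apply: is_derive_tan; rewrite gt_eqF.
- move=> j c /inS /cos0 c0; apply: continuousV; first by rewrite expf_neq0// gt_eqF.
  apply: (@continuous_comp _ _ _ cos (fun r : R => r ^+ 2)).
    exact: continuous_cos.
  exact: exprn_continuous.
- by move=> j c /inS /cos0 c0; rewrite invr_ge0 exprn_ge0// ltW.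
Qed.

(** In the variable [|y|^2] the Gaussian integral over the space is half of the left-hand side. *)
Lemma sphere_area_Gamma k :
  sphere_area k.+1 * Gamma (k.+1%:R / 2) = 2 * Num.sqrt pi ^+ k.+1 :> R.
Proof.
have pos j c : (j.+1%:R : R)^-1 <= c <= j.+1%:R -> 0 < c.
  by move=> /andP[jc _]; apply: lt_le_trans jc; rewrite invr_gt0.
have sqrK (c : R) : 0 <= c -> (c `^ 2^-1) ^+ 2 = c.
  by move=> c0; rewrite -powR_mulrn ?powR_ge0// -powRrM mulVf// powRr1.
have h : (\int[mu]_(r in `]0%R, +oo[) ((expR (- r))%:E *
    (sphere_area k.+1 * (r `^ 2^-1) ^+ k * (2^-1 * r `^ (2^-1 - 1)))%:E) =
    (Num.sqrt pi ^+ k.+1)%:E)%E.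
  rewrite -bigcup_itvS_oo; apply: etrans (esym (@integral_radial_density R k
    (fun x => x `^ 2^-1) (fun x => 2^-1 * x `^ (2^-1 - 1))
    (fun r => sphere_area k.+1 * (r `^ 2^-1) ^+ k * (2^-1 * r `^ (2^-1 - 1)))
    (fun j => j.+1%:R^-1) (fun j => j.+1%:R) (fun r => r ^+ 2) (fun v => (expR (- v))%:E)
    _ _ _ _ _ _ _ _ _ _ _ _)) _.
  - by move=> j; rewrite lef_pV2 ?posrE// ler_nat.
  - by move=> j; rewrite ler_nat.
  - by move=> j; rewrite powR_gt0.
  - move=> r j c e jc ce ej r0.
    have c0 : 0 < c by apply: lt_le_trans jc; rewrite invr_gt0.
    have e0 := lt_le_trans c0 ce.
    rewrite in_itv/= -{1}(sqrK c (ltW c0)) -{1}(sqrK e (ltW e0)).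
    by rewrite ltr_pXn2r ?ler_pXn2r ?nnegrE ?powR_ge0.
  - by move=> j c /pos c0; exact: is_derive1_powR.
  - move=> j c /pos c0; apply: continuousM; first exact: cst_continuous.
    have [+ _] := is_derive1_powR (2^-1 - 1) c0.
    by move=> /derivable1_diffP /differentiable_continuous.
  - by move=> j c /pos c0; rewrite mulr_ge0// powR_ge0.
  - by [].
  - exact: measurable_funX.
  - apply: measurable_funM; last by apply: measurable_funM => //; exact: measurable_powR.
    apply: measurable_funM => //; apply: measurable_funX; exact: measurable_powR.
  - by apply/measurable_EFinP; apply: measurableT_comp => //.
  - by move=> r; rewrite lee_fin expR_ge0.
  rewrite bigcup_itvS_oo -integral_gauss_tuple -[RHS]integral_punctured//; last first.
    apply/measurable_EFinP; apply: measurableT_comp => //.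
    apply: measurableT_comp => //; apply: measurable_funX; exact: measurable_enorm.
  congr (integral _ _ _); apply/seteqP; split => y; rewrite /= in_itv/= andbT.
    by rewrite exprn_even_gt0//= lt0r enorm_ge0 andbT.
  by move=> y0; rewrite exprn_gt0.
have A0 : 0 < sphere_area k.+1 / 2 :> R.
  by rewrite divr_gt0// sphere_areaE mulr_gt0// ball_volume_gt0.
have As : sphere_area k.+1 != 0 :> R by apply/eqP => A; move: A0; rewrite A mul0r ltxx.
suff : (\int[mu]_(r in `]0%R, +oo[) (r `^ (k.+1%:R / 2 - 1) * expR (- r))%:E =
    ((sphere_area k.+1 / 2)^-1 * Num.sqrt pi ^+ k.+1)%:E)%E.
  rewrite /Gamma /Rintegral => -> /=; field.
  exact: As.
rewrite EFinM -h -ge0_integralZl//; first last.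
- by rewrite lee_fin invr_ge0 ltW.
- move=> r _; rewrite -EFinM lee_fin mulr_ge0 ?expR_ge0// mulr_ge0//.
    by rewrite mulr_ge0 ?exprn_ge0 ?powR_ge0//; lra.
  by rewrite mulr_ge0// powR_ge0.
- apply: emeasurable_funM; apply/measurable_EFinP; apply: measurable_funTS.
    by apply: measurableT_comp.
  apply: measurable_funM; last by apply: measurable_funM => //; exact: measurable_powR.
  apply: measurable_funM => //; apply: measurable_funX; exact: measurable_powR.
apply: eq_integral => r /set_mem/=; rewrite in_itv/= andbT => r0.
rewrite -!EFinM; congr EFin.
rewrite -powR_mulrn ?powR_ge0// -powRrM.
rewrite (_ : r `^ (k.+1%:R / 2 - 1) = r `^ (2^-1 * k%:R) * r `^ (2^-1 - 1)); last first.
  rewrite -powRD; last by rewrite (gt_eqF r0) implybT.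
  by congr (_ `^ _); rewrite -natr1; field.
by field; exact: As.
Qed.

End polar.

(** * The incomplete Gamma function *)

Section incomplete_gamma.
Context {R : realType}.
Local Notation RT := (measurableTypeR R).
Local Notation mu := (@lebesgue_measure R).

(** For [0 < l], raise [y <= exp y] at [y = b x / l] to the power [l]. *)
Lemma powR_le_expR (l b x : R) : 0 <= l -> 0 < b -> 0 <= x ->
  x `^ l <= (l / b) `^ l * expR (b * x).
Proof.
rewrite le_eqVlt => /predU1P[<- b0 x0|l0 b0 x0].
  by rewrite !powRr0 mul1r -[X in X <= _]expR0 ler_expR mulr_ge0// ltW.
have y0 : 0 <= b * x / l by rewrite divr_ge0 ?mulr_ge0// ltW.
have {1}-> : x = (l / b) * (b * x / l) by field; rewrite !gt_eqF.
rewrite powRM ?y0 ?divr_ge0 ?(ltW l0) ?(ltW b0)//.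
rewrite ler_wpM2l ?powR_ge0//.
have -> : b * x = (b * x / l) * l by rewrite divfK// gt_eqF.
rewrite mulfK ?gt_eqF// expRM ge0_ler_powR ?nnegrE ?expR_ge0 ?(ltW l0)//.
by apply: le_trans (expR_ge1Dx _); rewrite lerDr.
Qed.

Definition igamma_fun (l xi : R) : R := xi `^ l * expR (- xi).

Lemma igamma_fun_ge0 l xi : 0 <= igamma_fun l xi.
Proof. by rewrite mulr_ge0 ?powR_ge0 ?expR_ge0. Qed.

Lemma measurable_igamma_fun l : measurable_fun setT (igamma_fun l).
Proof.
apply: measurable_funM; first exact: measurable_powR.
by apply: measurableT_comp.
Qed.

(* This is the incomplete Gamma function at l + 1, not at l. *)
Definition igamma (l v : R) : R := \int[mu]_(xi in `[v, +oo[) igamma_fun l xi.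

Lemma igamma_lty l : 0 <= l ->
  (\int[mu]_(xi in `[0%R, +oo[) (igamma_fun l xi)%:E < +oo)%E.
Proof.
move=> l0; have h0 : 0 < 2^-1 :> R by rewrite invr_gt0.
(* Half of the decay absorbs the power; the final 2 cancels the normalising factor of the
   exponential density of rate [2^-1]. *)
set C := (l / 2^-1) `^ l * 2.
apply: (@le_lt_trans _ _ (\int[mu]_xi (C%:E * (exponential_pdf 2^-1 xi)%:E))%E).
  rewrite integral_mkcond; apply: ge0_le_integral => //.
  - by move=> x _; apply: erestrict_ge0 => y _; rewrite lee_fin igamma_fun_ge0.
  - apply/(measurable_restrictT _ (measurable_itv _)); apply/measurable_EFinP.
    apply: measurable_funTS; exact: measurable_igamma_fun.
  - apply: measurable_funeM; apply/measurable_EFinP.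
    exact: measurable_exponential_pdf.
  - move=> x _; rewrite patchE; case: ifPn => [|_]; last first.
      by rewrite -EFinM lee_fin mulr_ge0 ?exponential_pdf_ge0// mulr_ge0// powR_ge0.
    rewrite inE/= in_itv/= andbT => x0.
    rewrite -EFinM lee_fin /exponential_pdf patchE mem_set/=; last by rewrite in_itv/= x0.
    rewrite /igamma_fun /C -!mulrA [2 * _]mulrA divff// mul1r.
    have := powR_le_expR l0 h0 x0.
    move=> /(ler_wpM2r (expR_ge0 (- x))) /le_trans; apply.
    by rewrite -mulrA -expRD ler_wpM2l ?powR_ge0// ler_expR; lra.
rewrite ge0_integralZl//.
- by rewrite integral_exponential_pdf// mule1 ltry.
- by apply/measurable_EFinP; exact: measurable_exponential_pdf.
- by move=> x _; rewrite lee_fin exponential_pdf_ge0.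
- by rewrite lee_fin mulr_ge0// powR_ge0.
Qed.

Lemma igammaE l v : 0 <= l -> 0 <= v ->
  (\int[mu]_(xi in `[v, +oo[) (igamma_fun l xi)%:E)%E = (igamma l v)%:E.
Proof.
move=> l0 v0; rewrite fineK// ge0_fin_numE; last first.
  by apply: integral_ge0 => x _; rewrite lee_fin igamma_fun_ge0.
apply: le_lt_trans (igamma_lty l0); apply: ge0_subset_integral => //=.
- apply/measurable_EFinP; apply: measurable_funTS; exact: measurable_igamma_fun.
- by move=> x _; rewrite lee_fin igamma_fun_ge0.
- by apply: subset_itvr; rewrite bnd_simp.
Qed.

Lemma igamma_ge0 l v : 0 <= igamma l v.
Proof. by apply: Rintegral_ge0 => x _; exact: igamma_fun_ge0. Qed.

Lemma le_igamma l v w : 0 <= l -> 0 <= v -> v <= w -> igamma l w <= igamma l v.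
Proof.
move=> l0 v0 vw; rewrite -lee_fin -!igammaE// ?(le_trans v0)//.
apply: ge0_subset_integral => //=.
- apply/measurable_EFinP; apply: measurable_funTS; exact: measurable_igamma_fun.
- by move=> x _; rewrite lee_fin igamma_fun_ge0.
- by apply: subset_itvr; rewrite bnd_simp.
Qed.

(** Monotonicity is known for nonnegative lower limits; measurability on the whole line comes from
    Tonelli's theorem for the integrand cut off at [v <= xi]. *)
Lemma measurable_igamma l : measurable_fun setT (igamma l).
Proof.
pose f (p : RT * RT) : \bar R := if p.1 <= p.2 then (igamma_fun l p.2)%:E else 0%E.
have f0 p : (0 <= f p)%E by rewrite /f; case: ifP => // _; rewrite lee_fin igamma_fun_ge0.
have mf : measurable_fun setT f.
  apply: measurable_fun_ifT => //.
    by apply: measurable_fun_ler; [exact: measurable_fst|exact: measurable_snd].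
  apply/measurable_EFinP.
  exact: (measurableT_comp (measurable_igamma_fun l) measurable_snd).
have := measurable_fun_fubini_tonelli_F (m2 := mu) f mf f0.
move=> /(measurableT_comp (@fine_measurable R setT measurableT)).
apply: eq_measurable_fun => v _ /=; rewrite /igamma /Rintegral; congr fine.
rewrite [RHS]integral_mkcond; apply: eq_integral => xi _.
by rewrite /f/= patchE mem_setE in_itv/= andbT.
Qed.

Lemma omegaE k l u : omega k l u = igamma l (k / u ^+ 2).
Proof. by []. Qed.

(* Substitution xi = B / (t - tau). *)
Lemma integral_time (B t l : R) : 0 < B -> 0 < t -> 2 <= l ->
  (\int[mu]_(tau in `]0%R, t[) (expR (- (B / (t - tau))) * (t - tau) `^ (- l))%:E =
   (B `^ (1 - l) * igamma (l - 2) (B / t))%:E)%E.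
Proof.
move=> B0 t0 l2.
pose T (tau : R) := B / (t - tau).
(* For [v = B / (t - tau)] one has [t - tau = B / v] and [dtau = B / v^2 dv]; this gives [D], and
   [g] below is the integrand in terms of [v]. *)
pose D (v : R) := B * v ^- 2.
pose g (v : R) := ((v / B) `^ l * expR (- v))%:E.
have Bt0 : 0 < B / t by rewrite divr_gt0.
have SE : \bigcup_k `]B / t, B / t + k%:R]%classic = `]B / t, +oo[%classic.
  apply/seteqP; split => r; first by move=> [k _ /=]; rewrite !in_itv/= andbT => /andP[].
  rewrite /= in_itv/= andbT => r0; exists (Num.truncn (r - B / t)).+1 => //=.
  by rewrite in_itv/= r0 -lerBlDl ltW// truncnS_gt.
have preim c e : B / t <= c -> c <= e ->
    T @^-1` `]c, e]%classic = `]t - B / c, t - B / e]%classic.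
  move=> Bc ce; have c0 := lt_le_trans Bt0 Bc; have e0 := lt_le_trans c0 ce.
  apply/seteqP; split => r; rewrite /T /= !in_itv/=.
    (* From time [t] on [T] is nonpositive, with the default value 0 at [r = t], so these times are
       not in the preimage. *)
    have [tr|tr] := leP t r.
      move=> /andP[cT _]; move: (lt_trans c0 cT); rewrite ltNge.
      by rewrite pmulr_rle0// invr_le0 subr_le0 tr.
    have tr' : 0 < t - r by rewrite subr_gt0.
    rewrite ltr_pdivlMr// ler_pdivrMr// => /andP[h1 h2].
    rewrite ltrBlDr -ltrBlDl ltr_pdivlMr// mulrC h1/=.
    by rewrite lerBrDr -lerBrDl ler_pdivrMr// mulrC.
  move=> /andP[h1 h2]; have Be0 : 0 < B / e by rewrite divr_gt0.
  have tr' : 0 < t - r by lra.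
  rewrite ltr_pdivlMr// ler_pdivrMr//; apply/andP; split.
    by rewrite mulrC -ltr_pdivlMr//; lra.
  by rewrite mulrC -ler_pdivrMr//; lra.
have mT : measurable_fun setT T.
  by apply: measurable_funM => //; apply: measurable_funV; exact: measurable_funB.
have mD : measurable_fun setT D.
  by apply: measurable_funM => //; apply: measurable_funV; exact: measurable_funX.
have mg : measurable_fun setT g.
  apply/measurable_EFinP; apply: measurable_funM; last by apply: measurableT_comp.
  by apply: (measurableT_comp (measurable_powR l)); exact: measurable_funM.
have g0 v : (0 <= g v)%E by rewrite lee_fin mulr_ge0 ?powR_ge0 ?expR_ge0.
have := @ge0_integral_density _ _ R mu T D (fun=> B / t) (fun k => B / t + k%:R) g mT mD.
rewrite SE => /(_ _ _ _ _ _ mg g0) h.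
have -> : (\int[mu]_(tau in `]0%R, t[) (expR (- (B / (t - tau))) * (t - tau) `^ (- l))%:E =
    \int[mu]_(tau in T @^-1` `](B / t)%R, +oo[) g (T tau))%E.
  have -> : T @^-1` `]B / t, +oo[%classic = `]0, t[%classic.
    apply/seteqP; split => r; rewrite /T /= !in_itv/= ?andbT.
      have [tr|tr] := leP t r.
        move=> cT; move: (lt_trans Bt0 cT); rewrite ltNge.
        by rewrite pmulr_rle0// invr_le0 subr_le0 tr.
      rewrite ltr_pM2l// ltf_pV2 ?posrE ?subr_gt0// => h1.
      by move: h1; rewrite ltrBlDr ltrDl andbT.
    move=> /andP[r0 rt]; rewrite ltr_pM2l// ltf_pV2 ?posrE ?subr_gt0//.
    by rewrite ltrBlDr ltrDl.
  apply: eq_integral => r /set_mem/=; rewrite in_itv/= => /andP[r0 rt].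
  rewrite /g /T; congr EFin; rewrite mulrC; congr (_ * _).
  have tr' : 0 < t - r by rewrite subr_gt0.
  rewrite mulrAC divff ?gt_eqF// mul1r -[in RHS]powR_inv1 ?(ltW tr')//.
  by rewrite -powRrM mulN1r.
rewrite {}h => [|v /=|//|k|k c e|k].
- rewrite EFinM -igammaE ?divr_ge0 ?(ltW B0) ?(ltW t0)//; last by rewrite subr_ge0.
  rewrite -ge0_integralZl//=; first last.
  + by rewrite lee_fin powR_ge0.
  + by move=> x _; rewrite lee_fin igamma_fun_ge0.
  + apply/measurable_EFinP; apply: measurable_funTS; exact: measurable_igamma_fun.
  rewrite -integral_itv_obnd_cbnd; last first.
    apply: measurable_funeM; apply/measurable_EFinP; apply: measurable_funTS.
    exact: measurable_igamma_fun.
  apply: eq_integral => v /set_mem/=; rewrite in_itv/= andbT => Bv.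
  have v0 := lt_trans Bt0 Bv.
  rewrite /g /D /igamma_fun -!EFinM; congr EFin.
  rewrite powRM ?invr_ge0 ?(ltW v0) ?(ltW B0)//.
  rewrite !powRB ?(gt_eqF v0) ?(gt_eqF B0) ?implybT//.
  rewrite (powRr1 (ltW B0)) (powR_mulrn 2 (ltW v0)).
  have -> : B^-1 `^ l = (B `^ l)^-1.
    by rewrite -[B^-1]powR_inv1 ?(ltW B0)// -powRrM mulN1r powRN.
  by ring.
- by rewrite in_itv/= andbT => Bv; rewrite /D mulr_ge0 ?(ltW B0)// invr_ge0 exprn_ge0// ltW// (lt_trans Bt0).
- by rewrite lerD2l ler_nat.
- move=> Bc ce _; have c0 := lt_le_trans Bt0 Bc; have e0 := lt_le_trans c0 ce.
  rewrite preim//= [LHS]lebesgue_measure_itv/= lte_fin.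
  have dF x : c <= x <= e -> is_derive x (1 : R) (fun v => - (B / v)) (D x).
    move=> /andP[cx _]; have x0 : x != 0 by rewrite gt_eqF// (lt_le_trans c0).
    apply: is_derive_eq.
      apply: is_deriveN; apply: (is_deriveZ B); exact: is_deriveV.
    by rewrite /D /GRing.scale/= mulr1 mulrN opprK.
  have cD x : c <= x <= e -> {for x, continuous D}.
    move=> /andP[cx _]; apply: continuousM; first exact: cst_continuous.
    apply: continuousV; last exact: exprn_continuous.
    by rewrite expf_neq0// gt_eqF// (lt_le_trans c0).
  rewrite (integral_ocitv_derive ce dF cD).
  have Bce : B / e <= B / c by rewrite ler_pM2l// lef_pV2.
  have [Blt|] := ltP (t - B / c) (t - B / e).
    by rewrite -EFinB; congr EFin; ring.
  by move=> Beq; congr EFin; lra.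
- have [->|k0] := eqVneq k 0%N.
    by rewrite addr0 set_itvoc0 preimage_set0 measure0 ltry.
  rewrite preim ?lexx ?lerDl//= [X in (X < _)%E]lebesgue_measure_itv/=.
  by case: ifP => _; rewrite ?ltry.
Qed.

End incomplete_gamma.

(** * The kernel of the gradient *)

Section kernel.
Context {R : realType}.
Local Notation RT := (measurableTypeR R).
Local Notation mu := (@lebesgue_measure R).
Local Notation lambda n := (@lebesgue_tuple R n).
Variables (m : nat) (a : R) (x : 'rV[R]_m.+1) (t : R).
Local Notation n := (m.+1%:R : R).

Definition heat_exponent (w : m.-tuple RT * RT) : R :=
  enorm (x - bdry w.1) ^+ 2 / (4 * a ^+ 2 * (t - w.2)).

(** The factor [2 / (4 a^2)] comes from differentiating the exponent of the Gaussian, the rest is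
    the normalisation of the potential. *)
Definition kernel_const : R := 2 / (4 * a ^+ 2 * (4 * a ^+ 2 * pi) `^ (n / 2)).

(* Up to its sign, the kernel of f |-> (grad (u / x_n), z). *)
Definition gradient_kernel (z : 'rV[R]_m.+1) (w : m.-tuple RT * RT) : R :=
  kernel_const * dotp (x - bdry w.1) z *
  (expR (- heat_exponent w) / (t - w.2) `^ ((n + 4) / 2)).

Lemma measurable_dotp_bdry z :
  measurable_fun setT (fun y : m.-tuple RT => dotp (x - bdry y) z).
Proof.
apply: measurable_sum => i; apply: measurable_funM => //.
rewrite (_ : (fun _ => _) = fun y : m.-tuple RT => x 0 i - bdry y 0 i); last first.
  by apply/funext => y; rewrite !mxE.
apply: measurable_funB => //; under eq_fun do rewrite mxE.
by case: unlift => [j|] /=; [exact: measurable_tnth|exact: measurable_cst].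
Qed.

Lemma measurable_sqr_enorm_bdry :
  measurable_fun setT (fun y : m.-tuple RT => enorm (x - bdry y) ^+ 2).
Proof.
rewrite (_ : (fun _ => _) = fun y => dotp (x - bdry y) (x - bdry y)); last first.
  by apply/funext => y; exact: sqr_enorm.
apply: measurable_sum => i.
rewrite (_ : (fun _ => _) = fun y : m.-tuple RT => (x 0 i - bdry y 0 i) ^+ 2); last first.
  by apply/funext => y; rewrite !mxE expr2.
apply: measurable_funX; apply: measurable_funB => //; under eq_fun do rewrite mxE.
by case: unlift => [j|] /=; [exact: measurable_tnth|exact: measurable_cst].
Qed.

Lemma measurable_time_to : measurable_fun setT (fun w : m.-tuple RT * RT => t - w.2).
Proof. by apply: measurable_funB => //; exact: measurable_snd. Qed.

Lemma measurable_heat_exponent : measurable_fun setT heat_exponent.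
Proof.
apply: measurable_funM.
  exact: (measurableT_comp measurable_sqr_enorm_bdry measurable_fst).
by apply: measurable_funV; apply: measurable_funM => //; exact: measurable_time_to.
Qed.

Lemma measurable_heat_factor l : measurable_fun setT
  (fun w => expR (- heat_exponent w) / (t - w.2) `^ l).
Proof.
apply: measurable_funM.
  by apply: measurableT_comp => //; apply: measurableT_comp => //;
    exact: measurable_heat_exponent.
apply: measurable_funV; exact: (measurableT_comp (measurable_powR l) measurable_time_to).
Qed.

Lemma measurable_gradient_kernel z : measurable_fun setT (gradient_kernel z).
Proof.
apply: measurable_funM; last exact: measurable_heat_factor.
apply: measurable_funM => //.
exact: (measurableT_comp (measurable_dotp_bdry z) measurable_fst).
Qed.

Hypotheses (a0 : 0 < a) (xn0 : 0 < xlast x) (t0 : 0 < t).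

Lemma kernel_const_gt0 : 0 < kernel_const.
Proof.
have a4 : 0 < 4 * a ^+ 2 by rewrite mulr_gt0// exprn_gt0.
by rewrite divr_gt0// mulr_gt0// powR_gt0// mulr_gt0// pi_gt0.
Qed.

Definition lateral : m.-tuple RT := [tuple x 0 (lift ord_max i) | i < m].

(** At the boundary point [x' - c y] the difference to [x] is [(c y, x_n)]. The choice [c = x_n]
    makes it a multiple of [(y, 1)], which is the central projection from [x]. *)
Lemma sub_bdry_lateral (c : R) (y : m.-tuple RT) :
  x - bdry (taffine (- c) lateral y) = c *: bdry y + xlast x *: en m.
Proof.
apply/rowP => i; rewrite !mxE eqxx /=; case: (unliftP ord_max i) => [j|] -> /=.
  rewrite !tnth_mktuple [_ == ord_max](_ : _ = false); last first.
    by rewrite eq_sym; exact/negbTE/neq_lift.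
  by rewrite mulr0 addr0 opprD addrCA subrr addr0 mulNr opprK.
by rewrite eqxx mulr0 add0r mulr1 subr0.
Qed.

Lemma sub_bdry_homog (y : m.-tuple RT) :
  x - bdry (taffine (- xlast x) lateral y) = xlast x *: rvec (homog y).
Proof. by rewrite sub_bdry_lateral rvec_tsnoc scalerDr scalerA mulr1. Qed.

Definition sphere_fun (kp lb e q : R) (z : 'rV[R]_m.+1) (s : m.+1.-tuple RT) : R :=
  omega kp lb (dotp (rvec s) (en m)) * `|dotp (rvec s) (en m)| `^ e *
  `|dotp (rvec s) z| `^ q.

Lemma measurable_sphere_fun kp lb e q z : measurable_fun setT (sphere_fun kp lb e q z).
Proof.
apply: measurable_funM; last first.
  apply: (measurableT_comp (measurable_powR q)); apply: measurableT_comp => //.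
  exact: measurable_dotp.
apply: measurable_funM; last first.
  apply: (measurableT_comp (measurable_powR e)); apply: measurableT_comp => //.
  exact: measurable_dotp.
apply: (measurableT_comp (measurable_igamma lb)).
apply: measurable_funM => //; apply: measurable_funV; apply: measurable_funX.
exact: measurable_dotp.
Qed.

Lemma sphere_fun_ge0 kp lb e q z s : 0 <= sphere_fun kp lb e q z s.
Proof. by rewrite mulr_ge0 ?powR_ge0// mulr_ge0 ?powR_ge0// igamma_ge0. Qed.

Lemma sphere_fun_even kp lb e q z s :
  sphere_fun kp lb e q z (tscale (-1) s) = sphere_fun kp lb e q z s.
Proof. by rewrite /sphere_fun rvec_tscale !dotpZl !mulN1r !normrN /omega sqrrN. Qed.

(** In this order: the constant of the kernel, the Jacobian of [y |-> x' - x_n y], the factor [x_n]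
    of the inner product, the constants of the substitution in time, and [1 / 2] for passing from
    the half-sphere to the sphere. *)
Definition norm_const (q : R) : R :=
  kernel_const `^ q * xlast x ^+ m * xlast x `^ q *
  (q * xlast x ^+ 2 / (4 * a ^+ 2)) `^ (1 - (n + 4) * q / 2) / 2.

Lemma integral_gradient_kernel (q : R) (z : 'rV[R]_m.+1) : 1 <= q ->
  (\int[lambda m]_y \int[mu]_(tau in `]0%R, t[)
     (`|gradient_kernel z (y, tau)| `^ q)%:E =
   (norm_const q)%:E * \int[surface m.+1]_(s in usphere m.+1)
     (sphere_fun (q * xlast x ^+ 2 / (4 * a ^+ 2 * t)) ((n + 4) * q / 2 - 2)
       ((n + 3) * q - (n + 2)) q z s)%:E)%E.
Proof.
move=> q1; have q0 : 0 < q by rewrite (lt_le_trans _ q1).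
have a4 : 0 < 4 * a ^+ 2 by rewrite mulr_gt0// exprn_gt0.
have n1 : 1 <= n by rewrite ler1n.
(* The substitution in time produces the incomplete Gamma integral with exponent [l - 2], which has
   to be nonnegative. *)
set l := (n + 4) * q / 2; have l2 : 2 <= l.
  rewrite /l ler_pdivlMr//; apply: (@le_trans _ _ ((n + 4) * 1)); first by lra.
  by rewrite ler_wpM2l//; lra.
set kp := q * _ / _; set F := sphere_fun _ _ _ _ _.
set xn := xlast x in kp F *; have xnp : 0 < xn := xn0.
pose P (y : m.-tuple RT) := enorm (rvec (homog y)).
have P0 y : 0 < P y by exact: enorm_homog_gt0.
have mK : measurable_fun setT (fun w => `|gradient_kernel z w| `^ q).
  apply: (measurableT_comp (measurable_powR q)); apply: measurableT_comp => //.
  exact: measurable_gradient_kernel.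
have mK1 : measurable_fun setT (fun y : m.-tuple RT => \int[mu]_(tau in `]0%R, t[)
     (`|gradient_kernel z (y, tau)| `^ q)%:E)%E.
  pose f (w : m.-tuple RT * RT) : \bar R :=
    if (0 < w.2) && (w.2 < t) then (`|gradient_kernel z w| `^ q)%:E else 0%E.
  have f0 w : (0 <= f w)%E by rewrite /f; case: ifP => // _; rewrite lee_fin powR_ge0.
  have mf : measurable_fun setT f.
    apply: measurable_fun_ifT => //; last exact/measurable_EFinP.
    by apply: measurable_and; apply: measurable_fun_ltr => //; exact: measurable_snd.
  apply: eq_measurable_fun (measurable_fun_fubini_tonelli_F (m2 := mu) f mf f0).
  move=> y _; rewrite /fubini_F [RHS]integral_mkcond.
  by apply: eq_integral => tau _; rewrite patchE mem_setE in_itv.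
have nxn : - xn != 0 by rewrite oppr_eq0 gt_eqF.
rewrite (ge0_integral_taffine lateral nxn mK1); last first.
  by move=> y; apply: integral_ge0 => tau _; rewrite lee_fin powR_ge0.
rewrite (integral_surface_projection (F := EFin \o F)); first last.
- by move=> s; rewrite /= /F sphere_fun_even.
- by move=> s; rewrite lee_fin sphere_fun_ge0.
- by apply/measurable_EFinP; exact: measurable_sphere_fun.
set K1 := kernel_const `^ q * xn `^ q * (q * xn ^+ 2 / (4 * a ^+ 2)) `^ (1 - l).
have -> : (\int[lambda m]_y \int[mu]_(tau in `]0%R, t[)
     (`|gradient_kernel z (taffine (- xn) lateral y, tau)| `^ q)%:E =
   \int[lambda m]_y (K1%:E * ((EFin \o F) (radial (homog y)) *
     (enorm (rvec (homog y)) ^- m.+1)%:E)))%E.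
  apply: eq_integral => y _.
  have X2 : 0 < xn * P y by rewrite mulr_gt0.
  set B := q * (xn * P y) ^+ 2 / (4 * a ^+ 2).
  have B0 : 0 < B by rewrite divr_gt0// mulr_gt0// exprn_gt0.
  (* [(P y)^-1] is the cosine of the angle between [(y, 1)] and the last axis, so this is the lower
     limit in [omega]. *)
  have Bt : B / t = kp / (P y)^-1 ^+ 2.
    by rewrite /B /kp; field; rewrite !gt_eqF.
  transitivity (((kernel_const * (xn * `|dotp (rvec (homog y)) z|)) `^ q)%:E *
    \int[mu]_(tau in `]0%R, t[) (expR (- (B / (t - tau))) * (t - tau) `^ (- l))%:E)%E.
    rewrite -ge0_integralZl//; last 3 first.
    - apply/measurable_EFinP; apply: measurable_funTS; apply: measurable_funM.
        apply: measurableT_comp => //; apply: measurableT_comp => //.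
        apply: measurable_funM => //; apply: measurable_funV.
        exact: measurable_funB.
      by apply: (measurableT_comp (measurable_powR _)); exact: measurable_funB.
    - by move=> tau _; rewrite lee_fin mulr_ge0 ?powR_ge0 ?expR_ge0.
    - by rewrite lee_fin powR_ge0.
    apply: eq_integral => tau /set_mem/=; rewrite in_itv/= => /andP[tau0 taut].
    have s0 : 0 < t - tau by rewrite subr_gt0.
    rewrite -EFinM; congr EFin.
    rewrite /gradient_kernel /heat_exponent/= sub_bdry_homog -/xn.
    rewrite enormZ (gtr0_norm xnp) -/(P y) dotpZl.
    rewrite normrM (normrM kernel_const) (gtr0_norm kernel_const_gt0).
    rewrite (normrM xn) (gtr0_norm xnp) [X in _ * X](ger0_norm (divr_ge0 (expR_ge0 _) (powR_ge0 _ _))).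
    have h1 : 0 <= kernel_const * (xn * `|dotp (rvec (homog y)) z|).
      exact: mulr_ge0 (ltW kernel_const_gt0) (mulr_ge0 (ltW xnp) (normr_ge0 _)).
    have h2 : 0 <= ((t - tau) `^ ((n + 4) / 2))^-1 by rewrite invr_ge0 powR_ge0.
    rewrite (powRM _ h1) ?(powRM _ (expR_ge0 _) h2) ?mulr_ge0 ?expR_ge0//.
    congr (_ * _); congr (_ * _).
      by rewrite -expRM; congr expR; rewrite /B; field; rewrite !gt_eqF.
    by rewrite -powRN -powRrM; congr (_ `^ _); rewrite /l; field.
  rewrite integral_time// -!EFinM; congr EFin.
  have Py : dotp (rvec (radial (homog y))) (en m) = (P y)^-1.
    by rewrite rvec_radial dotpZl dotp_en mxE tnth_tsnoc_max mulr1.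
  have Pz : dotp (rvec (radial (homog y))) z = (P y)^-1 * dotp (rvec (homog y)) z.
    by rewrite rvec_radial dotpZl.
  rewrite /F /sphere_fun Py Pz omegaE -/(P y) Bt normrM gtr0_norm ?invr_gt0//.
  set d := `|dotp _ z|; set G := igamma _ _; have d0 : 0 <= d by exact: normr_ge0.
  have PE r : (P y)^-1 `^ r = P y `^ (- r).
    by rewrite -[(P y)^-1]powR_inv1 ?(ltW (P0 y))// -powRrM mulN1r.
  have P0' : 0 <= P y by exact: ltW.
  (* The power of [P y] left by the time integral splits into the power of the cosine in
     [sphere_fun], the homogeneity [q] of the factor with [z], and the Jacobian of the central
     projection. *)
  have key : (P y ^+ 2) `^ (1 - l) = (P y)^-1 `^ ((n + 3) * q - (n + 2)) *
      (P y)^-1 `^ q * P y ^- m.+1.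
    rewrite !PE -powR_mulrn// -powR_mulrn// -powRN -powRrM.
    rewrite -!powRD ?(gt_eqF (P0 y)) ?implybT//; congr (_ `^ _); rewrite /l; by field.
  have -> : B `^ (1 - l) =
      (q * xn ^+ 2 / (4 * a ^+ 2)) `^ (1 - l) * (P y ^+ 2) `^ (1 - l).
    rewrite -powRM ?exprn_ge0//; last by rewrite divr_ge0 ?mulr_ge0 ?ltW// exprn_gt0.
    by congr (_ `^ _); rewrite /B exprMn; ring.
  rewrite key (powRM _ (ltW kernel_const_gt0)); last by rewrite mulr_ge0// ltW.
  rewrite (powRM _ (ltW xnp) d0) (powRM (x := (P y)^-1)) ?invr_ge0// /K1.
  by ring.
rewrite ge0_integralZl//; last 3 first.
- apply: emeasurable_funM.
    apply/measurable_EFinP; apply: (measurableT_comp (measurable_sphere_fun _ _ _ _ _)).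
    apply: (measurableT_comp (@measurable_radial R m.+1)); exact: measurable_homog.
  apply/measurable_EFinP; apply: measurable_funV; apply: measurable_funX.
  exact: (measurableT_comp (@measurable_enorm R m.+1) (@measurable_homog R m)).
- by move=> y _; rewrite mule_ge0// lee_fin ?sphere_fun_ge0// invr_ge0 exprn_ge0// enorm_ge0.
- by rewrite lee_fin /K1 !mulr_ge0// powR_ge0.
rewrite muleA [RHS]muleA -!EFinM; congr (_%:E * _)%E.
by rewrite normrN gtr0_norm// /norm_const /K1 -/xn -/l; field.
Qed.

End kernel.

(** * The formula for the coefficient *)

Section exponents.
Context {R : realType}.

Lemma cvg_shift_inv (c L M : R) (g : R -> R) :
  (forall r, c < r -> g r = L + M * (r - c)^-1) -> g r @[r --> +oo] --> L.
Proof.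
move=> gE.
have h : (r - c)^-1 @[r --> +oo] --> (0 : R).
  apply/gtr0_cvgV0; last exact: cvg_addrr.
  near=> r; rewrite subr_gt0; near: r; exact: nbhs_pinfty_gt (num_real c).
have : L + M * (r - c)^-1 @[r --> +oo] --> L + M * 0.
  by apply: cvgD; [exact: cvg_cst|apply: cvgM => //; exact: cvg_cst].
rewrite mulr0 addr0; apply: cvg_trans; apply: near_eq_cvg; near=> r.
rewrite gE//; near: r; exact: nbhs_pinfty_gt (num_real c).
Unshelve. all: by end_near. Qed.

Variable p : \bar R.
Hypothesis p1 : (1 < p)%E.
Local Notation q := (conj_exponent p).

Lemma conj_exponent_fin (r : R) : 1 < r -> conj_exponent r%:E = r / (r - 1).
Proof.
move=> r1; rewrite /conj_exponent /hoelder_conjugate/= eqe gt_eqF ?(lt_trans ltr01)//.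
by rewrite -EFinD inver subr_eq0 gt_eqF.
Qed.

Lemma conj_exponentE : at_exponent (fun r => r / (r - 1)) p = q.
Proof.
case: p p1 => [r| |//]; first by rewrite lte_fin => r1; rewrite conj_exponent_fin.
move=> _; rewrite /conj_exponent hoelder_conjugatey /=; apply: cvg_lim => //.
apply: (@cvg_shift_inv 1 1 1) => r r1; field.
by rewrite subr_eq0 gt_eqF.
Qed.

Lemma conj_exponent_ge1 : 1 <= q.
Proof.
case: p p1 => [r| |//]; last by rewrite /conj_exponent hoelder_conjugatey.
rewrite lte_fin => r1; rewrite conj_exponent_fin//.
by rewrite ler_pdivlMr ?subr_gt0// mul1r lerBlDr lerDl.
Qed.

(* The exponents are affine in 1 / (p - 1) = q - 1. *)
Lemma at_exponent_affine (L M : R) (g : R -> R) :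
  (forall r, 1 < r -> g r = L + M * (r - 1)^-1) ->
  at_exponent g p = L + M * (q - 1).
Proof.
move=> gE; case: p p1 => [r| |//].
  rewrite lte_fin => r1; rewrite /= gE// conj_exponent_fin//; congr (_ + _ * _).
  by field; rewrite subr_eq0 gt_eqF.
move=> _; rewrite /conj_exponent hoelder_conjugatey /= subrr mulr0 addr0.
by apply: cvg_lim => //; exact: cvg_shift_inv gE.
Qed.

Lemma inv_conj_exponentE : at_exponent (fun r => (r - 1) / r) p = q^-1.
Proof.
case: p p1 => [r| |//]; first by rewrite lte_fin => r1; rewrite conj_exponent_fin// invf_div.
move=> _; rewrite /conj_exponent hoelder_conjugatey /= invr1; apply: cvg_lim => //.
apply: (@cvg_shift_inv 0 1 (-1)) => r r0; rewrite subr0; field.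
by rewrite gt_eqF.
Qed.

Lemma fine_inv_exponentE : fine p^-1%E = 1 - q^-1.
Proof.
case: p p1 => [r| |//]; last by rewrite /conj_exponent hoelder_conjugatey /= invr1 subrr.
rewrite lte_fin => r1; rewrite conj_exponent_fin// invf_div.
have r0 : r != 0 by rewrite gt_eqF// (lt_trans ltr01).
by rewrite inver (negbTE r0)/=; field.
Qed.

Variable n : nat.

Lemma exponent_cosE : at_exponent (fun r => (n%:R + r + 2) / (r - 1)) p =
  (n%:R + 3) * q - (n%:R + 2).
Proof.
rewrite (@at_exponent_affine 1 (n%:R + 3)); first by ring.
by move=> r r1; field; rewrite subr_eq0 gt_eqF.
Qed.

Lemma lambdaE : at_exponent (fun r => (n%:R * r + 4) / (2 * (r - 1))) p = lambda n p.
Proof.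
rewrite (@at_exponent_affine (n%:R / 2) ((n%:R + 4) / 2)).
  by rewrite /lambda; field.
by move=> r r1; field; rewrite subr_eq0 gt_eqF.
Qed.

Lemma exponent_cos_thetaE : at_exponent (fun r => (n%:R + 2 * (r + 1)) / (r - 1)) p =
  (n%:R + 4) * q - (n%:R + 2).
Proof.
rewrite (@at_exponent_affine 2 (n%:R + 4)); first by ring.
by move=> r r1; field; rewrite subr_eq0 gt_eqF.
Qed.

Lemma kappaE (a xn t : R) : 0 < a -> 0 < t ->
  at_exponent (fun r => r * xn ^+ 2 / (4 * a ^+ 2 * (r - 1) * t)) p = kappa a p xn t.
Proof.
move=> a0 t0; rewrite (@at_exponent_affine (xn ^+ 2 / (4 * a ^+ 2 * t))
  (xn ^+ 2 / (4 * a ^+ 2 * t))).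
  by rewrite /kappa; ring.
move=> r r1; have : r - 1 != 0 by rewrite subr_eq0 gt_eqF.
by move=> h; field; rewrite h !gt_eqF.
Qed.

End exponents.

Section formula.
Context {R : realType}.
Local Notation RT := (measurableTypeR R).
Local Notation mu := (@lebesgue_measure R).
Variables (m : nat) (a : R) (p : \bar R) (x : 'rV[R]_m.+1) (t : R).
Hypotheses (a0 : 0 < a) (p1 : (1 < p)%E) (xn0 : 0 < xlast x) (t0 : 0 < t).
Local Notation n := (m.+1%:R : R).
Local Notation q := (conj_exponent p).
Local Notation xn := (xlast x).

Let q1 : 1 <= q. Proof. exact: conj_exponent_ge1. Qed.
Let q0 : 0 < q. Proof. exact: lt_le_trans q1. Qed.
Let n1 : 1 <= n. Proof. by rewrite ler1n. Qed.

(* Comparing logarithms makes the identity linear in the exponents. *)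
Lemma prefactorE : prefactor a m.+1 p xn = norm_const a x q `^ q^-1.
Proof.
have a4 : 0 < 4 * a ^+ 2 by rewrite mulr_gt0// exprn_gt0.
have pi0 : 0 < (pi : R) := pi_gt0 R.
set lhs := prefactor _ _ _ _.
have lhs0 : 0 < lhs.
  by rewrite /lhs /prefactor /cnp !(divr_gt0, mulr_gt0) ?powR_gt0// mulr_gt0// powR_gt0.
have nc0 : 0 < norm_const a x q.
  rewrite /norm_const divr_gt0// !mulr_gt0 ?powR_gt0 ?exprn_gt0//.
    exact: kernel_const_gt0.
  by rewrite divr_gt0// mulr_gt0// exprn_gt0.
apply: ln_inj; rewrite ?posrE ?powR_gt0// ln_powR.
rewrite /lhs /prefactor /cnp /norm_const /kernel_const fine_inv_exponentE//.
have D2 : 0 < (4 * a ^+ 2 * pi) `^ (n / 2) by rewrite powR_gt0// mulr_gt0.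
rewrite -[xn ^+ m]powR_mulrn ?(ltW xn0)// -[xn ^+ 2]powR_mulrn ?(ltW xn0)//.
rewrite !(lnM, lnV, ln_powR) ?posrE ?(powR_gt0, invr_gt0, mulr_gt0, exprn_gt0)//.
have -> : m%:R = n - 1 :> R by rewrite -natr1 addrK.
by field; rewrite gt_eqF.
Qed.

Let kp := kappa a p xn t.
Let lb := lambda m.+1 p.
Let e : R := (n + 3) * q - (n + 2).

Let lb0 : 0 <= lb.
Proof.
rewrite /lb /lambda; have := ler_wpM2l (ltW (lt_le_trans ltr01 n1)) q1.
by have := q1; have := n1; nra.
Qed.

Let e0 : 0 < e.
Proof. by rewrite /e; have := q1; have := n1; nra. Qed.

Let kp0 : 0 <= kp.
Proof. by rewrite /kp /kappa divr_ge0 ?mulr_ge0 ?exprn_ge0 ?ltW// mulr_gt0// mulr_gt0// exprn_gt0. Qed.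

Let F (z : 'rV[R]_m.+1) := sphere_fun kp lb e q z.

Lemma sphere_integralRE (z : 'rV[R]_m.+1) : sphere_integral a p xn t z =
  \int[surface m.+1]_(s in usphere m.+1) F z s.
Proof.
rewrite /sphere_integral exponent_cosE// conj_exponentE//.
Qed.

Lemma surface_usphere_lty k : (surface k.+1 (@usphere R k.+1) < +oo)%E.
Proof.
rewrite -[X in (X < _)%E]mul1e -integral_cst; last exact: measurable_usphere.
rewrite (integral_surface (F := cst 1%E))//.
rewrite integral_cst ?mul1e; last exact: measurable_pball.
apply: (@le_lt_trans _ _ (k.+1%:R%:E * (ball_volume k.+1)%:E)%E); last first.
  by rewrite -EFinM ltry.
rewrite lee_wpmul2l// -lebesgue_eball1; apply: le_measure; rewrite ?inE.
- exact: measurable_pball.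
- exact: measurable_eball.
- by move=> y /= /andP[].
Qed.

(** On a sphere of finite area, the powers of inner products of unit vectors are at most 1, and
    [omega] is at most the complete integral [igamma lb 0]. *)
Lemma sphere_integral_fin (z : 'rV[R]_m.+1) : enorm z = 1 ->
  (\int[surface m.+1]_(s in usphere m.+1) (F z s)%:E)%E =
  (sphere_integral a p xn t z)%:E.
Proof.
move=> z1; rewrite sphere_integralRE fineK// ge0_fin_numE; last first.
  by apply: integral_ge0 => s _; rewrite lee_fin sphere_fun_ge0.
apply: (@le_lt_trans _ _ (\int[surface m.+1]_(s in usphere m.+1) (igamma lb 0)%:E)%E).
  apply: ge0_le_integral => //.
  - exact: measurable_usphere.
  - by move=> s _; rewrite lee_fin sphere_fun_ge0.
  - by apply/measurable_EFinP; apply: measurable_funTS; exact: measurable_sphere_fun.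
  - move=> s; rewrite /usphere/= => s1; rewrite lee_fin /F /sphere_fun omegaE.
    have le1 (v : 'rV[R]_m.+1) (r : R) : enorm v = 1 -> 0 <= r -> `|dotp (rvec s) v| `^ r <= 1.
      move=> v1 r0; have one : 1 `^ r = 1 :> R by rewrite powR1.
    rewrite -[leRHS]one ge0_ler_powR// ?nnegrE//.
      by have := dotp_le (rvec s) v; rewrite s1 v1 mulr1.
    rewrite -[leRHS]mulr1 ler_pM ?powR_ge0 ?le1 ?(ltW q0)//.
      by rewrite mulr_ge0 ?powR_ge0 ?igamma_ge0.
    rewrite -[leRHS]mulr1 ler_pM ?powR_ge0 ?igamma_ge0 ?le1 ?(ltW e0) ?enorm_en//.
    by rewrite le_igamma// divr_ge0// sqr_ge0.
rewrite integral_cst; last exact: measurable_usphere.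
by rewrite lte_mul_pinfty ?lee_fin ?igamma_ge0// surface_usphere_lty.
Qed.

Lemma sphere_integral_le_en (z : 'rV[R]_m.+1) : enorm z = 1 ->
  sphere_integral a p xn t z <= sphere_integral a p xn t (en m).
Proof.
move=> z1; rewrite -lee_fin -(sphere_integral_fin z1) -(sphere_integral_fin (enorm_en m)).
pose Phi (u : R) := igamma lb (kp / u ^+ 2) * u `^ e.
have FE v s : F v s = Phi `|dotp (rvec s) (en m)| * `|dotp (rvec s) v| `^ q.
  by rewrite /F /sphere_fun omegaE /Phi real_normK ?num_real.
under eq_integral do rewrite FE.
under [X in (_ <= X)%E]eq_integral do rewrite FE.
apply: (@integral_surface_rearrangement R m.+1 (en m) z Phi (fun u => u `^ q)) => //.
- exact: enorm_en.
- apply: measurable_funM; last exact: measurable_powR.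
  apply: (measurableT_comp (measurable_igamma lb)).
  by apply: measurable_funM => //; apply: measurable_funV; exact: measurable_funX.
- move=> u v; rewrite !nnegrE => u0 v0 uv; rewrite /Phi.
  (* At [u = 0] the lower limit [kp / u ^+ 2] defaults to 0, where the first factor is largest; the
     second factor vanishes there since [0 < e], so [Phi] is still nondecreasing. *)
  have [->|u0'] := eqVneq u 0.
    by rewrite powR0 ?gt_eqF// mulr0 mulr_ge0 ?powR_ge0 ?igamma_ge0.
  have up : 0 < u by rewrite lt0r u0'.
  apply: ler_pM; rewrite ?powR_ge0 ?igamma_ge0//.
    have vp : 0 < v by exact: lt_le_trans uv.
    apply: le_igamma => //; first by rewrite divr_ge0// sqr_ge0.
    apply: ler_wpM2l => //; rewrite lef_pV2 ?posrE ?exprn_gt0//.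
    by rewrite lerXn2r// nnegrE.
  by rewrite ge0_ler_powR ?nnegrE// ltW.
- by move=> u v u0 v0 uv; apply: ge0_ler_powR => //; rewrite ltW.
- by move=> u; rewrite mulr_ge0 ?powR_ge0 ?igamma_ge0.
- by move=> u; exact: powR_ge0.
Qed.

Lemma sup_sphere_integrals :
  sup (sphere_integrals m a p xn t) = sphere_integral a p xn t (en m).
Proof.
have ub : ubound (sphere_integrals m a p xn t) (sphere_integral a p xn t (en m)).
  by move=> _ [z /= z1 <-]; exact: sphere_integral_le_en.
have inS : sphere_integrals m a p xn t (sphere_integral a p xn t (en m)).
  by exists (en m) => //=; exact: enorm_en.
apply/eqP; rewrite eq_le; apply/andP; split.
  by apply: ge_sup => //; exists (sphere_integral a p xn t (en m)).
by apply: ub_le_sup => //; exists (sphere_integral a p xn t (en m)).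
Qed.

Lemma W_formulaE : W_formula m a p xn t =
  (norm_const a x q * sphere_integral a p xn t (en m)) `^ q^-1.
Proof.
rewrite /W_formula sup_sphere_integrals inv_conj_exponentE// prefactorE -powRM//.
  rewrite /norm_const divr_ge0// !mulr_ge0 ?powR_ge0// exprn_ge0// ltW//.
by rewrite sphere_integralRE; apply: Rintegral_ge0 => s _; exact: sphere_fun_ge0.
Qed.

End formula.

(** * The sphere integral in terms of the angle *)

Section theta.
Context {R : realType}.
Local Notation RT := (measurableTypeR R).
Local Notation mu := (@lebesgue_measure R).
Variables (k : nat) (a : R) (p : \bar R) (x : 'rV[R]_k.+2) (t : R).
Hypotheses (a0 : 0 < a) (p1 : (1 < p)%E) (xn0 : 0 < xlast x) (t0 : 0 < t).
Local Notation n := (k.+2%:R : R).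
Local Notation q := (conj_exponent p).
Local Notation xn := (xlast x).

Lemma sqr_enorm_homog m (y : m.-tuple RT) :
  enorm (rvec (homog y)) ^+ 2 = 1 + enorm (rvec y) ^+ 2.
Proof.
rewrite !sqr_enorm /dotp big_ord_recr/= addrC !mxE tnth_tsnoc_max mulr1.
congr (_ + _); apply: eq_bigr => i _; rewrite !mxE.
rewrite (_ : widen_ord _ i = lift ord_max i) ?tnth_tsnoc_lift//.
by apply/val_inj; rewrite /= /bump leqNgt ltn_ord.
Qed.

(** For [z = e_n] the integrand depends only on the cosine of the projected point, which is
    [cos (atan |y|)]; polar coordinates in the hyperplane then apply. *)
Lemma sphere_integral_theta : sphere_integral a p xn t (en k.+1) =
  2 * sphere_area k.+1 * \int[mu]_(theta in `[0%R, (pi / 2)%R])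
    (igamma (lambda k.+2 p) (q * xn ^+ 2 / (4 * a ^+ 2 * t * cos theta ^+ 2)) *
     cos theta `^ ((n + 4) * q - (n + 2)) * sin theta ^+ k).
Proof.
have q1 : 1 <= q by exact: conj_exponent_ge1.
have q0 : 0 < q by exact: lt_le_trans q1.
have n2 : 2 <= n by rewrite ler_nat.
set lb := lambda k.+2 p; set e : R := (n + 3) * q - (n + 2).
have lb0 : 0 <= lb by rewrite /lb /lambda; nra.
set c := _ - (n + 2); have cE : c = e + q by rewrite /c /e; ring.
pose kp := kappa a p xn t.
(* The extra exponent [n] is the Jacobian of the central projection; multiplied by
   [tan r ^+ k * cos r ^- 2] it leaves [sin r ^+ k], as [n = k + 2]. *)
pose g (r : RT) : R := igamma lb (kp / cos r ^+ 2) * `|cos r| `^ (c + n).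
have g0 r : 0 <= g r by rewrite mulr_ge0 ?powR_ge0 ?igamma_ge0.
have mg : measurable_fun setT g.
  apply: measurable_funM.
    apply: (measurableT_comp (measurable_igamma lb)).
    apply: measurable_funM => //; apply: measurable_funV; apply: measurable_funX.
    exact: measurable_cos.
  apply: (measurableT_comp (measurable_powR _)); apply: measurableT_comp => //.
  exact: measurable_cos.
apply: EFin_inj; rewrite -sphere_integral_fin ?enorm_en//.
rewrite integral_surface_projection; first last.
- by move=> s; rewrite sphere_fun_even.
- by move=> s; rewrite lee_fin sphere_fun_ge0.
- by apply/measurable_EFinP; exact: measurable_sphere_fun.
under eq_integral => y _.
  rewrite (_ : (_ * _)%E = (g (atan (enorm (rvec y))))%:E); last first.
    have P0 := enorm_homog_gt0 y.
    rewrite -EFinM /sphere_fun /g rvec_radial dotpZl dotp_en mxE tnth_tsnoc_max mulr1.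
    rewrite cos_atan -sqr_enorm_homog sqrtr_sqr (gtr0_norm P0).
    set P := enorm _ in P0 *.
    have Pi : P^-1 != 0 by rewrite gt_eqF ?invr_gt0.
    rewrite omegaE ger0_norm ?invr_ge0 ?(ltW P0)// -!mulrA; congr (_ * _)%:E.
    rewrite mulrA -powRD; last by rewrite Pi implybT.
    rewrite -exprVn -powR_mulrn ?invr_ge0 ?(ltW P0)// -powRD.
      by rewrite cE.
    by rewrite Pi implybT.
  over.
rewrite (@integral_radial_atan _ k (EFin \o g)); first last.
- by move=> r; rewrite lee_fin.
- exact/measurable_EFinP.
set F := (X in Rintegral _ _ X).
have FE r : r \in `]0, pi / 2[%classic ->
    ((EFin \o g) r * (sphere_area k.+1 * tan r ^+ k * cos r ^- 2)%:E)%E =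
    ((sphere_area k.+1)%:E * (F r)%:E)%E.
  rewrite inE/= in_itv/= => /andP[r0 rpi].
  have cr : 0 < cos r by rewrite cos_gt0_pihalf// rpi andbT (lt_trans _ r0)// oppr_lt0 divr_gt0// pi_gt0.
  rewrite -!EFinM; congr EFin; rewrite /g /F (gtr0_norm cr) powRD; last by rewrite (gt_eqF cr) implybT.
  rewrite powR_mulrn ?(ltW cr)// /tan expr_div_n.
  rewrite (_ : kp / cos r ^+ 2 = q * xn ^+ 2 / (4 * a ^+ 2 * t * cos r ^+ 2)); last first.
    by rewrite /kp /kappa; field; rewrite !gt_eqF.
  rewrite (_ : cos r ^+ k.+2 = cos r ^+ k * cos r ^+ 2); last by rewrite -exprD addn2.
  have : 0 < cos r ^+ k by rewrite exprn_gt0.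
  move: (igamma _ _) (cos r `^ c) (cos r ^+ k) (sin r ^+ k) (sphere_area _) => I C u v A u0.
  by field; rewrite !gt_eqF.
transitivity (2%:E * \int[mu]_(r in `]0%R, (pi / 2)%R[)
    ((sphere_area k.+1)%:E * (F r)%:E))%E.
  by congr (_ * _)%E; apply: eq_integral => r; exact: FE.
have pi20 : 0 < (pi : R) / 2 by rewrite divr_gt0// pi_gt0.
have mF : measurable_fun setT (F : RT -> R).
  apply: measurable_funM; last by apply: measurable_funX; exact: measurable_sin.
  apply: measurable_funM.
    apply: (measurableT_comp (measurable_igamma lb)).
    apply: measurable_funM => //; apply: measurable_funV; apply: measurable_funM => //.
    by apply: measurable_funX; exact: measurable_cos.
  apply: (measurableT_comp (measurable_powR _)); exact: measurable_cos.
have F0 r : r \in `[0, pi / 2] -> 0 <= F r <= igamma lb 0.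
  rewrite in_itv/= => /andP[r0 rpi].
  have c0 : 0 <= cos r.
    by rewrite cos_ge0_pihalf// rpi andbT (le_trans _ r0)// oppr_le0 ltW.
  have s0 : 0 <= sin r.
    by rewrite sin_ge0_pi// r0 (le_trans rpi)// ler_pdivrMr// ler_peMr// ?ler1n// ltW// pi_gt0.
  rewrite !mulr_ge0 ?igamma_ge0 ?powR_ge0 ?exprn_ge0//=.
  have cc0 : 0 <= c by rewrite /c; nra.
  have one : 1 `^ c = 1 :> R by rewrite powR1.
  have h1 : cos r `^ c <= 1.
    by rewrite -[leRHS]one ge0_ler_powR// ?nnegrE// cos_le1.
  rewrite -[leRHS]mulr1 ler_pM ?exprn_ge0 ?mulr_ge0 ?igamma_ge0 ?powR_ge0 ?exprn_ile1 ?sin_le1//.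
  rewrite -[leRHS]mulr1 ler_pM ?igamma_ge0 ?powR_ge0 ?le_igamma//.
  by rewrite divr_ge0// ?mulr_ge0 ?sqr_ge0// ltW.
rewrite ge0_integralZl//; first last.
- by rewrite lee_fin fine_ge0.
- move=> r /=; rewrite lee_fin => rI.
  by have /andP[] : 0 <= F r <= igamma lb 0 by apply: F0; apply: subset_itv_oo_cc.
- by apply/measurable_EFinP; exact: measurable_funTS.
rewrite -(@integral_itv_bndoo R 0 (pi / 2) (EFin \o F) true false); last first.
  by apply/measurable_EFinP; exact: measurable_funTS.
rewrite -(mulrA 2) EFinM; congr (_ * _)%E; rewrite EFinM; congr (_ * _)%E.
rewrite fineK// ge0_fin_numE; last first.
  by apply: integral_ge0 => r rI; rewrite lee_fin; have /andP[] := F0 _ rI.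
apply: (@le_lt_trans _ _ (\int[mu]_(r in `[0%R, (pi / 2)%R]) (igamma lb 0)%:E)%E).
  apply: ge0_le_integral => //=.
  - by move=> r rI; rewrite lee_fin; have /andP[] := F0 _ rI.
  - by apply/measurable_EFinP; exact: measurable_funTS.
  - by move=> r rI; rewrite lee_fin; have /andP[] := F0 _ rI.
rewrite integral_cst//= lebesgue_measure_itv/= lte_fin pi20 -EFinB -EFinM ltry//.
Qed.

Lemma W_formula_theta : W_formula k.+1 a p xn t = prefactor a k.+2 p xn *
  (2 * sphere_area k.+1 * \int[mu]_(theta in `[0%R, (pi / 2)%R])
    (igamma (lambda k.+2 p) (q * xn ^+ 2 / (4 * a ^+ 2 * t * cos theta ^+ 2)) *
     cos theta `^ ((n + 4) * q - (n + 2)) * sin theta ^+ k)) `^ q^-1.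
Proof.
rewrite /W_formula sup_sphere_integrals// inv_conj_exponentE//.
by rewrite -sphere_integral_theta.
Qed.

End theta.

(** Here [1 / p = 0] and [q = 1], so no power of [a] is left, and the area of the unit sphere of the
    boundary hyperplane is [2 * Num.sqrt pi ^+ k.+1 / Gamma (k.+1%:R / 2)]. *)
Lemma prefactory {R : realType} (k : nat) (a xn : R) : 0 < a -> 0 < xn ->
  prefactor a k.+2 +oo xn * (2 * sphere_area k.+1) =
  4 / (Num.sqrt pi * Gamma (k.+1%:R / 2) * xn ^+ 2).
Proof.
move=> a0 xn0; rewrite /prefactor /cnp /conj_exponent hoelder_conjugatey /=.
rewrite !powRr0 mulr0 !addr0 powR1.
have spi : 0 < Num.sqrt (pi : R) by rewrite sqrtr_gt0 pi_gt0.
have -> : (pi : R) `^ (k.+2%:R / 2) = Num.sqrt pi ^+ k.+2.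
  by rewrite -powR12_sqrt ?pi_ge0// -powR_mulrn ?powR_ge0// -powRrM mulrC.
rewrite powR_mulrn ?(ltW xn0)//.
have SG := sphere_area_Gamma (R := R) k.
have : sphere_area k.+1 * Gamma (k.+1%:R / 2) != 0 :> R.
  by rewrite SG mulf_neq0// expf_neq0// gt_eqF.
rewrite mulf_eq0 negb_or => /andP[_ G0].
move/(canRL (mulfK G0)) : SG => ->; rewrite exprS.
have : Num.sqrt (pi : R) ^+ k.+1 != 0 by rewrite expf_neq0// gt_eqF.
move: (Gamma _) G0 (Num.sqrt _ ^+ _) => G G0 v v0.
by field; rewrite v0 G0 !gt_eqF.
Qed.

Lemma row_form_continuous (K : numFieldType) n (v : 'rV[K]_n.+1) :
  continuous (fun w : 'rV[K]_n.+1 => \sum_i w 0 i * v 0 i).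
Proof.
have coord i : continuous (fun w : 'rV[K]_n.+1 => w 0 i * v 0 i).
  move=> u; have h : (fun w : 'rV[K]_n.+1 => w 0 i) @ (u : 'rV[K]_n.+1) --> u 0 i.
    exact: coord_continuous.
  exact: (cvgM h (cvg_cst _)).
elim: (index_enum _) => [|i s ih] u.
  have -> : (fun w : 'rV[K]_n.+1 => \sum_(i <- [::]) w 0 i * v 0 i) = cst 0.
    by apply/funext => w; rewrite big_nil.
  exact: cst_continuous.
have -> : (fun w : 'rV[K]_n.+1 => \sum_(j <- i :: s) w 0 j * v 0 j) =
    (fun w => w 0 i * v 0 i + \sum_(j <- s) w 0 j * v 0 j).
  by apply/funext => w; rewrite big_cons.
exact: (cvgD (coord i u) (ih u)).
Qed.

(** * Differentiability of the potential *)

Section taylor.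
Context {R : realType}.

Definition dotpr n (v u : 'rV[R]_n) : R^o := dotp u v.

Lemma dotpr_is_linear n (v : 'rV[R]_n) : linear (dotpr v).
Proof. by move=> k u w; rewrite /dotpr dotpDl dotpZl. Qed.

HB.instance Definition _ n (v : 'rV[R]_n) :=
  GRing.isLinear.Build R 'rV[R]_n R^o *:%R (dotpr v) (dotpr_is_linear v).

Lemma dotpr_continuous n (v : 'rV[R]_n.+1) : continuous (dotpr v).
Proof. exact: row_form_continuous. Qed.

Lemma enorm_le_norm n (h : 'rV[R]_n.+1) : enorm h <= n.+1%:R * `|h|.
Proof.
have hi i : `|h 0 i| <= `|h|.
  rewrite [leRHS]mx_normrE; exact: (le_bigmax _ _ (0, i)).
rewrite -(@ler_pXn2r _ 2)// ?nnegrE ?enorm_ge0 ?mulr_ge0//.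
rewrite sqr_enorm /dotp exprMn.
apply: (@le_trans _ _ (n.+1%:R * `|h| ^+ 2)).
  rewrite mulr_natl -[X in _ *+ X](card_ord n.+1) -sumr_const.
  apply: ler_sum => i _; rewrite -expr2 -real_normK ?num_real//.
  by rewrite lerXn2r ?nnegrE.
by rewrite ler_wpM2r ?sqr_ge0// expr2 ler_peMr// ler1n.
Qed.

(** The remainder is measured in the Euclidean norm, differentiability in the sup norm;
    [enorm_le_norm] mediates, and uniqueness of the differential identifies the gradient. *)
Lemma differentiable_quadratic n (g : 'rV[R]_n.+1 -> R^o) (x v : 'rV[R]_n.+1) (C d : R) :
  0 < d -> 0 <= C ->
  (forall h, enorm h <= d -> `|g (x + h) - g x - dotp h v| <= C * enorm h ^+ 2) ->
  differentiable g x /\ gradient g x = v.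
Proof.
move=> d0 C0 gE.
have := diff_unique (f := g) (df := dotpr v) (x := x) (@dotpr_continuous n v).
set dg := (X in (X -> _) -> _) => dU; have dg0 : dg; last have dE := dU dg0.
  apply/eqaddoP => e e0.
  pose N : R := n.+1%:R; have N1 : 1 <= N by rewrite ler1n.
  have N0 : 0 < N by exact: lt_le_trans N1.
  have CN : 0 < C * N ^+ 2 + 1 by rewrite ltr_wpDl// mulr_ge0 ?sqr_ge0.
  have near0 c : 0 < c -> \forall h \near (0 : 'rV[R]_n.+1), `|h| <= c.
    by move=> c0; exact: nbhs0_le.
  near=> h => /=; rewrite /cst/=.
  have hN : enorm h <= N * `|h| := enorm_le_norm h.
  have hd : enorm h <= d.
    rewrite (le_trans hN)// mulrC -ler_pdivlMr//.
    near: h; apply: near0; exact: divr_gt0.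
  (* The summand 1 keeps the denominator positive when [C = 0]. *)
  have he : `|h| <= e / (C * N ^+ 2 + 1).
    near: h; apply: near0; exact: divr_gt0.
  rewrite [X in `|X|](_ : _ = g (x + h) - g x - dotp h v); last first.
    by rewrite -[LHS]/(g (h + x) - (g x + dotp h v)) opprD addrA (addrC h).
  rewrite (le_trans (gE _ hd))//.
  apply: (@le_trans _ _ (C * (N * `|h|) ^+ 2)).
    by rewrite ler_wpM2l// lerXn2r// ?nnegrE ?enorm_ge0// mulr_ge0// ltW.
  rewrite exprMn mulrA expr2 mulrA ler_wpM2r//.
  apply: (@le_trans _ _ ((C * N ^+ 2 + 1) * `|h|)).
    by rewrite ler_wpM2r// lerDl.
  by rewrite mulrC -ler_pdivlMr.
have gd : differentiable g x.
  by apply/diff_locallyP; rewrite dE; split => //; exact: dotpr_continuous.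
split => //; apply/rowP => i; rewrite mxE deriveE// dE.
rewrite -[LHS]/(\sum_j (delta_mx 0 i : 'rV[R]_n.+1) 0 j * v 0 j) (bigD1 i)//= mxE !eqxx mul1r big1 ?addr0// => j ji.
by rewrite mxE (negbTE ji) andbF mul0r.
Unshelve. all: by end_near. Qed.

End taylor.

(** * Integrability against bounded and Gaussian weights *)

Section weight.
Context d (T : measurableType d) {R : realType} (mu : {measure set T -> \bar R}).

(** For finite [p], [phi |f| <= phi + |f|^p]: use [|f| <= 1] or else [phi <= 1] and [|f| <= |f|^p].
    For [p = +oo], [|f|] is almost everywhere bounded. *)
Lemma integrable_bounded_weight (p : \bar R) (phi f : T -> R) :
  (1 <= p)%E -> f \in Lfun mu p -> mu.-integrable setT (EFin \o phi) ->
  (forall w, 0 <= phi w <= 1) -> (\int[mu]_w (phi w * `|f w|)%:E < +oo)%E.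
Proof.
move=> p1 fL iphi phi01.
have mphi : measurable_fun setT phi by apply/measurable_EFinP; case/integrableP : iphi.
have phiy : (\int[mu]_w (phi w)%:E < +oo)%E.
  case/integrableP : iphi => _; apply: le_lt_trans; apply: ge0_le_integral => //.
  - by move=> w _; rewrite lee_fin; case/andP : (phi01 w).
  - exact/measurable_EFinP.
  - by do 2 apply: measurableT_comp => //.
  - by move=> w _; rewrite lee_fin ler_norm.
move: (fL); rewrite inE => /andP[]; rewrite !inE/= => mf nf.
have mnf : measurable_fun setT (fun w => `|f w|) by exact: measurableT_comp.
have phi0 w : 0 <= phi w by case/andP : (phi01 w).
case: p p1 fL nf => [r| |//] p1 fL nf.
  rewrite lee_fin in p1.
  have /integrableP[mfr fry] := Lfun_integrable p1 fL.
  apply: (@le_lt_trans _ _ (\int[mu]_w ((phi w)%:E + (`|f w| `^ r)%:E))%E).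
    apply: ge0_le_integral => //.
    - by move=> w _; rewrite lee_fin mulr_ge0.
    - by apply/measurable_EFinP; exact: measurable_funM.
    - by apply: emeasurable_funD => //; exact/measurable_EFinP.
    - move=> w _; rewrite -EFinD lee_fin; have /andP[p0 pw1] := phi01 w.
      have [f1|f1] := leP `|f w| 1.
        by rewrite -[leLHS]addr0 lerD ?powR_ge0// ler_piMr.
      rewrite -[leLHS]add0r lerD// (@le_trans _ _ `|f w|)// ?ler_piMl//.
      by rewrite -[leLHS]powRr1// ler_powR// ltW.
  rewrite ge0_integralD//; first last.
  - exact/measurable_EFinP.
  - by move=> w _; rewrite lee_fin.
  rewrite lte_add_pinfty//; apply: le_lt_trans fry; apply: ge0_le_integral => //.
  - by apply: measurableT_comp.
  - by move=> w _; rewrite lee_abs.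
(* [Lnorm] at [+oo] is the essential supremum only for a nonzero measure, so the null measure is
   treated apart. *)
have [mu0|mu0] := leP (mu setT) 0%E.
  rewrite null_set_integral//; first by apply/measurable_EFinP; exact: measurable_funM.
  by apply/eqP; rewrite eq_le mu0 measure_ge0.
move: nf; rewrite /finite_norm unlock /Lnorm mu0 => nf.
have [N [N0 fN]] : exists N : R, 0 <= N /\ \forall w \ae mu, (`|f w| <= N).
  exists (fine (maxe 0%E (ess_sup mu (abse \o (EFin \o f))))).
  have mfin : maxe 0%E (ess_sup mu (abse \o (EFin \o f))) \is a fin_num.
    by rewrite ge0_fin_numE ?le_max ?lexx// gt_max ltry nf.
  split; first by rewrite fine_ge0// le_max lexx.
  have := ess_sup_ge mu (abse \o (EFin \o f)).
  by apply: filterS => w fw; rewrite -lee_fin fineK// le_max fw orbT.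
apply: (@le_lt_trans _ _ (\int[mu]_w (N%:E * (phi w)%:E))%E).
  apply: ae_ge0_le_integral => //.
  - by move=> w _; rewrite lee_fin mulr_ge0.
  - by apply/measurable_EFinP; exact: measurable_funM.
  - by move=> w _; rewrite -EFinM lee_fin mulr_ge0.
  - by apply/measurable_EFinP; apply: measurable_funM.
  - apply: filterS fN => w fw _; rewrite lee_fin mulrC ler_wpM2r//.
rewrite ge0_integralZl//.
- by rewrite lte_mul_pinfty.
- exact/measurable_EFinP.
- by move=> w _; rewrite lee_fin.
Qed.

End weight.

Section heat_weight.
Context {R : realType}.
Local Notation RT := (measurableTypeR R).
Local Notation mu := (@lebesgue_measure R).
Local Notation lambda n := (@lebesgue_tuple R n).
Variables (m : nat) (a : R) (x : 'rV[R]_m.+1) (t : R).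
Local Notation n := (m.+1%:R : R).
Local Notation P := (lambda m \x mu)%E.
Local Notation D := (slab m `]0%R, t[).
Local Notation X := (heat_exponent a x t).
Hypotheses (a0 : 0 < a) (xn0 : 0 < xlast x) (t0 : 0 < t).

Let a4 : 0 < 4 * a ^+ 2. Proof. by rewrite mulr_gt0// exprn_gt0. Qed.

Lemma dotp_sub_bdry_en (y : m.-tuple RT) : dotp (x - bdry y) (en m) = xlast x.
Proof. by rewrite dotp_en !mxE unlift_none /= subr0. Qed.

Lemma xlast_le_enorm (y : m.-tuple RT) : xlast x <= enorm (x - bdry y).
Proof.
have := dotp_le (x - bdry y) (en m).
by rewrite dotp_sub_bdry_en enorm_en mulr1 gtr0_norm.
Qed.

Lemma sqr_enorm_lateral (c : R) (y : m.-tuple RT) :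
  enorm (x - bdry (taffine (- c) (lateral x) y)) ^+ 2 =
  c ^+ 2 * enorm (rvec y) ^+ 2 + xlast x ^+ 2.
Proof.
have b0 : dotp (bdry y) (en m) = 0 by rewrite dotp_en mxE unlift_none.
rewrite sub_bdry_lateral sqr_enorm dotpDl !dotpDr !dotpZl !dotpZr dotp_bdry.
rewrite b0 [dotp (en m) _]dotpC b0 -[dotp (en m) (en m)]sqr_enorm enorm_en sqr_enorm.
by ring.
Qed.

Lemma measurable_gauss_bdry b :
  measurable_fun setT (fun y : m.-tuple RT => expR (- (b * enorm (x - bdry y) ^+ 2))).
Proof.
apply: measurableT_comp => //; apply: measurableT_comp => //.
by apply: measurable_funM => //; exact: measurable_sqr_enorm_bdry.
Qed.

Lemma integral_gauss_bdry_lty b : 0 < b ->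
  (\int[lambda m]_y (expR (- (b * enorm (x - bdry y) ^+ 2)))%:E < +oo)%E.
Proof.
move=> b0; pose c := (Num.sqrt b)^-1; have sb : 0 < Num.sqrt b by rewrite sqrtr_gt0.
have c0 : - c != 0 by rewrite oppr_eq0 invr_eq0 gt_eqF.
rewrite (ge0_integral_taffine (lateral x) c0)//; last first.
  by apply/measurable_EFinP; exact: measurable_gauss_bdry.
rewrite lte_mul_pinfty ?lee_fin ?exprn_ge0//.
apply: (@le_lt_trans _ _ (\int[lambda m]_y (expR (- enorm (rvec y) ^+ 2))%:E)%E).
  apply: ge0_le_integral => //.
  - apply/measurable_EFinP.
    by apply: (measurableT_comp (measurable_gauss_bdry b)); exact: measurable_taffine.
  - apply/measurable_EFinP; apply: measurableT_comp => //; apply: measurableT_comp => //.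
    by apply: measurable_funX; exact: measurable_enorm.
  - move=> y _; rewrite lee_fin ler_expR lerN2 sqr_enorm_lateral mulrDr mulrA.
    have -> : b * c ^+ 2 = 1 by rewrite /c exprVn sqr_sqrtr ?(ltW b0)// mulfV// gt_eqF.
    rewrite mul1r lerDl.
    by rewrite mulr_ge0 ?sqr_ge0// ltW.
by rewrite integral_gauss_tuple ltry.
Qed.

(** With [s = t - w.2], half of the exponent is at least [B / s] because [|x - y| >= x_n], and
    absorbs the power of [1 / s] by [powR_le_expR]. In the other half [s] is replaced by [t >= s],
    which leaves a fixed Gaussian in [y]. *)
Lemma heat_weight_le (l c : R) (w : m.-tuple RT * RT) : 0 <= l -> 0 < c -> D w ->
  expR (- (c * X w)) / (t - w.2) `^ l <=
  (l / (c * xlast x ^+ 2 / (2 * (4 * a ^+ 2)))) `^ l *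
    expR (- (c / (2 * (4 * a ^+ 2) * t) * enorm (x - bdry w.1) ^+ 2)).
Proof.
move=> l0 c0 [_]; rewrite /= in_itv/= => /andP[w0 wt].
set B := c * _ / _; set s := t - w.2.
have s0 : 0 < s by rewrite subr_gt0.
have B0 : 0 < B by rewrite !(divr_gt0, mulr_gt0, exprn_gt0).
have := powR_le_expR l0 B0 (ltW (_ : 0 < s^-1)); rewrite invr_gt0 => /(_ s0).
rewrite -{1}powR_inv1 ?(ltW s0)// -powRrM mulN1r powRN => h.
rewrite [leLHS]mulrC (le_trans (ler_wpM2r (expR_ge0 _) h))// -[leLHS]mulrA -expRD.
rewrite ler_wpM2l ?powR_ge0// ler_expR /heat_exponent -/s.
set A := enorm _; have A0 : xlast x ^+ 2 <= A ^+ 2.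
  by rewrite lerXn2r ?nnegrE ?enorm_ge0 ?xlast_le_enorm// ltW.
have st : t^-1 <= s^-1 by rewrite lef_pV2 ?posrE// /s lerBlDr lerDl ltW.
have -> : B / s = c / (2 * (4 * a ^+ 2)) * xlast x ^+ 2 * s^-1.
  by rewrite /B; ring.
have -> : c * (A ^+ 2 / (4 * a ^+ 2 * s)) = 2 * (c / (2 * (4 * a ^+ 2)) * A ^+ 2 * s^-1).
  by field; rewrite !gt_eqF.
have -> : c / (2 * (4 * a ^+ 2) * t) * A ^+ 2 = c / (2 * (4 * a ^+ 2)) * A ^+ 2 * t^-1.
  by field; rewrite !gt_eqF.
have k0 : 0 < c / (2 * (4 * a ^+ 2)) by rewrite divr_gt0// mulr_gt0.
move: (c / _) k0 => k k0.
have h1 : k * xlast x ^+ 2 / s <= k * A ^+ 2 / s.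
  by rewrite ler_wpM2r ?invr_ge0 ?(ltW s0)// ler_wpM2l// ltW.
have h2 : k * A ^+ 2 / t <= k * A ^+ 2 / s.
  by rewrite ler_wpM2l// mulr_ge0 ?sqr_ge0// ltW.
by lra.
Qed.

Lemma integrable_heat_weight (p : \bar R) (f k : m.-tuple RT * RT -> R) (M l c : R) :
  (1 <= p)%E -> in_Lp p f -> 0 <= M -> 0 <= l -> 0 < c -> measurable_fun setT k ->
  (forall w, D w -> `|k w| <= M * (expR (- (c * X w)) / (t - w.2) `^ l)) ->
  P.-integrable D (fun w => (k w * f w)%:E).
Proof.
move=> p1 fL M0 l0 c0 mk kM.
pose b := c / (2 * (4 * a ^+ 2) * t).
have b0 : 0 < b by rewrite /b !(divr_gt0, mulr_gt0).
(* [in_Lp] concerns all positive times; the indicator makes the weight integrable there and equals 1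
   on [D]. *)
pose phi (w : m.-tuple RT * RT) : R :=
  expR (- (b * enorm (x - bdry w.1) ^+ 2)) * \1_(`]0, t[%classic : set RT) w.2.
have mI : measurable_fun setT (\1_(`]0, t[%classic : set RT) : RT -> R).
  by apply: measurable_indic; exact: measurable_itv.
have mphi : measurable_fun setT phi.
  apply: measurable_funM; last exact: (measurableT_comp mI measurable_snd).
  exact: (measurableT_comp (measurable_gauss_bdry b) measurable_fst).
have phi0 w : 0 <= phi w by rewrite mulr_ge0 ?expR_ge0.
have phi01 w : 0 <= phi w <= 1.
  rewrite phi0/= -[leRHS]mulr1 ler_pM ?expR_ge0//.
  by rewrite -[leRHS]expR0 ler_expR oppr_le0 mulr_ge0 ?sqr_ge0// ltW.
have phiy : (\int[P]_w (phi w)%:E < +oo)%E.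
  rewrite fubini_tonelli2//; last exact/measurable_EFinP.
  rewrite /fubini_G.
  have -> : (\int[mu]_y \int[lambda m]_x0 (phi (x0, y))%:E =
     \int[mu]_y ((\int[lambda m]_z (expR (- (b * enorm (x - bdry z) ^+ 2)))%:E) *
       (\1_(`]0, t[%classic : set RT) y)%:E))%E.
    apply: eq_integral => tau _; rewrite -ge0_integralZr//.
    by apply/measurable_EFinP; exact: measurable_gauss_bdry.
  rewrite ge0_integralZl//; first last.
  - exact: integral_ge0.
  - exact/measurable_EFinP.
  rewrite integral_indic// setIT.
  have muI : mu (`]0, t[%classic : set RT) = t%:E.
    by apply: etrans (lebesgue_measure_itv _) _; rewrite /= lte_fin t0 -EFinB subr0.
  set G := (\int[lambda m]_z _)%E.
  apply: (@le_lt_trans _ _ (G * t%:E)%E); first by rewrite -muI; exact: lexx.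
  rewrite muleC lte_mul_pinfty//; first by rewrite lee_fin ltW.
  exact: integral_gauss_bdry_lty.
have restr (g : m.-tuple RT * RT -> R) : measurable_fun setT g -> (forall w, 0 <= g w) ->
    (\int[slab_measure m `]0%R, +oo[]_w (g w)%:E =
     \int[P]_(w in slab m `]0%R, +oo[) (g w)%:E)%E.
  move=> mg g0; apply: ge0_integral_mrestr; first exact/measurable_EFinP.
  by move=> w; rewrite lee_fin.
have mf : measurable_fun setT f by move: fL; rewrite /in_Lp inE => /andP[]; rewrite !inE.
have mphif : measurable_fun setT (fun w => phi w * `|f w|).
  by apply: measurable_funM => //; exact: measurableT_comp.
have phify : (\int[P]_(w in D) (phi w * `|f w|)%:E < +oo)%E.
  have : (\int[slab_measure m `]0%R, +oo[]_w (phi w * `|f w|)%:E < +oo)%E.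
    apply: (integrable_bounded_weight p1 fL) => //; apply/integrableP; split.
      exact/measurable_EFinP.
    under eq_integral => w _ do rewrite /= ger0_norm//.
    rewrite restr//; apply: le_lt_trans phiy; apply: ge0_subset_integral => //.
    - exact: measurable_slab.
    - exact/measurable_EFinP.
    - by move=> w _; rewrite lee_fin.
  rewrite restr//; last by move=> w; rewrite mulr_ge0.
  apply: le_lt_trans; apply: ge0_subset_integral => //.
  - exact: measurable_slab.
  - exact: measurable_slab.
  - by apply/measurable_EFinP; exact: measurable_funTS.
  - by move=> w _; rewrite lee_fin mulr_ge0.
  - move=> w [_ /=]; rewrite in_itv/= => /andP[w0 _].
    by split => //=; rewrite in_itv/= w0.
have mD : measurable D by exact: measurable_slab.
apply/integrableP; split.
  by apply/measurable_EFinP; apply: measurable_funTS; exact: measurable_funM.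
set C := (l / (c * xlast x ^+ 2 / (2 * (4 * a ^+ 2)))) `^ l.
apply: (@le_lt_trans _ _ (\int[P]_(w in D) ((M * C)%:E * (phi w * `|f w|)%:E))%E).
  apply: ge0_le_integral => //.
  - apply/measurable_EFinP; apply: measurable_funTS.
    by apply: measurableT_comp => //; exact: measurable_funM.
  - by apply/measurable_EFinP; apply: measurable_funTS; apply: measurable_funM.
  - move=> w Dw; rewrite -EFinM /= lee_fin normrM mulrA ler_wpM2r//.
    rewrite (le_trans (kM _ Dw))// -mulrA ler_wpM2l//.
    rewrite (le_trans (heat_weight_le l0 c0 Dw))// -/C -/b /phi indicE.
    by rewrite mem_set ?mulr1//; case: Dw.
rewrite ge0_integralZl//.
- by rewrite lte_mul_pinfty// lee_fin mulr_ge0// powR_ge0.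
- by apply/measurable_EFinP; exact: measurable_funTS.
- by move=> w _; rewrite lee_fin mulr_ge0.
- by rewrite lee_fin mulr_ge0// powR_ge0.
Qed.

End heat_weight.

(** * Taylor estimates for the Gaussian *)

Section exp_taylor.
Context {R : realType}.

(** From [1 + u <= exp u], at [u] and at [- u]; the latter reads [exp u - 1 <= u exp u]. *)
Lemma expR_remainder (u : R) : `|expR u - 1 - u| <= u ^+ 2 * expR `|u|.
Proof.
have h1 : 1 + u <= expR u := expR_ge1Dx u.
have h2 : expR u - 1 <= u * expR u.
  have := ler_wpM2r (expR_ge0 u) (expR_ge1Dx (- u)).
  by rewrite -expRD addNr expR0 mulrDl mul1r mulNr; lra.
rewrite ger0_norm; last by lra.
have [u0|u0] := leP 0 u.
  by rewrite ger0_norm// expr2 -mulrA; have := ler_wpM2l u0 h2; lra.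
have e1 : 1 <= expR `|u| by rewrite -[X in X <= _]expR0 ler_expR.
have := ler_wpM2l (sqr_ge0 u) e1; rewrite mulr1; apply: le_trans.
have eu : u * expR u <= u * (1 + u) by rewrite ler_wnM2l// ltW.
by lra.
Qed.

(** Let [X = |A|^2 / s], [y = |h|^2 / s] and [r = |A| |h| / s], so that [r^2 = X y] and
    [r <= X / 8]. The exponent changes by [d] with [|d| <= 3 r <= 3 X / 8], and the remainder is at
    most [9 X y exp (- 5 X / 8)]; by [X <= 8 exp (X / 8)] this is at most [72 y exp (- X / 2)]. The
    part [y] of [d], absent from the linear term, raises 72 to 73. *)
Lemma gauss_taylor n (A h : 'rV[R]_n) (s : R) : 0 < s -> enorm h <= enorm A / 8 ->
  `|expR (- (enorm (A + h) ^+ 2 / s)) - expR (- (enorm A ^+ 2 / s)) +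
    2 * dotp A h / s * expR (- (enorm A ^+ 2 / s))| <=
  73 * (enorm h ^+ 2 / s) * expR (- (2^-1 * (enorm A ^+ 2 / s))).
Proof.
move=> s0 hA; set X := enorm A ^+ 2 / s.
pose b := dotp A h / s; pose y := enorm h ^+ 2 / s; pose r := enorm A * enorm h / s.
have y0 : 0 <= y by rewrite /y divr_ge0 ?sqr_ge0// ltW.
have X0 : 0 <= X by rewrite /X divr_ge0 ?sqr_ge0// ltW.
have r0 : 0 <= r by rewrite /r divr_ge0 ?mulr_ge0 ?enorm_ge0// ltW.
have br : `|b| <= r.
  rewrite /b /r normrM (ger0_norm (_ : 0 <= s^-1)) ?invr_ge0 ?(ltW s0)//.
  by rewrite ler_wpM2r ?dotp_le// invr_ge0 ltW.
have si : 0 <= s^-1 by rewrite invr_ge0 ltW.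
have yr : y <= r / 8.
  have := ler_wpM2r (mulr_ge0 (enorm_ge0 h) si) hA.
  by congr (_ <= _); rewrite /y /r; ring.
have rX : r <= X / 8.
  have := ler_wpM2r (mulr_ge0 (enorm_ge0 A) si) hA.
  by congr (_ <= _); rewrite /X /r; ring.
have rr : r ^+ 2 = X * y by rewrite /r /X /y; field; rewrite gt_eqF.
have -> : enorm (A + h) ^+ 2 / s = X + (2 * b + y).
  rewrite /X /b /y !sqr_enorm dotpDl !dotpDr [dotp h A]dotpC.
  by field; rewrite gt_eqF.
rewrite -[2 * dotp A h / s]mulrA -/b.
set d := 2 * b + y; set E := expR (- X).
have -> : expR (- (X + d)) - E + 2 * b * E = E * (expR (- d) - 1 - (- d)) - E * y.
  by rewrite opprD expRD -/E /d; ring.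
have dr : `|d| <= 3 * r.
  have : `|d| <= `|2 * b| + `|y| := ler_normD _ _.
  by rewrite normrM (ger0_norm y0) ger0_norm//; lra.
have hE : E * `|expR (- d) - 1 - (- d)| <= 72 * y * expR (- (2^-1 * X)).
  apply: (@le_trans _ _ (E * (9 * (X * y) * expR (3 / 8 * X)))).
    rewrite ler_wpM2l ?expR_ge0// (le_trans (expR_remainder _))//.
    rewrite ler_pM ?sqr_ge0 ?expR_ge0// ?ler_expR ?normrN; last by lra.
    rewrite sqrrN -rr -[d ^+ 2]real_normK ?num_real//.
    have := lerXn2r 2 (normr_ge0 d) (mulr_ge0 (ler0n _ 3) r0) dr.
    by rewrite exprMn; lra.
  have hX : X <= 8 * expR (X / 8) by have := expR_ge1Dx (X / 8); lra.
  rewrite (_ : E * _ = 9 * y * (X * expR (- (5 / 8 * X)))); last first.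
    rewrite (_ : - (5 / 8 * X) = - X + 3 / 8 * X); last by field.
    by rewrite expRD -/E; ring.
  rewrite (_ : 72 * y * _ = 9 * y * ((8 * expR (X / 8)) * expR (- (5 / 8 * X)))).
    apply: ler_wpM2l; first by rewrite mulr_ge0.
    by apply: ler_wpM2r; rewrite ?expR_ge0.
  rewrite -[8 * _ * _]mulrA -expRD (_ : X / 8 + _ = - (2^-1 * X)); last by field.
  by ring.
have hE2 : E * y <= y * expR (- (2^-1 * X)).
  by rewrite mulrC ler_wpM2l// ler_expR; lra.
have E0 : 0 <= E by exact: expR_ge0.
apply: (le_trans (ler_normB _ _)).
by rewrite (normrM E) (ger0_norm E0) (ger0_norm (mulr_ge0 E0 y0)) -/y; lra.
Qed.

End exp_taylor.

(** * Differentiation of the potential under the integral sign *)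

Section potential.
Context {R : realType}.
Local Notation RT := (measurableTypeR R).
Local Notation mu := (@lebesgue_measure R).
Local Notation lambda n := (@lebesgue_tuple R n).
Variables (m : nat) (a t : R) (p : \bar R) (f : m.-tuple RT * RT -> R).
Local Notation n := (m.+1%:R : R).
Local Notation P := (lambda m \x mu)%E.
Local Notation D := (slab m `]0%R, t[).
Hypotheses (a0 : 0 < a) (t0 : 0 < t) (p1 : (1 <= p)%E) (fL : in_Lp p f).

Let a4 : 0 < 4 * a ^+ 2. Proof. by rewrite mulr_gt0// exprn_gt0. Qed.

Let mD : measurable D. Proof. exact: measurable_slab. Qed.

Definition heat_factor (x : 'rV[R]_m.+1) (w : m.-tuple RT * RT) : R :=
  expR (- heat_exponent a x t w) / (t - w.2) `^ ((n + 2) / 2).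

Lemma heat_factor_ge0 x w : 0 <= heat_factor x w.
Proof. by rewrite divr_ge0 ?expR_ge0 ?powR_ge0. Qed.

Lemma integrable_heat_factor (x : 'rV[R]_m.+1) : 0 < xlast x ->
  P.-integrable D (fun w => (heat_factor x w * f w)%:E).
Proof.
move=> xn0; apply: (integrable_heat_weight a0 xn0 t0 p1 fL (M := 1) (l := (n + 2) / 2) (c := 1)) => //.
- exact: measurable_heat_factor.
- by move=> w _; rewrite !mul1r ger0_norm ?heat_factor_ge0.
Qed.

Lemma integrable_half_heat_weight (x : 'rV[R]_m.+1) : 0 < xlast x ->
  P.-integrable D (fun w =>
    (expR (- (2^-1 * heat_exponent a x t w)) / (t - w.2) `^ ((n + 4) / 2) * f w)%:E).
Proof.
move=> xn0; apply: (integrable_heat_weight a0 xn0 t0 p1 fL (M := 1) (l := (n + 4) / 2) (c := 2^-1)) => //.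
- apply: measurable_funM.
    by apply: measurableT_comp => //; apply: measurableT_comp => //;
      apply: measurable_funM => //; exact: measurable_heat_exponent.
  apply: measurable_funV; exact: (measurableT_comp (measurable_powR ((n + 4) / 2)) (@measurable_time_to R m t)).
- by move=> w _; rewrite mul1r ger0_norm// divr_ge0 ?expR_ge0 ?powR_ge0.
Qed.

(** The linear factor is absorbed by half of the exponent: [|x - y| <= |x - y|^2 / x_n], which is
    [4 a^2 s X / x_n] with [s <= t], and [X <= 2 exp (X / 2)]. *)
Lemma gradient_kernel_le (x z : 'rV[R]_m.+1) w : 0 < xlast x -> D w ->
  `|gradient_kernel a x t z w| <=
  kernel_const m a * enorm z * (2 * (4 * a ^+ 2) * t / xlast x) *
    (expR (- (2^-1 * heat_exponent a x t w)) / (t - w.2) `^ ((n + 4) / 2)).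
Proof.
move=> xn0 [_]; rewrite /= in_itv/= => /andP[w0 wt].
have kc := kernel_const_gt0 m a0.
rewrite /gradient_kernel; move: (kernel_const m a) kc => K kc.
rewrite normrM (ger0_norm (_ : 0 <= expR _ / _)) ?divr_ge0 ?expR_ge0 ?powR_ge0//.
have cmp (d E E' Z u S : R) : 0 <= S -> d * E <= Z * (u * E') ->
    K * d * (E / S) <= K * Z * u * (E' / S).
  move=> S0 h; have -> : K * d * (E / S) = K / S * (d * E) by ring.
  have -> : K * Z * u * (E' / S) = K / S * (Z * (u * E')) by ring.
  by rewrite ler_wpM2l// divr_ge0// ltW.
rewrite normrM (ger0_norm (ltW kc)); apply: cmp; first exact: powR_ge0.
set A := x - bdry w.1; set s := t - w.2; set X := heat_exponent _ _ _ _.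
have s0 : 0 < s by rewrite subr_gt0.
have st : s <= t by rewrite /s lerBlDr lerDl ltW.
have An := xlast_le_enorm xn0 w.1; rewrite -/A in An.
have XE : enorm A ^+ 2 = 4 * a ^+ 2 * s * X.
  by rewrite /X /heat_exponent -/A -/s; field; rewrite !gt_eqF.
have X0 : 0 <= X by rewrite divr_ge0 ?sqr_ge0// mulr_ge0 ?ltW.
clearbody X.
have Ale : enorm A <= 4 * a ^+ 2 * t / xlast x * X.
  have -> : 4 * a ^+ 2 * t / xlast x * X = (4 * a ^+ 2 * t * X) / xlast x by ring.
  rewrite ler_pdivlMr// (@le_trans _ _ (enorm A ^+ 2))//.
    by rewrite expr2 ler_wpM2l ?enorm_ge0.
  by rewrite XE ler_wpM2r// ler_wpM2l// ltW.
have Xe : X <= 2 * expR (2^-1 * X) by have := expR_ge1Dx (2^-1 * X); lra.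
apply: (@le_trans _ _ (enorm A * enorm z * expR (- X))).
  by rewrite ler_wpM2r ?expR_ge0 ?dotp_le.
have -> : enorm A * enorm z * expR (- X) = enorm z * (enorm A * expR (- X)) by ring.
apply: ler_wpM2l; first exact: enorm_ge0.
have K0 : 0 <= 4 * a ^+ 2 * t / xlast x by rewrite !(mulr_ge0, invr_ge0) ?ltW.
apply: (@le_trans _ _ (4 * a ^+ 2 * t / xlast x * (2 * expR (2^-1 * X)) * expR (- X))).
  by rewrite ler_wpM2r ?expR_ge0// (le_trans Ale)// ler_wpM2l.
have -> : expR (- (2^-1 * X)) = expR (2^-1 * X) * expR (- X).
  by rewrite -expRD; congr expR; field.
by rewrite le_eqVlt; apply/orP; left; apply/eqP; ring.
Qed.

Lemma integrable_gradient_kernel (x z : 'rV[R]_m.+1) : 0 < xlast x ->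
  P.-integrable D (fun w => (gradient_kernel a x t z w * f w)%:E).
Proof.
move=> xn0; apply: (integrable_heat_weight a0 xn0 t0 p1 fL (l := (n + 4) / 2) (c := 2^-1)
  (M := kernel_const m a * enorm z * (2 * (4 * a ^+ 2) * t / xlast x))) => //.
- have kc : 0 <= kernel_const m a by rewrite ltW// kernel_const_gt0.
  have u0 : 0 <= 2 * (4 * a ^+ 2) * t / xlast x by rewrite ltW// !(mulr_gt0, invr_gt0).
  by rewrite mulr_ge0 ?(mulr_ge0 kc) ?enorm_ge0.
- exact: measurable_gradient_kernel.
- by move=> w Dw; exact: gradient_kernel_le.
Qed.

Lemma iterated_integral (g : m.-tuple RT * RT -> R) :
  P.-integrable D (EFin \o g) ->
  \int[mu]_(tau in `]0%R, t[) \int[lambda m]_y g (y, tau) = \int[P]_(w in D) g w.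
Proof.
move=> ig; have igD : P.-integrable setT ((EFin \o g) \_ D) by exact/(integrable_mkcond _ mD).
rewrite /Rintegral; congr fine.
rewrite [RHS]integral_mkcond -(integral21_prod_meas1 igD) integral_mkcond.
pose G := fubini_G (lambda m) ((EFin \o g) \_ D).
have -> : ((fun tau => (fine (\int[lambda m]_y (g (y, tau))%:E))%:E) \_ `]0%R, t[ =
    EFin \o fine \o G)%E.
  apply/funext => tau; rewrite /G /fubini_G patchE /=.
  case: ifPn => tI; last first.
    rewrite integral0_eq// => y _; rewrite patchE memNset// => -[_ /=] h.
    by move/negP: tI; apply; rewrite inE.
  congr (fine _)%:E; apply: eq_integral => y _; rewrite patchE mem_set//.
  by split => //; move: tI; rewrite inE.
have mG : measurable_fun setT G by exact: (measurable_fubini_G igD).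
apply: ae_eq_integral => //.
  by do 2 apply: measurableT_comp => //; exact: fine_measurable.
(* The inner integral is known to be finite only for almost every time; the default values of [fine]
   are confined to a null set. *)
have := ae_integrable2 igD; apply: filterS => tau itau _ /=.
by rewrite fineK// /G /fubini_G; exact: integrable_fin_num.
Qed.

(** Division by [x_n] removes the factor in front of the integral, so that only the Gaussian remains
    to be differentiated. *)
Lemma double_layerE (x : 'rV[R]_m.+1) : 0 < xlast x ->
  double_layer a f x t / xlast x =
  ((4 * a ^+ 2 * pi) `^ (n / 2))^-1 * \int[P]_(w in D) (heat_factor x w * f w).
Proof.
move=> xn0; rewrite -iterated_integral; last exact: integrable_heat_factor.
rewrite /double_layer /heat_factor /heat_exponent /=.
by rewrite mulrAC [xlast x / _ / _]mulrAC divff ?gt_eqF// mul1r.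
Qed.

Definition gradient_vector (x : 'rV[R]_m.+1) : 'rV[R]_m.+1 :=
  \row_i (- \int[P]_(w in D) (gradient_kernel a x t (delta_mx 0 i) w * f w)).

Lemma dotp_gradient_vector (x z : 'rV[R]_m.+1) : 0 < xlast x ->
  dotp z (gradient_vector x) = - \int[P]_(w in D) (gradient_kernel a x t z w * f w).
Proof.
move=> xn0; pose K i w : R := gradient_kernel a x t (delta_mx 0 i) w * f w.
have iK i : P.-integrable D (fun w => ((z 0 i)%:E * (K i w)%:E)%E).
  by apply: integrableZl => //; exact: integrable_gradient_kernel.
rewrite (_ : \int[P]_(w in D) _ = \sum_i z 0 i * \int[P]_(w in D) K i w); last first.
  rewrite /Rintegral.
  transitivity (fine (\int[P]_(w in D) \sum_i ((z 0 i)%:E * (K i w)%:E))%E).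
    congr fine; apply: eq_integral => w _.
    under eq_bigr do rewrite -EFinM; rewrite sumEFin; congr EFin.
    have -> : gradient_kernel a x t z w = \sum_i z 0 i * gradient_kernel a x t (delta_mx 0 i) w.
      rewrite /gradient_kernel.
      have -> : dotp (x - bdry w.1) z =
          \sum_i z 0 i * dotp (x - bdry w.1) (delta_mx 0 i).
        apply: eq_bigr => i _; rewrite mulrC; congr (_ * _).
        rewrite /dotp (bigD1 i)//= big1 ?addr0; first by rewrite [delta_mx _ _ _ _]mxE !eqxx mulr1.
        by move=> j ji; rewrite [delta_mx _ _ _ _]mxE (negbTE ji) andbF mulr0.
      by rewrite mulr_sumr mulr_suml; apply: eq_bigr => i _; ring.
    by rewrite mulr_suml; apply: eq_bigr => i _; rewrite -[LHS]mulrA.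
  rewrite integral_sum//.
  rewrite (eq_bigr (fun i => (z 0 i * fine (\int[P]_(w in D) (K i w)%:E))%:E)).
    by rewrite sumEFin.
  move=> i _; rewrite EFinM fineK ?integralZl//; first exact: integrable_gradient_kernel.
  by apply: integrable_fin_num => //; exact: integrable_gradient_kernel.
by rewrite -sumrN; apply: eq_bigr => i _; rewrite mxE mulrN.
Qed.

(** As [x_n <= |x - y|], the condition on [h] suits all boundary points at once, and [gauss_taylor]
    applies with [4 a^2 (t - tau)] for [s]. Its division by [s] raises the power of [t - tau] from
    [(n + 2) / 2] to [(n + 4) / 2]. *)
Lemma heat_factor_taylor (x h : 'rV[R]_m.+1) w : 0 < xlast x -> enorm h <= xlast x / 8 ->
  D w ->
  `|((4 * a ^+ 2 * pi) `^ (n / 2))^-1 * (heat_factor (x + h) w - heat_factor x w) +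
    gradient_kernel a x t h w| <=
  ((4 * a ^+ 2 * pi) `^ (n / 2))^-1 * (73 / (4 * a ^+ 2)) * enorm h ^+ 2 *
    (expR (- (2^-1 * heat_exponent a x t w)) / (t - w.2) `^ ((n + 4) / 2)).
Proof.
move=> xn0 hx [_]; rewrite /= in_itv/= => /andP[w0 wt].
have s0 : 0 < t - w.2 by rewrite subr_gt0.
rewrite /gradient_kernel /kernel_const /heat_factor /heat_exponent.
have -> : x + h - bdry w.1 = (x - bdry w.1) + h by rewrite addrAC.
have An := xlast_le_enorm xn0 w.1.
set A := x - bdry w.1 in An *; set s := t - w.2 in s0 *.
have hA : enorm h <= enorm A / 8 by lra.
have := gauss_taylor (mulr_gt0 a4 s0) hA.
have -> : s `^ ((n + 4) / 2) = s `^ ((n + 2) / 2) * s.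
  rewrite -[X in _ = _ * X]powRr1 ?(ltW s0)// -powRD; last by rewrite (gt_eqF s0) implybT.
  by congr (_ `^ _); field.
have : 0 < (4 * a ^+ 2 * pi) `^ (n / 2) by rewrite powR_gt0// mulr_gt0// pi_gt0.
have : 0 < s `^ ((n + 2) / 2) by rewrite powR_gt0.
move: (expR _) (expR _) (expR _) => E1 E2 E3.
move: (_ `^ (n / 2)) (s `^ _) => C S S0 C0 hT.
set L := (X in `|X|); set b := (X in `|X| <= _) in hT.
have -> : L = C^-1 * S^-1 * b by rewrite /L /b; field; rewrite !gt_eqF.
have CS : 0 <= C^-1 * S^-1 by rewrite mulr_ge0// invr_ge0 ltW.
rewrite normrM (ger0_norm CS); apply: le_trans (ler_wpM2l CS hT) _.
by rewrite le_eqVlt; apply/orP; left; apply/eqP; field; rewrite !gt_eqF.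
Qed.

(** The pointwise Taylor remainder is integrated against [|f|]. Apart from the factor
    [enorm h ^+ 2], its bound is integrable and independent of [h]. *)
Lemma double_layer_quadratic (x : 'rV[R]_m.+1) : 0 < xlast x ->
  differentiable (fun x0 => double_layer a f x0 t / xlast x0 : R^o) x /\
  weighted_gradient a f x t = gradient_vector x.
Proof.
move=> xn0; pose W w : R :=
  expR (- (2^-1 * heat_exponent a x t w)) / (t - w.2) `^ ((n + 4) / 2) * f w.
have iW : P.-integrable D (EFin \o W) by exact: integrable_half_heat_weight.
pose C0 := ((4 * a ^+ 2 * pi) `^ (n / 2))^-1.
have C00 : 0 <= C0 by rewrite invr_ge0 powR_ge0.
pose C := C0 * (73 / (4 * a ^+ 2)) * \int[P]_(w in D) `|W w|.
have a40 : 0 <= 73 / (4 * a ^+ 2) by rewrite divr_ge0// ltW.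
apply: (@differentiable_quadratic R m _ x _ C (xlast x / 8)).
- by rewrite divr_gt0.
- by apply: mulr_ge0; [exact: mulr_ge0|exact: Rintegral_ge0].
move=> h hx.
(* A displacement of at most [x_n / 8] stays in the half-space, so that the integral representation
   holds at [x + h] too. *)
have xhn : 0 < xlast (x + h).
  have := dotp_le h (en m); rewrite enorm_en mulr1 dotp_en => hn.
  rewrite /xlast mxE -/(xlast x); have := ler_norm (- h 0 ord_max).
  by rewrite normrN; lra.
pose U v := \int[P]_(w in D) (heat_factor v w * f w).
have E1 : double_layer a f (x + h) t / xlast (x + h) = C0 * U (x + h).
  exact: double_layerE.
have E2 : double_layer a f x t / xlast x = C0 * U x by exact: double_layerE.
have ih := integrable_heat_factor xhn; have ix := integrable_heat_factor xn0.
have UB : U (x + h) - U x =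
    \int[P]_(w in D) (heat_factor (x + h) w * f w - heat_factor x w * f w).
  by rewrite RintegralB.
have E3 := dotp_gradient_vector h xn0.
have alg (c d1 d2 d3 u1 u2 b k : R) : d1 = c * u1 -> d2 = c * u2 -> d3 = - k ->
    u1 - u2 = b -> d1 - d2 - d3 = c * b + k by move=> -> -> -> <-; ring.
have key := alg _ _ _ _ _ _ _ _ E1 E2 E3 UB.
rewrite [X in `|X|]key.
have iB : P.-integrable D
    (EFin \o (fun w => heat_factor (x + h) w * f w - heat_factor x w * f w)).
  rewrite (_ : _ \o _ = (fun w => (heat_factor (x + h) w * f w)%:E) \-
    (fun w => (heat_factor x w * f w)%:E))%E; last by apply/funext => w /=; rewrite EFinB.
  exact: integrableB.
have iC : P.-integrable D (EFin \o (fun w =>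
    C0 * (heat_factor (x + h) w * f w - heat_factor x w * f w))).
  exact: (integrableZl mD C0 iB).
have iK : P.-integrable D (EFin \o (fun w => gradient_kernel a x t h w * f w)).
  exact: integrable_gradient_kernel.
rewrite -(RintegralZl C0 mD iB) -(RintegralD mD iC iK).
have iS : P.-integrable D (EFin \o (fun w =>
    C0 * (heat_factor (x + h) w * f w - heat_factor x w * f w) +
    gradient_kernel a x t h w * f w)).
  exact: (integrableD mD iC iK).
apply: (le_trans (le_normr_Rintegral _ iS)) => //.
have -> : C * enorm h ^+ 2 =
    \int[P]_(w in D) (C0 * (73 / (4 * a ^+ 2)) * enorm h ^+ 2 * `|W w|).
  by rewrite RintegralZl//; [rewrite /C; ring|exact: integrable_norm].
apply: le_Rintegral => //.
- exact: (integrable_norm iS).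
- exact: (integrableZl mD _ (integrable_norm iW)).
move=> w Dw.
have alg2 (c u v k b : R) : c * (u * b - v * b) + k * b = (c * (u - v) + k) * b by ring.
rewrite [X in `|X| <= _]alg2 [leLHS]normrM.
have W0 : 0 <= expR (- (2^-1 * heat_exponent a x t w)) / (t - w.2) `^ ((n + 4) / 2).
  by rewrite divr_ge0 ?expR_ge0 ?powR_ge0.
rewrite [X in _ <= _ * X]normrM (ger0_norm W0) [leRHS]mulrA.
apply: ler_wpM2r => //; exact: heat_factor_taylor.
Qed.

End potential.

Lemma Lnorm_finE d (T : measurableType d) (R : realType)
    (mu : {measure set T -> \bar R}) (p : \bar R) (r : R) (f : T -> R) : p = r%:E ->
  Lnorm mu p (EFin \o f) = ((\int[mu]_w (`|f w| `^ r)%:E) `^ r^-1)%E.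
Proof. by move=> ->; rewrite unlock. Qed.

Lemma LnormyE d (T : measurableType d) (R : realType)
    (mu : {measure set T -> \bar R}) (p : \bar R) (f : T -> R) : p = +oo%E ->
  Lnorm mu p (EFin \o f) =
  if (0 < mu setT)%E then ess_sup mu (abse \o (EFin \o f)) else 0%E.
Proof. by move=> ->; rewrite unlock. Qed.

Lemma le_powR2 (R : realType) (c u v : R) : 0 <= c -> 0 <= u -> u <= v -> u `^ c <= v `^ c.
Proof. by move=> c0 u0 uv; rewrite ge0_ler_powR// nnegrE// (le_trans u0). Qed.

Lemma hoelder_fin d (T : measurableType d) (R : realType)
    (mu : {measure set T -> \bar R}) (f g : T -> R) (q r : R) :
  measurable_fun setT f -> measurable_fun setT g -> 0 < q -> 0 < r ->
  q^-1 + r^-1 = 1 ->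
  (\int[mu]_w `|f w * g w|%:E <=
   (\int[mu]_w (`|f w| `^ q)%:E) `^ q^-1 * Lnorm mu r%:E (EFin \o g))%E.
Proof.
move=> mf mg q0 r0 qr; rewrite -(Lnorm_finE mu f erefl); apply: le_trans (hoelder mu mf mg q0 r0 qr).
by rewrite Lnorm1.
Qed.

(** * Sharpness *)

Section sharpness.
Context {R : realType}.
Local Notation RT := (measurableTypeR R).
Local Notation mu := (@lebesgue_measure R).
Local Notation lambda n := (@lebesgue_tuple R n).
Variables (m : nat) (a : R) (x : 'rV[R]_m.+1) (t : R).
Local Notation n := (m.+1%:R : R).
Local Notation P := (lambda m \x mu)%E.
Local Notation D := (slab m `]0%R, t[).
Local Notation K := (gradient_kernel a x t).
Hypotheses (a0 : 0 < a) (xn0 : 0 < xlast x) (t0 : 0 < t).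

Let mD : measurable D. Proof. exact: measurable_slab. Qed.

Let mK z : measurable_fun setT (K z). Proof. exact: measurable_gradient_kernel. Qed.

Lemma ge0_integral_slab i (g : m.-tuple RT * RT -> R) : measurable_fun setT g ->
  (forall w, 0 <= g w) ->
  (\int[slab_measure m i]_w (g w)%:E = \int[P]_(w in slab m i) (g w)%:E)%E.
Proof.
move=> mg g0; apply: ge0_integral_mrestr; first exact/measurable_EFinP.
by move=> w; rewrite lee_fin.
Qed.

Lemma gradient_kernel_en_gt0 w : D w -> 0 < K (en m) w.
Proof.
move=> [_]; rewrite /= in_itv/= => /andP[w0 wt].
rewrite /gradient_kernel dotp_sub_bdry_en; apply: mulr_gt0.
  by rewrite mulr_gt0// kernel_const_gt0.
by rewrite divr_gt0 ?expR_gt0// powR_gt0// subr_gt0.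
Qed.

(** The norm of a nonzero vector [V] is its inner product with the unit vector [V / |V|]; this [z]
    depends on [f], hence the bound for all [z]. *)
Lemma gradient_boundP (p : \bar R) (C : R) : (1 <= p)%E -> 0 <= C ->
  (forall z f, enorm z = 1 -> in_Lp p f ->
    (`|\int[P]_(w in D) (K z w * f w)|%:E <= C%:E * norm_pt p t f)%E) ->
  gradient_bound a p x t C.
Proof.
move=> p1 C0 bnd f fL; have [_ ->] := double_layer_quadratic a0 t0 p1 fL xn0.
set V := gradient_vector _ _ _ _.
have [->|V0] := eqVneq V 0.
  rewrite -(scale0r (0 : 'rV[R]_m.+1)) enormZ normr0 mul0r.
  by rewrite mule_ge0// /norm_pt Lnorm_ge0.
have eV : 0 < enorm V.
  by rewrite lt0r enorm_ge0 andbT; apply: contra_neq V0; exact: enorm_eq0.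
pose z := (enorm V)^-1 *: V.
have z1 : enorm z = 1 by rewrite enormZ gtr0_norm ?invr_gt0// mulVf// gt_eqF.
have := bnd z f z1 fL; apply: le_trans.
have := dotp_gradient_vector a0 t0 p1 fL z xn0; rewrite -/V dotpZl -sqr_enorm expr2.
rewrite mulrA mulVf ?mul1r ?gt_eqF// => /(congr1 (@Num.norm _ _)).
by rewrite normrN (gtr0_norm eV) => ->.
Qed.

(** The Euclidean norm dominates the component along [e_n]. *)
Lemma sharp_gradient_bound (p : \bar R) (C : R) (f : m.-tuple RT * RT -> R) :
  (1 <= p)%E -> in_Lp p f -> gradient_bound a p x t C ->
  ((\int[P]_(w in D) (K (en m) w * f w))%:E <= C%:E * norm_pt p t f)%E.
Proof.
move=> p1 fL /(_ f fL); have [_ ->] := double_layer_quadratic a0 t0 p1 fL xn0.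
apply: le_trans; rewrite lee_fin.
have := dotp_le (gradient_vector a t f x) (en m); rewrite enorm_en mulr1; apply: le_trans.
rewrite dotpC (dotp_gradient_vector a0 t0 p1 fL (en m) xn0) normrN; exact: ler_norm.
Qed.

Lemma slab_gt0 : (0 < P D)%E.
Proof.
rewrite /slab product_measure1E//.
have lt0 : (0 < lambda m setT)%E.
  apply: (@lt_le_trans _ _ (lambda m (eball m 1))).
    by rewrite lebesgue_eball1 lte_fin ball_volume_gt0.
  by apply: le_measure; rewrite ?inE//; exact: measurable_eball.
apply: mule_gt0 => //.
have muI : mu (`]0, t[%classic : set RT) = t%:E.
  by apply: etrans (lebesgue_measure_itv _) _; rewrite /= lte_fin t0 -EFinB subr0.
apply: (@lt_le_trans _ _ t%:E); first by rewrite lte_fin.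
by rewrite -muI; exact: lexx.
Qed.

Variable p : \bar R.
Hypothesis p1 : (1 < p)%E.
Local Notation q := (conj_exponent p).

Let q1 : 1 <= q. Proof. exact: conj_exponent_ge1. Qed.
Let q0 : 0 < q. Proof. exact: lt_le_trans q1. Qed.

Let N z : \bar R := (\int[P]_(w in D) (`|K z w| `^ q)%:E)%E.

Let mKq z s : measurable_fun setT (fun w => `|K z w| `^ s).
Proof. by apply: (measurableT_comp (measurable_powR s)); exact: measurableT_comp. Qed.

Lemma integral_slab_gradient_kernel z : enorm z = 1 ->
  N z = (norm_const a x q * sphere_integral a p (xlast x) t z)%:E.
Proof.
move=> z1; rewrite EFinM -sphere_integral_fin// /kappa /Defs.lambda.
rewrite -(integral_gradient_kernel a0 xn0 t0 z q1).
rewrite /N integral_mkcond fubini_tonelli1//; first last.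
- by move=> w; apply: erestrict_ge0 => ? _; rewrite lee_fin powR_ge0.
- by apply/(measurable_restrictT _ mD); apply/measurable_EFinP; exact: measurable_funTS.
apply: eq_integral => y _; rewrite [RHS]integral_mkcond; apply: eq_integral => tau _.
rewrite !patchE; congr (if _ then _ else _).
by apply/idP/idP; rewrite !inE/=; [case|split].
Qed.

Let Nen := norm_const a x q * sphere_integral a p (xlast x) t (en m).

Let NenE : N (en m) = Nen%:E.
Proof. exact: integral_slab_gradient_kernel (enorm_en m). Qed.

(** The kernel for [e_n] is positive on [D], a set of positive measure. Powers of [Nen] are divided
    out in the proof of sharpness. *)
Lemma norm_sphere_integral_gt0 : 0 < Nen.
Proof.
rewrite -lte_fin -NenE lt0e integral_ge0 ?andbT; last first.
  by move=> w _; rewrite lee_fin powR_ge0.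
apply/eqP => N0; have := slab_gt0; rewrite lt0e => /andP[/negP + _]; apply.
have /(ae_eq_integral_abs _ mD) : (\int[P]_(w in D) `|(`|K (en m) w| `^ q)%:E| = 0)%E.
  rewrite -[RHS]N0; apply: eq_integral => w _.
  by rewrite gee0_abs// lee_fin powR_ge0.
case; first by apply/measurable_EFinP; exact: measurable_funTS.
move=> B [mB B0 DB]; rewrite -measure_le0 -B0; apply: le_measure; rewrite ?inE//.
move=> w Dw; apply: DB => /= /(_ Dw) /eqP; rewrite eqe powR_eq0.
by rewrite normr_eq0 (gt_eqF (gradient_kernel_en_gt0 Dw)).
Qed.

Lemma measure_slab_gt0 : (0 < slab_measure m `]0%R, t[ setT)%E.
Proof. by rewrite /= /mrestr setTI slab_gt0. Qed.

Let norm_const_ge0 : 0 <= norm_const a x q.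
Proof.
rewrite /norm_const divr_ge0// !mulr_ge0 ?powR_ge0// exprn_ge0// ltW//.
Qed.

Let sphere_integral_ge0 (z : 'rV[R]_m.+1) : 0 <= sphere_integral a p (xlast x) t z.
Proof. by rewrite sphere_integralRE//; apply: Rintegral_ge0 => s _; exact: sphere_fun_ge0. Qed.

Lemma inv_exponent_fin (r : R) : p = r%:E -> r^-1 = 1 - q^-1.
Proof.
move=> pr; move: p1; rewrite pr lte_fin => r1; rewrite conj_exponent_fin// invf_div.
by field; rewrite gt_eqF// (lt_trans ltr01).
Qed.

(** The bound is uniform in [z] because the sphere integral is largest at [e_n]. For [p = +oo] one
    has [q = 1], and [|f|] is replaced by its essential supremum. *)
Lemma gradient_hoelder z f : enorm z = 1 -> in_Lp p f ->
  (`|\int[P]_(w in D) (K z w * f w)|%:E <= (Nen `^ q^-1)%:E * norm_pt p t f)%E.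
Proof.
move=> z1 fL.
have mf : measurable_fun setT f by move: fL; rewrite /in_Lp inE => /andP[]; rewrite !inE.
have iKf := integrable_gradient_kernel a0 t0 (ltW p1) fL z xn0.
have mKf : measurable_fun setT (fun w => K z w * f w) by exact: measurable_funM.
have mnKf : measurable_fun setT (fun w => `|K z w * f w|) by exact: measurableT_comp.
apply: (@le_trans _ _ (\int[slab_measure m `]0%R, t[]_w `|K z w * f w|%:E)%E).
  rewrite ge0_integral_slab// /Rintegral -abse_EFin fineK; last exact: integrable_fin_num.
  by apply: le_abse_integral => //; apply/measurable_EFinP; exact: measurable_funTS.
have NzNen : norm_const a x q * sphere_integral a p (xlast x) t z <= Nen.
  by apply: ler_wpM2l; [exact: norm_const_ge0|exact: sphere_integral_le_en].
have Nz0 : 0 <= norm_const a x q * sphere_integral a p (xlast x) t z.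
  by apply: mulr_ge0; [exact: norm_const_ge0|exact: sphere_integral_ge0].
have [pE|pE] : (exists r, p = r%:E) \/ p = +oo%E.
- by move: p1; case: p => [r|//|//] _; [left; exists r|right].
- case: pE => r pr; have r1 : 1 < r by rewrite -lte_fin -pr.
  have rq := inv_exponent_fin pr.
  have qr : q^-1 + r^-1 = 1 by rewrite rq addrC subrK.
  apply: (le_trans (hoelder_fin _ (mK z) mf q0 (lt_trans ltr01 r1) qr)).
  have -> : norm_pt p t f = Lnorm (slab_measure m `]0, t[) r%:E (EFin \o f).
    by rewrite /norm_pt pr.
  apply: lee_wpmul2r; first exact: Lnorm_ge0.
  have h : (\int[slab_measure m `]0%R, t[]_w (`|K z w| `^ q)%:E = N z)%E.
    by apply: ge0_integral_slab => // w; exact: powR_ge0.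
  rewrite h (integral_slab_gradient_kernel z1) poweR_EFin lee_fin.
  have qi : 0 <= q^-1 by rewrite invr_ge0 ltW.
  exact: le_powR2 qi Nz0 NzNen.
have q1E : q = 1 by rewrite pE /conj_exponent hoelder_conjugatey.
have Nen0 := norm_sphere_integral_gt0.
rewrite [in leRHS]q1E invr1 powRr1 ?(ltW Nen0)//.
have S0 : (0 <= norm_pt p t f)%E by exact: Lnorm_ge0.
have fS : \forall w \ae slab_measure m `]0, t[, (`|f w|%:E <= norm_pt p t f)%E.
  rewrite /norm_pt (LnormyE _ _ pE) measure_slab_gt0.
  exact: ess_sup_ge (abse \o (EFin \o f)).
case: (norm_pt p t f) S0 fS => [s| |//] S0 fS; last first.
  by rewrite gt0_muley ?leey// lte_fin.
rewrite lee_fin in S0.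
apply: (@le_trans _ _ (\int[slab_measure m `]0%R, t[]_w (s%:E * `|K z w|%:E))%E).
  apply: ae_ge0_le_integral => //.
  - exact/measurable_EFinP.
  - by move=> w _; rewrite -EFinM lee_fin mulr_ge0.
  - by apply/measurable_EFinP; apply: measurable_funM => //; exact: measurableT_comp.
  - apply: filterS fS => w; rewrite lee_fin => fw _.
    by rewrite -EFinM lee_fin normrM mulrC ler_wpM2r.
rewrite ge0_integralZl//; last by apply/measurable_EFinP; exact: measurableT_comp.
rewrite muleC; apply: lee_wpmul2r; first by rewrite lee_fin.
apply: le_trans (_ : (norm_const a x q * sphere_integral a p (xlast x) t z)%:E <= _)%E.
  rewrite -(integral_slab_gradient_kernel z1) /N -ge0_integral_slab//.
  rewrite q1E; under [leRHS]eq_integral do rewrite powRr1//.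
  exact: lexx.
rewrite lee_fin; exact: NzNen.
Qed.

(* The case of equality in Hoelder's inequality. *)
Let f0 (w : m.-tuple RT * RT) : R :=
  `|K (en m) w| `^ (q - 1) * \1_(`]0, t[%classic : set RT) w.2.

Let f0_ge0 w : 0 <= f0 w. Proof. by rewrite mulr_ge0 ?powR_ge0. Qed.

Let mf0 : measurable_fun setT f0.
Proof.
apply: measurable_funM => //.
have mI : measurable_fun setT (\1_(`]0, t[%classic : set RT) : RT -> R).
  by apply: measurable_indic; exact: measurable_itv.
exact: (measurableT_comp mI measurable_snd).
Qed.

Let f0_powR (r : R) w : p = r%:E ->
  (`|f0 w| `^ r)%:E = (fun w => (`|K (en m) w| `^ q)%:E) \_ D w.
Proof.
move=> pr; have r1 : 1 < r by rewrite -lte_fin -pr.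
have qr : (q - 1) * r = q.
  by rewrite pr conj_exponent_fin//; field; rewrite subr_eq0 gt_eqF.
rewrite ger0_norm// /f0 patchE indicE.
have [wD|wD] := boolP (w \in D).
  rewrite mem_set; last by move: wD; rewrite inE => -[].
  by rewrite mulr1 -powRrM qr.
rewrite memNset; last by move=> wI; move/negP: wD; apply; rewrite inE.
by rewrite mulr0 powR0// gt_eqF// (lt_trans ltr01).
Qed.

(** Used on []0, +oo[] for membership in L^p and on []0, t[] for the norm; as [f0] vanishes outside
    []0, t[], one bound serves every interval. *)
Let Lnorm_f0 i : (Lnorm (slab_measure m i) p (EFin \o f0) <= (Nen `^ (1 - q^-1))%:E)%E.
Proof.
have Nen0 := norm_sphere_integral_gt0.
have [[r pr]|pE] : (exists r, p = r%:E) \/ p = +oo%E.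
- by move: p1; case: p => [r|//|//] _; [left; exists r|right].
- have r0 : 0 < r by rewrite -lte_fin -pr (lt_trans _ p1)// lte_fin.
  rewrite (Lnorm_finE _ _ pr) -(inv_exponent_fin pr) -poweR_EFin.
  apply: gt0_ler_poweR; rewrite ?in_itv/= ?invr_ge0 ?(ltW r0) ?lee_fin ?(ltW Nen0) ?leey ?andbT//.
    by apply: integral_ge0 => w _; rewrite lee_fin; exact: powR_ge0.
  rewrite -NenE /N.
  rewrite ge0_integral_slab//; first last.
  - by apply: (measurableT_comp (measurable_powR r)); exact: measurableT_comp.
  under eq_integral do rewrite f0_powR//.
  rewrite [leRHS]integral_mkcond; apply: ge0_subset_integral => //.
  - exact: measurable_slab.
  - by apply/(measurable_restrictT _ mD); apply/measurable_EFinP; exact: measurable_funTS.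
  - by move=> w _; apply: erestrict_ge0 => ? _; rewrite lee_fin powR_ge0.
have q1E : q = 1 by rewrite pE /conj_exponent hoelder_conjugatey.
rewrite (LnormyE _ _ pE) [in leRHS]q1E invr1 subrr powRr0.
case: ifPn => // _; apply/ess_supP; apply: nearW => w /=.
rewrite lee_fin ger0_norm// /f0 q1E subrr powRr0 mul1r.
by rewrite indicE; case: (_ \in _).
Qed.

Lemma sharp_coefficient_gt1 : sharp_coefficient a p x t (Nen `^ q^-1).
Proof.
have Nen0 := norm_sphere_integral_gt0.
split; first by apply: gradient_boundP; rewrite ?(ltW p1) ?powR_ge0//; exact: gradient_hoelder.
move=> C' bC'.
have f0L : in_Lp p f0.
  rewrite /in_Lp inE; apply/andP; split; rewrite inE//=.
  exact: le_lt_trans (Lnorm_f0 _) (ltry _).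
have := sharp_gradient_bound (ltW p1) f0L bC'.
have -> : (\int[P]_(w in D) (K (en m) w * f0 w)) = Nen.
  rewrite /Rintegral; apply: EFin_inj.
  rewrite -NenE fineK; last first.
    by rewrite /N; apply: integrable_fin_num => //; exact: (integrable_gradient_kernel a0 t0 (ltW p1) f0L).
  apply: eq_integral => w; rewrite inE => Dw; have Kw := gradient_kernel_en_gt0 Dw.
  rewrite /f0 indicE mem_set; last by case: Dw.
  rewrite mulr1 (gtr0_norm Kw) -{1}(powRr1 (ltW Kw)) -powRD; last by rewrite (gt_eqF Kw) implybT.
  by rewrite addrC subrK.
(* The left side of [h] is positive, so [C'] is; multiplying [Lnorm_f0] by [C'] then keeps its
   direction. *)
move=> h; have C'0 : 0 < C'.
  rewrite ltNge; apply/negP => C'0; move: h; apply/negP; rewrite -ltNge.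
  apply: (@le_lt_trans _ _ 0%E); last by rewrite lte_fin.
  by apply: mule_le0_ge0; rewrite ?lee_fin// /norm_pt Lnorm_ge0.
have : (Nen%:E <= C'%:E * (Nen `^ (1 - q^-1))%:E)%E.
  by apply: le_trans h _; apply: lee_wpmul2l (Lnorm_f0 _); rewrite lee_fin ltW.
rewrite -EFinM lee_fin -{1}(powRr1 (ltW Nen0)) -{1}(subrK q^-1 1) powRD; last first.
  by rewrite (gt_eqF Nen0) implybT.
by rewrite mulrC ler_pM2r// powR_gt0.
Qed.

End sharpness.

(** * The case p = 1 *)

Section exponent_one.
Context {R : realType}.
Local Notation RT := (measurableTypeR R).
Local Notation mu := (@lebesgue_measure R).
Local Notation lambda n := (@lebesgue_tuple R n).
Variables (m : nat) (a : R) (x : 'rV[R]_m.+1) (t : R).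
Local Notation n := (m.+1%:R : R).
Local Notation P := (lambda m \x mu)%E.
Local Notation D := (slab m `]0%R, t[).
Local Notation K := (gradient_kernel a x t).
Local Notation l := ((n + 4) / 2).
Local Notation xn := (xlast x).
Hypotheses (a0 : 0 < a) (xn0 : 0 < xlast x) (t0 : 0 < t).

Let mD : measurable D. Proof. exact: measurable_slab. Qed.

Let mK z : measurable_fun setT (K z). Proof. exact: measurable_gradient_kernel. Qed.

Let a4 : 0 < 4 * a ^+ 2. Proof. by rewrite mulr_gt0// exprn_gt0. Qed.

Let l0 : 0 < l. Proof. by rewrite divr_gt0// addr_gt0. Qed.

Let kc0 : 0 < kernel_const m a. Proof. exact: kernel_const_gt0. Qed.

Lemma gradient_kernel_enE w : K (en m) w =
  kernel_const m a * xn * (expR (- heat_exponent a x t w) / (t - w.2) `^ l).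
Proof. by rewrite /gradient_kernel dotp_sub_bdry_en. Qed.

Lemma enorm_sub_lateral : enorm (x - bdry (lateral x)) ^+ 2 = xn ^+ 2.
Proof.
have -> : lateral x = taffine (- 0) (lateral x) (lateral x).
  by apply: eq_from_tnth => i; rewrite [RHS]tnth_mktuple oppr0 mul0r add0r.
by rewrite sqr_enorm_lateral expr2 !mul0r add0r.
Qed.

(* With rho = |x - bdry y|, the point (x', t - s xn^2 / rho^2) of the axis has
   the same exponent rho^2 / (4 a^2 s). *)
Lemma gradient_kernel_le_axis z w : enorm z = 1 -> D w ->
  exists2 s, 0 < s < t & `|K z w| <= K (en m) (lateral x, t - s).
Proof.
move=> z1 [_]; rewrite /= in_itv/= => /andP[w0 wt].
pose s := t - w.2; have s0 : 0 < s by rewrite subr_gt0.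
pose rho := enorm (x - bdry w.1); have xr : xn <= rho := xlast_le_enorm xn0 w.1.
have r0 : 0 < rho by exact: lt_le_trans xr.
pose u := xn / rho; have u0 : 0 < u by exact: divr_gt0.
have u1 : u <= 1 by rewrite ler_pdivrMr// mul1r.
exists (s * u ^+ 2).
  rewrite mulr_gt0 ?exprn_gt0//=; apply: (@le_lt_trans _ _ s).
    by rewrite ler_piMr ?exprn_ile1// ltW.
  by rewrite /s ltrBlDr ltrDl.
rewrite gradient_kernel_enE /gradient_kernel /heat_exponent /= enorm_sub_lateral.
have -> : t - (t - s * u ^+ 2) = s * u ^+ 2 by ring.
have -> : xn ^+ 2 / (4 * a ^+ 2 * (s * u ^+ 2)) = rho ^+ 2 / (4 * a ^+ 2 * s).
  by rewrite /u; field; rewrite !gt_eqF.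
rewrite -/s -/rho; set E := expR _; have E0 : 0 <= E by exact: expR_ge0.
have -> : (s * u ^+ 2) `^ l = s `^ l * u `^ (2 * l).
  by rewrite powRM ?(ltW s0) ?sqr_ge0// (powRrM u 2) (powR_mulrn 2 (ltW u0)).
(* Moving to the axis divides by this power, which makes up for replacing the inner product, at most
   [rho = xn / u], by [xn]. *)
have ul : u `^ (2 * l) <= u.
  rewrite -[leRHS]powRr1 ?(ltW u0)//; apply: ger_powR; rewrite ?u0 ?u1//.
  by have : 1 <= n by [rewrite ler1n]; lra.
have ul0 : 0 < u `^ (2 * l) by rewrite powR_gt0.
have Sl0 : 0 < s `^ l by rewrite powR_gt0.
have dz : `|dotp (x - bdry w.1) z| <= rho by have := dotp_le (x - bdry w.1) z; rewrite z1 mulr1.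
move: (kernel_const m a) kc0 (s `^ l) (u `^ (2 * l)) Sl0 ul0 ul => k k0 S U S0 U0 UL.
rewrite normrM [X in _ * X]ger0_norm; last by rewrite divr_ge0// ltW.
rewrite normrM (gtr0_norm k0).
have -> : k * xn * (E / (S * U)) = k * (xn / U) * (E / S) by field; rewrite !gt_eqF.
apply: ler_wpM2r; first by rewrite divr_ge0// ltW.
apply: ler_wpM2l; first exact: ltW.
rewrite (le_trans dz)// ler_pdivlMr// -ler_pdivlMl// mulrC.
by rewrite -/u.
Qed.

(** By [gradient_kernel_le_axis] the supremum of all the kernels over [D] is already that of the
    kernel for [e_n] on the line [y = x'], which depends on the single parameter [s]. *)
Definition axis_sup : R :=
  sup [set K (en m) (lateral x, t - s) | s in [set s | 0 < s < t]].

Let axis_slab s : 0 < s < t -> D (lateral x, t - s).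
Proof.
move=> /andP[s0 st]; split => //=.
by rewrite in_itv/= subr_gt0 st ltrBlDr ltrDl.
Qed.

(** The estimates behind the integrability of the kernel bound it by a constant times a Gaussian,
    which is at most 1. *)
Lemma axis_has_ubound :
  has_ubound [set K (en m) (lateral x, t - s) | s in [set s | 0 < s < t]].
Proof.
pose C1 := kernel_const m a * enorm (en m : 'rV[R]_m.+1) * (2 * (4 * a ^+ 2) * t / xlast x).
pose C2 := (l / (2^-1 * xn ^+ 2 / (2 * (4 * a ^+ 2)))) `^ l.
have C10 : 0 <= C1.
  have u0 : 0 <= 2 * (4 * a ^+ 2) * t / xlast x by rewrite ltW// !(mulr_gt0, invr_gt0).
  by rewrite /C1 enorm_en mulr1; exact: (mulr_ge0 (ltW kc0) u0).
exists (C1 * C2) => _ [s /= st <-]; have Ds := axis_slab st.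
apply: (le_trans (ler_norm _)).
apply: (le_trans (gradient_kernel_le a0 t0 (en m) xn0 Ds)).
apply: ler_wpM2l => //.
have h2 : 0 < 2^-1 :> R by rewrite invr_gt0.
apply: (le_trans (heat_weight_le a0 xn0 t0 (ltW l0) h2 Ds)).
rewrite -[leRHS]mulr1; apply: ler_wpM2l; first exact: powR_ge0.
by rewrite -[leRHS]expR0 ler_expR oppr_le0 mulr_ge0 ?sqr_ge0// divr_ge0// ?mulr_ge0// ltW.
Qed.

Lemma gradient_kernel_le_sup z w : enorm z = 1 -> D w -> `|K z w| <= axis_sup.
Proof.
move=> z1 Dw; have [s st /le_trans] := gradient_kernel_le_axis z1 Dw; apply.
by apply: ub_le_sup; [exact: axis_has_ubound|exists s].
Qed.

Let axis_nonempty : [set K (en m) (lateral x, t - s) | s in [set s | 0 < s < t]] !=set0.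
Proof.
exists (K (en m) (lateral x, t - t / 2)); exists (t / 2) => //=.
by rewrite divr_gt0//= ltr_pdivrMr// ltr_pMr// ltr1n.
Qed.

Lemma axis_sup_gt0 : 0 < axis_sup.
Proof.
have [_ [s /= st _]] := axis_nonempty.
have Ds := axis_slab st; apply: (lt_le_trans (gradient_kernel_en_gt0 a0 xn0 Ds)).
by apply: ub_le_sup; [exact: axis_has_ubound|exists s].
Qed.

(* If eta < K(x', t - s0) for the kernel K on the axis, then E is the product of
   a ball around x' and ]t - s0, t - s1[, where s1 < s0: the exponential factor is
   minimal at the boundary of the ball and t - tau = s1, the other one at s0. *)
Lemma axis_superlevel eta : 0 < eta < axis_sup -> exists E : set (m.-tuple RT * RT),
  [/\ measurable E, E `<=` D, exists2 c, 0 < c & P E = c%:E &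
      forall w, E w -> eta <= K (en m) w].
Proof.
move=> /andP[eta0 etaM].
have [_ [s0 /= /andP[s00 s0t] <-]] := sup_gt axis_nonempty etaM.
rewrite gradient_kernel_enE /heat_exponent /= enorm_sub_lateral.
have -> : t - (t - s0) = s0 by ring.
set k := kernel_const m a * xn; have k0 : 0 < k by rewrite /k; exact: (mulr_gt0 kc0 xn0).
have S0 : 0 < s0 `^ l by rewrite powR_gt0.
(* [v = exp (- Y)] is the value of the exponential factor that gives exactly the level [eta] at
   [t - tau = s0]. *)
move=> hs0; pose v := eta * s0 `^ l / k; have v0 : 0 < v by rewrite divr_gt0// mulr_gt0.
have vs0 : v < expR (- (xn ^+ 2 / (4 * a ^+ 2 * s0))).
  rewrite /v ltr_pdivrMr// -ltr_pdivlMr//; apply: (lt_le_trans hs0).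
  by rewrite le_eqVlt; apply/orP; left; apply/eqP; ring.
pose Y := - ln v; have vE : v = expR (- Y) by rewrite opprK lnK.
have YX : xn ^+ 2 / (4 * a ^+ 2 * s0) < Y by move: vs0; rewrite vE ltr_expR ltrN2.
have Y0 : 0 < Y.
  by apply: lt_trans YX; rewrite divr_gt0 ?exprn_gt0// mulr_gt0.
(* On the axis the exponent equals [Y] at [t - tau = u]. Any [s1] between [u] and [s0] leaves room
   for a ball: at [t - tau = s1] the exponent equals [Y] at lateral distance [Num.sqrt d2]. *)
pose u := xn ^+ 2 / (4 * a ^+ 2 * Y).
have u0 : 0 < u by rewrite divr_gt0 ?exprn_gt0// mulr_gt0.
have us : u < s0.
  have YX' : xn ^+ 2 < Y * (4 * a ^+ 2 * s0) by rewrite -ltr_pdivrMr ?(mulr_gt0 a4 s00).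
  rewrite /u ltr_pdivrMr ?(mulr_gt0 a4 Y0)//.
  by rewrite (_ : s0 * _ = Y * (4 * a ^+ 2 * s0)); [exact: YX'|ring].
pose s1 := (s0 + u) / 2.
have s1u : u < s1 by rewrite /s1; lra.
have s1s0 : s1 < s0 by rewrite /s1; lra.
have s10 : 0 < s1 by exact: lt_trans s1u.
pose d2 := 4 * a ^+ 2 * Y * s1 - xn ^+ 2.
have d20 : 0 < d2.
  by rewrite subr_gt0 [ltRHS]mulrC -ltr_pdivrMr ?(mulr_gt0 a4 Y0).
pose B : set (m.-tuple RT) := [set y | enorm (x - bdry y) ^+ 2 <= d2 + xn ^+ 2].
have mB : measurable B.
  rewrite -[X in measurable X]setTI.
  rewrite (_ : B = (fun y : m.-tuple RT => enorm (x - bdry y) ^+ 2) @^-1` `]-oo, d2 + xn ^+ 2]%classic).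
    by apply: measurable_sqr_enorm_bdry => //; exact: measurable_itv.
  by apply/seteqP; split => y; rewrite /B /= in_itv/=.
have lB : lambda m B = ((Num.sqrt d2) ^+ m * ball_volume m)%:E.
  have m1 : - 1 != 0 :> R by rewrite oppr_eq0 oner_eq0.
  rewrite (lebesgue_tuple_affine (lateral x) m1 mB) normrN normr1 expr1n mul1e.
  rewrite -lebesgue_eball ?sqrtr_gt0//; congr (lambda m _).
  apply/seteqP; split => y; rewrite /B /eball /= sqr_enorm_lateral expr1n mul1r lerD2r.
    by move=> /ler_wsqrtr; rewrite sqrtr_sqr ger0_norm ?enorm_ge0.
  by move=> h; rewrite -(sqr_sqrtr (ltW d20)) lerXn2r ?nnegrE ?enorm_ge0 ?sqrtr_ge0.
exists (B `*` `]t - s0, t - s1[%classic); split.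
- by apply: measurableX => //; exact: measurable_itv.
- move=> w [_ /=]; rewrite in_itv/= => /andP[h1 h2]; split => //=.
  by rewrite in_itv/=; lra.
- exists ((Num.sqrt d2) ^+ m * ball_volume m * (s0 - s1)).
    apply: mulr_gt0; last by rewrite subr_gt0.
    by apply: mulr_gt0 (ball_volume_gt0 m); rewrite exprn_gt0// sqrtr_gt0.
  rewrite product_measure1E//.
  rewrite [RHS]EFinM -lB; congr (_ * _)%E.
  apply: etrans (lebesgue_measure_itv _) _; rewrite /= lte_fin ifT; last by lra.
  by rewrite -EFinB; congr EFin; ring.
- move=> w [/= Bw]; rewrite in_itv/= => /andP[h1 h2].
  have sw : s1 < t - w.2 < s0 by lra.
  case/andP: sw => sw1 sw0; have sp : 0 < t - w.2 by exact: lt_trans sw1.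
  rewrite gradient_kernel_enE -/k.
  have -> : eta = k * (expR (- Y) / s0 `^ l).
    by rewrite -vE /v; field; rewrite !gt_eqF.
  apply: ler_wpM2l; first exact: ltW.
  apply: ler_pM; rewrite ?expR_ge0 ?invr_ge0 ?powR_ge0//.
    rewrite ler_expR lerN2 /heat_exponent ler_pdivrMr ?mulr_gt0//.
    apply: (le_trans Bw); rewrite /d2 subrK.
    have -> : Y * (4 * a ^+ 2 * (t - w.2)) = 4 * a ^+ 2 * Y * (t - w.2) by ring.
    by apply: ler_wpM2l; [rewrite ltW// mulr_gt0|exact: ltW].
  rewrite lef_pV2 ?posrE ?powR_gt0//; apply: le_powR2; [exact: ltW|exact: ltW|exact: ltW].
Qed.

Section formula_near_one.
Variable r : R.
Hypothesis r1 : 1 < r.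
Local Notation q := (conj_exponent r%:E).
Local Notation W := (W_formula m a r%:E xn t).

Let p1 : (1 < r%:E)%E. Proof. by rewrite lte_fin. Qed.
Let q1 : 1 <= q. Proof. exact: conj_exponent_ge1. Qed.
Let q0 : 0 < q. Proof. exact: lt_le_trans q1. Qed.

Let qiE : q^-1 = 1 - r^-1.
Proof. by rewrite (inv_exponent_fin p1 erefl) opprB addrC subrK. Qed.

Let mKq s : measurable_fun setT (fun w => `|K (en m) w| `^ s).
Proof. by apply: (measurableT_comp (measurable_powR s)); exact: measurableT_comp. Qed.

Let iK : exists2 N, 0 < N &
  (\int[P]_(w in D) (`|K (en m) w| `^ q)%:E)%E = N%:E /\ W = N `^ q^-1.
Proof.
have NE := integral_slab_gradient_kernel a0 xn0 t0 p1 (enorm_en m).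
have WE := W_formulaE a0 p1 xn0 t0.
have N0 := norm_sphere_integral_gt0 a0 xn0 t0 p1.
by eexists; [exact: N0|split; [exact: NE|exact: WE]].
Qed.

(** Chebyshev's inequality for the L^q norm, with [1 / q = 1 - 1 / r]. *)
Lemma W_formula_ge (eta c : R) (E : set (m.-tuple RT * RT)) : 0 < eta -> 0 < c ->
  measurable E -> E `<=` D -> P E = c%:E -> (forall w, E w -> eta <= K (en m) w) ->
  eta * c `^ (1 - r^-1) <= W.
Proof.
move=> eta0 c0 mE ED PE Eeta; have [N N0 [NE ->]] := iK.
have h : eta `^ q * c <= N.
  rewrite -lee_fin -NE EFinM -PE -integral_cst//.
  apply: (@le_trans _ _ (\int[P]_(w in E) (`|K (en m) w| `^ q)%:E)%E).
    apply: ge0_le_integral => //.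
    - by move=> w _; rewrite lee_fin powR_ge0.
    - by apply/measurable_EFinP; exact: measurable_funTS.
    - move=> w Ew; rewrite lee_fin; apply: le_powR2; rewrite ?(ltW q0) ?(ltW eta0)//.
      exact: le_trans (Eeta _ Ew) (ler_norm _).
  apply: ge0_subset_integral => //.
  by apply/measurable_EFinP; exact: measurable_funTS.
rewrite -qiE; have qi0 : 0 <= q^-1 by rewrite invr_ge0 ltW.
have -> : eta * c `^ q^-1 = (eta `^ q * c) `^ q^-1.
  by rewrite powRM ?powR_ge0 ?(ltW c0)// -powRrM mulfV ?gt_eqF// powRr1// ltW.
by apply: le_powR2 => //; rewrite mulr_ge0 ?powR_ge0// ltW.
Qed.

(** Integrate [|K|^q <= M^(q - 1) |K|], and take the power [1 / q = 1 - 1 / r]. *)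
Lemma W_formula_le (M I : R) : 0 < M -> 0 < I ->
  (forall w, D w -> `|K (en m) w| <= M) ->
  (\int[P]_(w in D) `|K (en m) w|%:E)%E = I%:E ->
  W <= M * (I / M) `^ (1 - r^-1).
Proof.
move=> M0 I0 KM KI; have [N N0 [NE ->]] := iK.
have h : N <= M `^ (q - 1) * I.
  rewrite -lee_fin -NE EFinM -KI -ge0_integralZl//; first last.
  - by rewrite lee_fin powR_ge0.
  - by apply/measurable_EFinP; apply: measurable_funTS; exact: measurableT_comp.
  apply: ge0_le_integral => //.
  - by apply/measurable_EFinP; exact: measurable_funTS.
  - apply/measurable_EFinP; apply: measurable_funTS; apply: measurable_funM => //.
    exact: measurableT_comp.
  - move=> w Dw; rewrite -EFinM lee_fin.
    move: (normr_ge0 (K (en m) w)) (KM _ Dw); move: `|_| => k k0 kM.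
    rewrite -(mulr_powRB1 k0 q0) [leRHS]mulrC; apply: ler_wpM2l => //.
    by apply: le_powR2; rewrite ?subr_ge0.
have qi0 : 0 <= q^-1 by rewrite invr_ge0 ltW.
apply: (@le_trans _ _ ((M `^ (q - 1) * I) `^ q^-1)).
  by apply: le_powR2 => //; exact: ltW.
rewrite -qiE; have -> : M `^ (q - 1) * I = M `^ q * (I / M).
  by rewrite -(mulr_powRB1 (ltW M0) q0); field; rewrite gt_eqF.
have IM : 0 <= I / M by rewrite divr_ge0 ?ltW.
rewrite powRM ?powR_ge0//.
by rewrite -powRrM mulfV ?gt_eqF// powRr1// ltW.
Qed.

End formula_near_one.

Lemma powR_cvg1 (v : R) : 0 < v -> v `^ (1 - r^-1) @[r --> 1^'+] --> (1 : R).
Proof.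
move=> v0.
have -> : (fun r : R => v `^ (1 - r^-1)) = (fun r => expR ((1 - r^-1) * ln v)).
  by apply/funext => r; rewrite /powR gt_eqF.
have h : (1 - r^-1) * ln v @[r --> 1^'+] --> (0 : R).
  have : (1 - r^-1) * ln v @[r --> 1^'+] --> (1 - 1^-1) * ln v.
    apply: cvgMl; apply: cvgB; first exact: cvg_cst.
    by apply: cvg_at_right_filter; apply: cvgV => //; rewrite oner_eq0.
  by rewrite invr1 subrr mul0r.
have := cvg_comp _ _ h (@continuous_expR R 0).
by rewrite expR0.
Qed.

Lemma W_formula_cvg1 : W_formula m a r%:E xn t @[r --> 1^'+] --> axis_sup.
Proof.
have M0 := axis_sup_gt0; set M := axis_sup in M0 *.
have KM w : D w -> `|K (en m) w| <= M by apply: gradient_kernel_le_sup; exact: enorm_en.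
(* For [p = +oo] one has [q = 1], so the formula for the L^q norm gives the L^1 norm of the kernel,
   finite and positive. *)
have [I I0 KI] : exists2 I, 0 < I & (\int[P]_(w in D) `|K (en m) w|%:E)%E = I%:E.
  have NE := integral_slab_gradient_kernel a0 xn0 t0 (ltry 1) (enorm_en m).
  have N0 := norm_sphere_integral_gt0 a0 xn0 t0 (ltry (1 : R)).
  move: NE N0; rewrite /conj_exponent hoelder_conjugatey /= => NE N0.
  eexists; first exact: N0.
  rewrite -NE; apply: eq_integral => w _; by rewrite powRr1.
apply/cvgrPdist_le => e e0.
(* The level loses at most [e / 2], the limit of the lower bound the other half; the maximum with
   [M / 2] keeps the level positive. *)
pose eta := Num.max (M - e / 2) (M / 2).
have eta0 : 0 < eta by rewrite lt_max; apply/orP; right; lra.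
have etaM : eta < M by rewrite gt_max; apply/andP; split; lra.
have etae : M - e / 2 <= eta by rewrite le_max lexx.
have [E [mE ED [c c0 PE] Eeta]] := axis_superlevel (introT andP (conj eta0 etaM)).
have up : M * (I / M) `^ (1 - r^-1) @[r --> 1^'+] --> M * 1.
  by apply: cvgMr; apply: powR_cvg1; exact: divr_gt0.
have low : eta * c `^ (1 - r^-1) @[r --> 1^'+] --> eta * 1.
  by apply: cvgMr; exact: powR_cvg1.
have e2 : 0 < e / 2 by exact: divr_gt0.
move/cvgrPdist_le : up => /(_ _ e0); move/cvgrPdist_le : low => /(_ _ e2).
rewrite !mulr1 => low up; near=> r.
have r1 : 1 < r by near: r; exact: nbhs_right_gt.
have h1 := W_formula_ge r1 eta0 c0 mE ED PE Eeta.
have h2 := W_formula_le r1 M0 I0 KM KI.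
have h3 : `|eta - eta * c `^ (1 - r^-1)| <= e / 2 by near: r.
have h4 : `|M - M * (I / M) `^ (1 - r^-1)| <= e by near: r.
move: h3 h4; rewrite !ler_norml => /andP[_ h3] /andP[h4 _].
by apply/andP; split; lra.
Unshelve. all: by end_near. Qed.

Lemma sharp_coefficient_1 : sharp_coefficient a 1 x t axis_sup.
Proof.
have M0 := axis_sup_gt0; split.
  apply: gradient_boundP => //; first exact: ltW.
  move=> z f z1 fL.
  have mf : measurable_fun setT f by move: fL; rewrite /in_Lp inE => /andP[]; rewrite !inE.
  have mKf : measurable_fun setT (fun w => K z w * f w) by exact: measurable_funM.
  have mnf : measurable_fun setT (fun w => `|f w|) by exact: measurableT_comp.
  have iKf := integrable_gradient_kernel a0 t0 (lexx _) fL z xn0.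
  apply: (@le_trans _ _ (\int[P]_(w in D) `|K z w * f w|%:E)%E).
    rewrite /Rintegral -abse_EFin fineK; last exact: integrable_fin_num.
    by apply: le_abse_integral => //; apply/measurable_EFinP; exact: measurable_funTS.
  have -> : norm_pt 1 t f = (\int[P]_(w in D) `|f w|%:E)%E.
    by rewrite /norm_pt Lnorm1 -ge0_integral_slab.
  rewrite -ge0_integralZl//.
  - apply: ge0_le_integral => //.
    + by apply/measurable_EFinP; apply: measurable_funTS; exact: measurableT_comp.
    + by apply/measurable_EFinP; apply: measurable_funTS; exact: measurable_funM.
    + move=> w Dw; rewrite -EFinM lee_fin normrM; apply: ler_wpM2r => //.
      exact: gradient_kernel_le_sup.
  - by apply/measurable_EFinP; exact: measurable_funTS.
  - by rewrite lee_fin ltW.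
move=> C' bC'; rewrite leNgt; apply/negP => C'M.
(* A level between [C'] and the supremum that is positive whatever the sign of [C']. The indicator
   of a set of positive measure on which the kernel is at least [eta] contradicts the bound [C']. *)
pose eta := Num.max ((C' + axis_sup) / 2) (axis_sup / 2).
have eta0 : 0 < eta by rewrite lt_max; apply/orP; right; lra.
have etaM : eta < axis_sup by rewrite gt_max; apply/andP; split; lra.
have etaC : C' < eta by rewrite lt_max; apply/orP; left; lra.
have [E [mE ED [c c0 PE] Eeta]] := axis_superlevel (introT andP (conj eta0 etaM)).
have mI : measurable_fun setT (\1_E : m.-tuple RT * RT -> R) by exact: measurable_indic.
have L1 i : D `<=` slab m i -> Lnorm (slab_measure m i) 1 (EFin \o \1_E) = c%:E.
  move=> Di; rewrite Lnorm1.
  transitivity (\int[slab_measure m i]_w (\1_E w)%:E)%E.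
    by apply: eq_integral => w _; rewrite /= ger0_norm.
  rewrite ge0_integral_slab// integral_indic//; last exact: measurable_slab.
  by rewrite setIidl ?PE//; exact: subset_trans Di.
have EL : in_Lp 1 (\1_E : m.-tuple RT * RT -> R).
  rewrite /in_Lp inE; apply/andP; split; rewrite inE//=.
  rewrite /finite_norm L1 ?ltry// => w [_ /=]; rewrite !in_itv/= => /andP[w0 _].
  by split => //=; rewrite in_itv/= w0.
have := sharp_gradient_bound a0 xn0 t0 (lexx _) EL bC'.
rewrite /norm_pt L1// -EFinM lee_fin; apply/negP; rewrite -ltNge.
apply: (@lt_le_trans _ _ (eta * c)); first by rewrite ltr_pM2r.
rewrite -lee_fin /Rintegral fineK; last first.
  apply: integrable_fin_num => //; exact: (integrable_gradient_kernel a0 t0 (lexx _) EL).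
rewrite EFinM -PE -integral_cst//.
apply: (@le_trans _ _ (\int[P]_(w in E) (K (en m) w)%:E)%E).
  apply: ge0_le_integral => //.
  - by move=> w _; rewrite lee_fin ltW.
  - by apply/measurable_EFinP; exact: measurable_funTS.
rewrite le_eqVlt; apply/orP; left; apply/eqP.
rewrite [LHS]integral_mkcond [RHS]integral_mkcond; apply: eq_integral => w _.
rewrite !patchE indicE; have [wE|wE] := boolP (w \in E).
  by rewrite mulr1 mem_set//; apply: ED; rewrite inE in wE.
by rewrite mulr0 if_same.
Qed.

End exponent_one.

Theorem proposition2 (R : realType) (m : nat) (a : R) (p : \bar R)
    (x : 'rV[R]_m.+1) (t : R) (hm : (0 < m)%N) (ha : 0 < a) (hp : (1 <= p)%E)
    (hx : 0 < xlast x) (ht : 0 < t) :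
  let n := m.+1 in
  let xn := xlast x in
  [/\ forall f : m.-tuple (measurableTypeR R) * measurableTypeR R -> R,
        in_Lp p f ->
        differentiable (fun x0 => double_layer a f x0 t / xlast x0) x,
      sharp_coefficient a p x t (sharp_W m a p xn t),
      ((1 < p)%E ->
        [/\ exists2 z : 'rV[R]_m.+1, enorm z = 1 &
              sphere_integral a p xn t z = sup (sphere_integrals m a p xn t) /\
              forall z' : 'rV[R]_m.+1, enorm z' = 1 ->
                sphere_integral a p xn t z' <= sphere_integral a p xn t z,
            kappa a p xn t = at_exponent
              (fun r => r * xn ^+ 2 / (4 * a ^+ 2 * (r - 1) * t)) p &
            lambda n p = at_exponent
              (fun r => (n%:R * r + 4) / (2 * (r - 1))) p]) /\
      (p = 1%E -> cvg (W_formula m a r%:E xn t @[r --> 1^'+])),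
      ((2%:R)%:E <= p)%E ->
        sharp_W m a p xn t =
        prefactor a n p xn *
        (2 * sphere_area n.-1 *
         \int[lebesgue_measure]_(theta in `[0, pi / 2])
           ((\int[lebesgue_measure]_(xi in
                `[conj_exponent p * xn ^+ 2 /
                  (4 * a ^+ 2 * t * cos theta ^+ 2), +oo[)
               (xi `^ at_exponent (fun r => (n%:R * r + 4) / (2 * (r - 1))) p *
                expR (- xi))) *
            cos theta `^
              at_exponent (fun r => (n%:R + 2 * (r + 1)) / (r - 1)) p *
            sin theta ^+ (n - 2)))
          `^ at_exponent (fun r => (r - 1) / r) p &
      p = +oo%E ->
        sharp_W m a p xn t =
        4 / (Num.sqrt pi * Gamma ((n%:R - 1) / 2) * xn ^+ 2) *
        \int[lebesgue_measure]_(theta in `[0, pi / 2])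
          ((\int[lebesgue_measure]_(xi in
               `[xn ^+ 2 / (4 * a ^+ 2 * t * cos theta ^+ 2), +oo[)
              (xi `^ (n%:R / 2) * expR (- xi))) *
           cos theta ^+ 2 * sin theta ^+ (n - 2))].
Proof.
(* Now [n = k + 2], so the boundary hyperplane has positive dimension [k + 1] and admits polar
   coordinates. *)
move=> n xn; case: m hm x hx @n @xn => // k _ x hx n xn.
have sW1 : p = 1%E -> sharp_W k.+1 a p xn t = axis_sup a x t.
  by move=> ->; rewrite /sharp_W eqxx; apply: cvg_lim => //; exact: W_formula_cvg1.
have sWp : (1 < p)%E -> sharp_W k.+1 a p xn t = W_formula k.+1 a p xn t.
  by move=> p1; rewrite /sharp_W gt_eqF.
have theta : (1 < p)%E -> sharp_W k.+1 a p xn t =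
    prefactor a n p xn * (2 * sphere_area n.-1 *
     \int[lebesgue_measure]_(theta in `[0, pi / 2])
       ((\int[lebesgue_measure]_(xi in
            `[conj_exponent p * xn ^+ 2 / (4 * a ^+ 2 * t * cos theta ^+ 2), +oo[)
           (xi `^ at_exponent (fun r => (n%:R * r + 4) / (2 * (r - 1))) p *
            expR (- xi))) *
        cos theta `^ at_exponent (fun r => (n%:R + 2 * (r + 1)) / (r - 1)) p *
        sin theta ^+ (n - 2)))
      `^ at_exponent (fun r => (r - 1) / r) p.
  move=> p1; rewrite sWp// (W_formula_theta ha p1 hx ht).
  rewrite (lambdaE p1 n) (exponent_cos_thetaE p1 n) (inv_conj_exponentE p1).
  by rewrite /n subSS subSS subn0.
split.
- by move=> f fL; have [] := double_layer_quadratic ha ht hp fL hx.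
- have [p1|p1] := eqVneq p 1%E.
    by rewrite sW1// p1; exact: sharp_coefficient_1.
  have {}p1 : (1 < p)%E by rewrite lt_neqAle eq_sym p1.
  rewrite sWp// (W_formulaE ha p1 hx ht); exact: sharp_coefficient_gt1.
- split=> [p1|p1]; last first.
    by apply/cvg_ex; exists (axis_sup a x t); exact: W_formula_cvg1.
  split; last 2 first.
  + by rewrite (kappaE p1).
  + by rewrite (lambdaE p1).
  exists (en k.+1); first exact: enorm_en.
  split; first by rewrite (sup_sphere_integrals ha p1 hx ht).
  by move=> z z1; exact: sphere_integral_le_en.
- by move=> p2; apply: theta; apply: lt_le_trans p2; rewrite lte_fin ltr1n.
move=> pE; have p1 : (1 < p)%E by rewrite pE ltry.
rewrite (theta p1) (inv_conj_exponentE p1) (lambdaE p1 n) (exponent_cos_thetaE p1 n).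
have q1 : conj_exponent p = 1 by rewrite pE /conj_exponent hoelder_conjugatey.
rewrite /lambda q1 invr1 powRr1; last first.
  apply: mulr_ge0; first by rewrite mulr_ge0// fine_ge0.
  apply: Rintegral_ge0 => th; rewrite /= in_itv/= => /andP[th0 thpi].
  rewrite mulr_ge0 ?mulr_ge0 ?powR_ge0 ?exprn_ge0//.
    by apply: Rintegral_ge0 => xi _; rewrite mulr_ge0 ?powR_ge0 ?expR_ge0.
  apply: sin_ge0_pi; rewrite th0/= (le_trans thpi)// ler_pdivrMr// ler_peMr ?ler1n//.
  exact: pi_ge0.
rewrite mulrA pE (prefactory k ha hx).
have -> : (n%:R - 1) / 2 = k.+1%:R / 2 :> R by rewrite /n -natr1 addrK.
congr (_ * _); apply: eq_Rintegral => th; rewrite inE/= in_itv/= => /andP[th0 thpi].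
have c0 : 0 <= cos th.
  rewrite cos_ge0_pihalf// thpi andbT (le_trans _ th0)// oppr_le0 divr_ge0//.
  exact: pi_ge0.
have e1 : (n%:R + 4) * 1 / 2 - 2 = n%:R / 2 :> R by field.
have e2 : (n%:R + 4) * 1 - (n%:R + 2) = 2%:R :> R by ring.
by rewrite e1 e2 (mul1r (xn ^+ 2)) (powR_mulrn 2 c0).
Qed.
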